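(* Let $q\ge2$, $d=2^q$, let $p,m\in\mathbb{N}_0$ with $0\le m\le p$, and let $\mathbf{x},\mathbf{x}'\in\mathbb{R}^d$ be given in generalized Hopf coordinates, with $r,r',R,R'>0$ and $r\neq r'$. Then, with $m_1=m$, $n_1=n$, $M=\sum_{j=1}^{d/2}m_j$, $N=\sum_{k=1}^{d/2-1}n_k$, $$\begin{aligned} &\frac{1}{(p+m)!(p-m)!}\left(\log(RR')+\log(\chi+\sqrt{\chi^2-1})+2H_{2p}-H_{p+m}-H_{p-m}\right)Q_{m-\frac12}^{p+\frac12}(\chi)\\ &+\frac1{(p+m)!}\sum_{k=0}^{p-m-1}\frac{2m+2k+1}{k!(p-m-k)(p+m+k+1)}\left[1+\frac{k!(p+m)!}{(2m+k)!(p-m)!}\right]Q_{m-\frac12}^{m+k+\frac12}(\chi)\\ &+\frac1{(p-m)!}\sum_{k=0}^{m-1}\frac{2k+1}{(m+k)!(p-k)(p+k+1)}Q_{m-\frac12}^{k+\frac12}(\chi)\\ &=(-1)^{m+\frac d2-1}2^{\frac d2-1}\left(\frac{rr'}{RR'}\right)^p(\chi^2-1)^{-\frac p2-\frac14}\left(\frac{r_>^2-r_<^2}{2rr'}\right)^{p+\frac{d-1}2}\\ &\times\Biggl\{\sum_{m_2=0}^{p-m}\epsilon_{m_2}\cos(m_2(\phi_2-\phi_2'))\cdots\sum_{m_j=0}^{p-\sum_{i=1}^{j-1}m_i}\epsilon_{m_j}\cos(m_j(\phi_j-\phi_j'))\cdots\sum_{m_{d/2}=0}^{p-\sum_{i=1}^{d/2-1}m_i}\epsilon_{m_{d/2}}\cos(m_{d/2}(\phi_{d/2}-\phi_{d/2}'))\\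 &\quad\times(-1)^M\sum_{n_{d/2-1}=0}^{\lfloor\frac{p-M}2\rfloor}\Psi_{d/2-1}\cdots\sum_{n=0}^{\lfloor\frac{p-M-2\sum_{i=2}^{d/2-1}n_i}{2}\rfloor}\Psi_1\\ &\quad\times\biggl(\frac{2\log r_>+2H_{2p+d-2}+H_p-H_{p+\frac d2-1}-H_{p+M+2N+d-2}-H_{p-2N-M}}{(p-2N-M)!(p+2N+M+d-2)!}Q_{2N+M+\frac{d-3}2}^{p+\frac{d-1}2}(\zeta)\\ &\quad+\frac1{(p+2N+M+d-2)!}\sum_{k=0}^{p-2N-M-1}\frac{4N+2M+2k+d-1}{k!(p-k-2N-M)(p+k+2N+M+d-1)}\\ &\qquad\times\left[1+\frac{k!(p+2N+M+d-2)!}{(k+4N+2M+d-2)!(p-2N-M)!}\right]Q_{2N+M+\frac{d-3}2}^{k+2N+M+\frac{d-1}2}(\zeta)\\ &\quad+\frac1{(p-2N-M)!}\sum_{k=0}^{2N+M+\frac d2-2}\frac{2k+1}{(2N+M+k+\frac d2-1)!(p+\frac d2-k-1)(p+k+\frac d2)}Q_{2N+M+\frac{d-3}2}^{k+\frac12}(\zeta)\biggr)\\ &+(-1)^{p+1}\sum_{m_2=0}^\infty\epsilon_{m_2}\cos(m_2(\phi_2-\phi_2'))\cdots\sum_{m_{d/2}=0}^\infty\epsilon_{m_{d/2}}\cos(m_{d/2}(\phi_{d/2}-\phi_{d/2}'))\sum_{n_{d/2-1}=0}^\infty\Psi_{d/2-1}\cdots\sum_{n_2=0}^\infty\Psi_2\\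 &\quad\times\sum_{n=\max\left(0,\left\lfloor\frac{p-M-2\sum_{i=2}^{d/2-1}n_i}{2}\right\rfloor+1\right)}^\infty\frac{(2N+M-p-1)!}{(2N+M+p+d-2)!}\,\Psi_1\,Q_{2N+M+\frac{d-3}2}^{p+\frac{d-1}2}(\zeta)\Biggr\}. \end{aligned}$$ In the first multi-sum the sum over $n_k$ runs from $0$ to $\left\lfloor\frac12\left(p-M-2\sum_{i=k+1}^{d/2-1}n_i\right)\right\rfloor$. (For $d=4$ there is only one index $n=n_1$ in each multi-sum.)
   Context: $\mathbb{N}_0=\{0,1,2,\ldots\}$; $H_n=\sum_{j=1}^n\frac1j$ ($n\ge1$), $H_0=0$; empty sums are $0$; $\epsilon_m=2-\delta_{m,0}$; $r_>=\max\{r,r'\}$, $r_<=\min\{r,r'\}$. Generalized Hopf coordinates on $\mathbb{R}^d$, $d=2^q$: radius $r\ge0$, angles $\vartheta_k\in[0,\frac\pi2]$ ($1\le k\le\frac d2-1$), $\phi_j\in[-\pi,\pi)$ ($1\le j\le\frac d2$). Define $\rho_1=r$, $\rho_{2k}=\rho_k\cos\vartheta_k$, $\rho_{2k+1}=\rho_k\sin\vartheta_k$ for $1\le k\le\frac d2-1$; then for $\frac d2\le j\le d-1$, $x_{2j-d+1}=\rho_j\cos\phi_{d-j}$ and $x_{2j-d+2}=\rho_j\sin\phi_{d-j}$. Put $R=\rho_{d-1}$, so $x_{d-1}=R\cos\phi_1$, $x_d=R\sin\phi_1$. Primed quantities refer to $\mathbf{x}'$. Put $$\zeta=\frac{r^2+r'^2}{2rr'},\qquad\chi=\frac{R^2+R'^2+\sum_{j=1}^{d-2}(x_j-x_j')^2}{2RR'}.$$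 Quantum numbers: given $m_1,\ldots,m_{d/2}\in\mathbb{N}_0$ and $n_1,\ldots,n_{d/2-1}\in\mathbb{N}_0$, set $l_j=m_{d-j}$ for $\frac d2\le j\le d-1$ and recursively $l_k=2n_k+l_{2k}+l_{2k+1}$ for $k=\frac d2-1,\ldots,1$ (so $l_1=2N+M$). For $1\le k\le\frac d2-1$ put $\alpha_k=l_{2k}-1+2^{\log_2(d/4)-\lfloor\log_2k\rfloor}$, $\beta_k=l_{2k+1}-1+2^{\log_2(d/4)-\lfloor\log_2k\rfloor}$, $$\Upsilon_k(\vartheta)=\sqrt{\frac{(2n_k+\alpha_k+\beta_k+1)(n_k+\alpha_k+\beta_k)!\,n_k!}{(n_k+\alpha_k)!(n_k+\beta_k)!}}\,(\cos\vartheta)^{l_{2k}}(\sin\vartheta)^{l_{2k+1}}P_{n_k}^{(\beta_k,\alpha_k)}(\cos2\vartheta),$$ and $\Psi_k=\Upsilon_k(\vartheta_k)\Upsilon_k(\vartheta_k')$, where $P_n^{(\alpha,\beta)}$ is the Jacobi polynomial. In each multi-sum the whole expression to the right of each summation sign is summed. For $z>1$ the associated Legendre function of the second kind is $$Q_\nu^\mu(z)=\frac{\sqrt{\pi}\,e^{i\pi\mu}\,\Gamma(\nu+\mu+1)(z^2-1)^{\mu/2}}{2^{\nu+1}\Gamma(\nu+\frac32)z^{\nu+\mu+1}}\,{}_2F_1\!\left(\tfrac{\nu+\mu+1}{2},\tfrac{\nu+\mu+2}{2};\nu+\tfrac32;\tfrac1{z^2}\right).$$ *)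

(* Defs.v *)
From Stdlib Require Export Reals ZArith Arith List.
From Coquelicot Require Export Coquelicot.
Open Scope R_scope.

(** * Special functions *)

Definition harmonic (n : nat) : R := sum_n_m (fun j => / INR j) 1 n.

(* Euler's integral, meaningful for [0 < x]; [LegendreQ] is only ever used with
   [nu + mu + 1 > 0] and [nu + 3/2 > 0]. *)
Definition Gamma (x : R) : R :=
  RInt_gen (fun t => Rpower t (x - 1) * exp (- t))
           (at_right 0) (Rbar_locally p_infty).

Fixpoint pochhammer (a : R) (n : nat) : R :=
  match n with
  | O => 1
  | S n' => pochhammer a n' * (a + INR n')
  end.

Definition hyp2F1 (a b c z : R) : R :=
  PSeries (fun n => pochhammer a n * pochhammer b n
                    / (pochhammer c n * INR (fact n))) z.

(* P_n^(alpha,beta)(x) = (alpha+1)_n / n! 2F1(-n, n+alpha+beta+1; alpha+1; (1-x)/2);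
   the series terminates. *)
Definition JacobiP (n : nat) (alpha beta x : R) : R :=
  pochhammer (alpha + 1) n / INR (fact n)
  * hyp2F1 (- INR n) (INR n + alpha + beta + 1) (alpha + 1) ((1 - x) / 2).

(* e^(i t) *)
Definition expi (t : R) : C := (cos t, sin t).

(* Q_nu^mu(z) for z > 1 *)
Definition LegendreQ (nu mu z : R) : C :=
  (expi (PI * mu)
   * RtoC (sqrt PI * Gamma (nu + mu + 1) * Rpower (z ^ 2 - 1) (mu / 2)
           / (Rpower 2 (nu + 1) * Gamma (nu + 3 / 2) * Rpower z (nu + mu + 1))
           * hyp2F1 ((nu + mu + 1) / 2) ((nu + mu + 2) / 2) (nu + 3 / 2)
                    (1 / z ^ 2)))%C.

(** * Sums *)

(* Sum over [lo <= i <= hi]; zero if [hi < lo]. *)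
Definition Csum (lo hi : nat) (f : nat -> C) : C :=
  @sum_n_m C_AbelianMonoid f lo hi.

(* Sum over [0 <= k < n], i.e. [0 <= k <= n - 1] with [n - 1] taken in Z, so
   that it is empty for [n = 0]. *)
Definition Csum_lt (n : nat) (f : nat -> C) : C :=
  match n with
  | O => RtoC 0
  | S n' => Csum 0 n' f
  end.

Definition nat_sum (lo hi : nat) (f : nat -> nat) : nat :=
  list_sum (map f (seq lo (hi + 1 - lo))).

Definition update (v : nat -> nat) (j i : nat) : nat -> nat :=
  fun j' => if Nat.eqb j' j then i else v j'.

(* Nested sum over the indices v_j for j in [js], outermost first; v_j runs over
   [0 .. hi j v] and contributes the factor [w j v], where [v] holds the values
   of the indices bound so far. *)
Fixpoint multisum (js : list nat) (hi : nat -> (nat -> nat) -> nat)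
    (w : nat -> (nat -> nat) -> R) (F : (nat -> nat) -> C) (v : nat -> nat) : C :=
  match js with
  | nil => F v
  | j :: js' =>
      Csum 0 (hi j v) (fun i =>
        (RtoC (w j (update v j i)) * multisum js' hi w F (update v j i))%C)
  end.

(* [s] is the value of the iterated infinite series over the indices v_j for j in
   [js], outermost first, v_j running over [lo j v, lo j v + 1, ...]; every inner
   series is required to converge. [F v s] says that the innermost expression
   has value [s]; it is a relation so that multi-series can be nested. *)
Fixpoint is_multiseries (js : list nat) (lo : nat -> (nat -> nat) -> nat)
    (w : nat -> (nat -> nat) -> R) (F : (nat -> nat) -> C -> Prop)
    (v : nat -> nat) (s : C) : Prop :=
  match js with
  | nil => F v s
  | j :: js' =>
      exists g : nat -> C,
        (forall i, is_multiseries js' lo w F (update v j (lo j v + i)%nat) (g i))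
        /\ @is_series R_AbsRing C_R_NormedModule
             (fun i => (RtoC (w j (update v j (lo j v + i)%nat)) * g i)%C) s
  end.

(** * Generalized Hopf coordinates on R^d, d = 2^q *)

(* All families (x_j, theta_k, phi_j, rho_k, m_j, n_k, l_k) are indexed from 1, as
   in the mathematics; values outside the stated index ranges are irrelevant. *)

Definition coord {d : nat} (x : Tn d R) (i : nat) : R := coeff_Tn 0 x (i - 1).

Record hopf_coordinates (q : nat) (x : Tn (2 ^ q) R)
    (r : R) (theta phi rho : nat -> R) : Prop := {
  hopf_radius : 0 <= r;
  hopf_theta : forall k, (1 <= k <= 2 ^ q / 2 - 1)%nat -> 0 <= theta k <= PI / 2;
  hopf_phi : forall j, (1 <= j <= 2 ^ q / 2)%nat -> - PI <= phi j < PI;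
  hopf_rho_root : rho 1%nat = r;
  hopf_rho_even : forall k, (1 <= k <= 2 ^ q / 2 - 1)%nat ->
    rho (2 * k)%nat = rho k * cos (theta k);
  hopf_rho_odd : forall k, (1 <= k <= 2 ^ q / 2 - 1)%nat ->
    rho (2 * k + 1)%nat = rho k * sin (theta k);
  hopf_x_odd : forall j, (2 ^ q / 2 <= j <= 2 ^ q - 1)%nat ->
    coord x (2 * j + 1 - 2 ^ q) = rho j * cos (phi (2 ^ q - j)%nat);
  hopf_x_even : forall j, (2 ^ q / 2 <= j <= 2 ^ q - 1)%nat ->
    coord x (2 * j + 2 - 2 ^ q) = rho j * sin (phi (2 ^ q - j)%nat)
}.

Definition zeta (r r' : R) : R := (r ^ 2 + r' ^ 2) / (2 * r * r').

Definition chi {d : nat} (x x' : Tn d R) (R0 R0' : R) : R :=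
  (R0 ^ 2 + R0' ^ 2 + sum_n_m (fun j => (coord x j - coord x' j) ^ 2) 1 (d - 2))
  / (2 * R0 * R0').

(** * Quantum numbers and normalized angular functions *)

(* l_k for a node k at height h above the leaves d/2 <= k <= d - 1 of the binary
   tree in which k has children 2k and 2k + 1. *)
Fixpoint l_at_height (h d : nat) (m n : nat -> nat) (k : nat) : nat :=
  match h with
  | O => m (d - k)%nat
  | S h' => (2 * n k + l_at_height h' d m n (2 * k)
             + l_at_height h' d m n (2 * k + 1))%nat
  end.

Definition lnum (q : nat) (m n : nat -> nat) (k : nat) : nat :=
  l_at_height (q - 1 - Nat.log2 k) (2 ^ q) m n k.

(* For 1 <= k <= d/2 - 1 the natural-number subtractions below are exact, and
   log2 (d/4) = q - 2. *)
Definition alpha (q : nat) (m n : nat -> nat) (k : nat) : nat :=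
  (lnum q m n (2 * k) + 2 ^ (q - 2 - Nat.log2 k) - 1)%nat.

Definition beta (q : nat) (m n : nat -> nat) (k : nat) : nat :=
  (lnum q m n (2 * k + 1) + 2 ^ (q - 2 - Nat.log2 k) - 1)%nat.

Definition Upsilon (q : nat) (m n : nat -> nat) (k : nat) (t : R) : R :=
  let a := alpha q m n k in
  let b := beta q m n k in
  sqrt (INR (2 * n k + a + b + 1) * INR (fact (n k + a + b)) * INR (fact (n k))
        / (INR (fact (n k + a)) * INR (fact (n k + b))))
  * cos t ^ lnum q m n (2 * k) * sin t ^ lnum q m n (2 * k + 1)
  * JacobiP (n k) (INR b) (INR a) (cos (2 * t)).

Definition Psi (q : nat) (theta theta' : nat -> R) (m n : nat -> nat) (k : nat) : R :=
  Upsilon q m n k (theta k) * Upsilon q m n k (theta' k).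

Definition epsilon (m : nat) : R := if Nat.eqb m 0 then 1 else 2.

Definition azimuthal (phi phi' : nat -> R) (j : nat) (m : nat -> nat) : R :=
  epsilon (m j) * cos (INR (m j) * (phi j - phi' j)).

(* [L] stands for 2N + M; the first summand is used for L <= p, the second for L > p,
   so that all factorials and natural-number subtractions are exact. *)

Definition low_degree_term (d p L : nat) (rmax z : R) : C :=
  let nu := INR L + (INR d - 3) / 2 in
  (RtoC ((2 * ln rmax + 2 * harmonic (2 * p + d - 2) + harmonic p
          - harmonic (p + d / 2 - 1) - harmonic (p + L + d - 2) - harmonic (p - L))
         / (INR (fact (p - L)) * INR (fact (p + L + d - 2))))
   * LegendreQ nu (INR p + (INR d - 1) / 2) z
   + RtoC (1 / INR (fact (p + L + d - 2)))
     * Csum_lt (p - L) (fun k =>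
         RtoC (INR (2 * L + 2 * k + d - 1)
               / (INR (fact k) * INR (p - k - L) * INR (p + k + L + d - 1))
               * (1 + INR (fact k) * INR (fact (p + L + d - 2))
                      / (INR (fact (k + 2 * L + d - 2)) * INR (fact (p - L)))))
         * LegendreQ nu (INR k + INR L + (INR d - 1) / 2) z)
   + RtoC (1 / INR (fact (p - L)))
     * Csum_lt (L + d / 2 - 1) (fun k =>
         RtoC (INR (2 * k + 1)
               / (INR (fact (L + k + d / 2 - 1)) * INR (p + d / 2 - k - 1)
                  * INR (p + k + d / 2)))
         * LegendreQ nu (INR k + 1 / 2) z))%C.

Definition high_degree_term (d p L : nat) (z : R) : C :=
  (RtoC (INR (fact (L - p - 1)) / INR (fact (L + p + d - 2)))
   * LegendreQ (INR L + (INR d - 3) / 2) (INR p + (INR d - 1) / 2) z)%C.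

Definition first_multisum (q p m : nat) (theta theta' phi phi' : nat -> R)
    (rmax z : R) : C :=
  let d := (2 ^ q)%nat in
  let h := (d / 2)%nat in
  multisum (seq 2 (h - 1))
    (fun j ms => p - nat_sum 1 (j - 1) ms)%nat
    (azimuthal phi phi')
    (fun ms =>
       let M := nat_sum 1 h ms in
       (RtoC ((-1) ^ M)
        * multisum (rev (seq 1 (h - 1)))
            (fun k ns => (p - M - 2 * nat_sum (k + 1) (h - 1) ns) / 2)%nat
            (fun k ns => Psi q theta theta' ms ns k)
            (fun ns =>
               let N := nat_sum 1 (h - 1) ns in
               low_degree_term d p (2 * N + M) rmax z)
            (fun _ => 0%nat))%C)
    (update (fun _ => 0%nat) 1 m).

Definition is_second_multisum (q p m : nat) (theta theta' phi phi' : nat -> R)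
    (z : R) (s : C) : Prop :=
  let d := (2 ^ q)%nat in
  let h := (d / 2)%nat in
  is_multiseries (seq 2 (h - 1))
    (fun _ _ => 0%nat)
    (azimuthal phi phi')
    (fun ms =>
       let M := nat_sum 1 h ms in
       is_multiseries (rev (seq 1 (h - 1)))
         (fun k ns =>
            if Nat.eqb k 1 then
              (* division on Z rounds down, also for a negative numerator *)
              Z.to_nat (Z.max 0
                ((Z.of_nat p - Z.of_nat M
                  - 2 * Z.of_nat (nat_sum 2 (h - 1) ns)) / 2 + 1))
            else 0%nat)
         (fun k ns => Psi q theta theta' ms ns k)
         (fun ns s' =>
            let N := nat_sum 1 (h - 1) ns in
            s' = high_degree_term d p (2 * N + M) z)
         (fun _ => 0%nat))
    (update (fun _ => 0%nat) 1 m)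
    s.

(* Main.v *)
From Stdlib Require Import Lra Lia Psatz FunctionalExtensionality.
Require Import Defs.

(** Both sides are the m-th Fourier coefficient in the angle [t = phi_1 - phi_1'] of one
    function.  With [Z = zeta] and [ell = log (2 r r')],
    [|x - x'|^2 = 2 r r' (Z - y) = 2 R R' (chi - cos t)],
    where [y] is the cosine of the angle between the directions of [x] and [x'], and the
    function is [(Z - y)^p (log (Z - y) + ell)], that is, [|x - x'|^(2p) log |x - x'|^2] up to
    normalization.

    Its Fourier coefficient computed from [chi - cos t] is the left-hand side: the
    coefficients of [(chi - cos t)^p log (chi - cos t)] are derivatives with respect to the
    degree of Legendre functions, which expand in Legendre functions of smaller order.

    The right-hand side comes from expanding in powers of [y].  Here [y] is a sum of products
    along the binary tree of Hopf coordinates, and [y^s / s!] is the coefficient of a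
    generating function which splits at every node by Bateman's expansion of a product of
    Bessel functions into Bessel functions and Jacobi polynomials.  So each power of [y] is a
    finite sum over quantum numbers, and summing over [s] for fixed quantum numbers gives a
    radial coefficient depending on [L = 2N + M] only.  It is a logarithmic Legendre bracket
    if [L <= p] and a single Legendre function if [L > p].

    The convergence of every partial multi-series is obtained by comparison: the weights are
    dominated by those of the diagonal [theta = theta'] with zero azimuths, and the sums over
    the inner indices are bounded by complete box sums at a point slightly outside the real
    domain, where all weights are strictly positive. *)

(** * Finite sums *)

(** No limit in the degree is taken: [dff] and [drf] are formal derivatives of factorial powers, and
    each Legendre function that occurs has half-integer degree and order, so that Whipple's
    transformation turns it into a terminating sum [legp]. The variable is [x = exp (- eta)] with
    [zx x = cosh eta]; it is [r_< / r_>] for [zeta] and [chi - sqrt (chi^2 - 1)] for [chi]. Both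
    sides reduce to one computation on the circle. With [lam = d/2 - 1], [kap lam s L] is
    [kap 0 (s + lam) (L + lam)], and [lam] differentiations of [(z - u)^(p + lam) (log (z - u) + c)]
    restore the exponent [p] and change [c] by harmonic numbers. So the radial coefficient is the
    circle coefficient of order [L + lam] and exponent [p + lam]; the term [H_p - H_(p+d/2-1)]
    arises here. The obstacle to convergence is that [is_multiseries] asks for it at all values of
    the outer indices, whereas a bound on the complete sum says nothing about an inner series whose
    outer weight vanishes, as happens when an angle is [0] or [PI/2] or meets a zero of a Jacobi
    polynomial. *)

Fixpoint rsum (n : nat) (f : nat -> R) : R :=
  match n with O => 0 | S k => rsum k f + f k end.

Lemma rsum_S (n : nat) (f : nat -> R) : rsum (S n) f = rsum n f + f n.
Proof. reflexivity. Qed.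

Lemma rsum_ext (n : nat) (f g : nat -> R) :
  (forall i, (i < n)%nat -> f i = g i) -> rsum n f = rsum n g.
Proof.
  induction n as [|n IH]; intros H; simpl; auto.
  rewrite (H n) by lia. rewrite IH; auto.
Qed.

Lemma rsum_plus (n : nat) (f g : nat -> R) :
  rsum n (fun i => f i + g i) = rsum n f + rsum n g.
Proof. induction n as [|n IH]; simpl; [|rewrite IH]; ring. Qed.

Lemma rsum_scal (n : nat) (c : R) (f : nat -> R) :
  rsum n (fun i => c * f i) = c * rsum n f.
Proof. induction n as [|n IH]; simpl; [|rewrite IH]; ring. Qed.

Lemma rsum_minus (n : nat) (f g : nat -> R) :
  rsum n (fun i => f i - g i) = rsum n f - rsum n g.
Proof. induction n as [|n IH]; simpl; [|rewrite IH]; ring. Qed.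

Lemma rsum_0 (n : nat) (f : nat -> R) :
  (forall i, (i < n)%nat -> f i = 0) -> rsum n f = 0.
Proof.
  induction n as [|n IH]; intros H; simpl; auto.
  rewrite (H n) by lia. rewrite IH; auto; ring.
Qed.

Lemma rsum_swap (n m : nat) (f : nat -> nat -> R) :
  rsum n (fun i => rsum m (f i)) = rsum m (fun j => rsum n (fun i => f i j)).
Proof.
  induction n as [|n IH]; simpl.
  - symmetry; apply rsum_0; auto.
  - rewrite IH, <- rsum_plus; auto.
Qed.

Lemma rsum_add (n m : nat) (f : nat -> R) :
  rsum (n + m) f = rsum n f + rsum m (fun i => f (n + i)%nat).
Proof.
  induction m as [|m IH]; simpl.
  - rewrite Nat.add_0_r; ring.
  - rewrite Nat.add_succ_r; simpl; rewrite IH; ring.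
Qed.

Lemma rsum_first (n : nat) (f : nat -> R) :
  rsum (S n) f = f O + rsum n (fun i => f (S i)).
Proof.
  change (S n) with (1 + n)%nat. rewrite rsum_add; simpl; ring.
Qed.

Lemma rsum_extend (n m : nat) (f : nat -> R) :
  (n <= m)%nat -> (forall i, (n <= i < m)%nat -> f i = 0) -> rsum m f = rsum n f.
Proof.
  intros Hnm H. replace m with (n + (m - n))%nat by lia.
  rewrite rsum_add, (rsum_0 (m - n)); [ring|].
  intros i Hi; apply H; lia.
Qed.

Lemma rsum_single (n k : nat) (f : nat -> R) :
  (k < n)%nat -> (forall i, (i < n)%nat -> i <> k -> f i = 0) -> rsum n f = f k.
Proof.
  intros Hk H. rewrite (rsum_extend (S k) n); [|lia|intros i Hi; apply H; lia].
  simpl. rewrite rsum_0; [ring|]. intros i Hi; apply H; lia.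
Qed.

Lemma rsum_rev (n : nat) (f : nat -> R) :
  rsum n f = rsum n (fun i => f (n - 1 - i)%nat).
Proof.
  induction n as [|n IH]; auto.
  rewrite (rsum_first n (fun i => f (S n - 1 - i)%nat)). simpl rsum at 1.
  rewrite IH, Rplus_comm. f_equal; [f_equal; lia|].
  apply rsum_ext; intros i Hi; f_equal; lia.
Qed.

Lemma rsum_le (n : nat) (f g : nat -> R) :
  (forall i, (i < n)%nat -> f i <= g i) -> rsum n f <= rsum n g.
Proof.
  induction n as [|n IH]; intros H; simpl; [lra|].
  apply Rplus_le_compat; auto.
Qed.

Lemma rsum_nonneg (n : nat) (f : nat -> R) :
  (forall i, (i < n)%nat -> 0 <= f i) -> 0 <= rsum n f.
Proof.
  intros H. rewrite <- (rsum_0 n (fun _ => 0)); auto. apply rsum_le; auto.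
Qed.

Lemma rsum_pos_le (n m : nat) (f : nat -> R) :
  (n <= m)%nat -> (forall i, 0 <= f i) -> rsum n f <= rsum m f.
Proof.
  intros Hnm H. replace m with (n + (m - n))%nat by lia. rewrite rsum_add.
  assert (0 <= rsum (m - n) (fun i => f (n + i)%nat)) by (apply rsum_nonneg; auto).
  lra.
Qed.

Lemma rsum_term_le (n k : nat) (f : nat -> R) :
  (k < n)%nat -> (forall i, 0 <= f i) -> f k <= rsum n f.
Proof.
  intros Hk H. apply Rle_trans with (rsum (S k) f).
  - simpl. assert (0 <= rsum k f) by (apply rsum_nonneg; auto). lra.
  - apply rsum_pos_le; auto.
Qed.

Lemma rsum_Rabs (n : nat) (f : nat -> R) :
  Rabs (rsum n f) <= rsum n (fun i => Rabs (f i)).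
Proof.
  induction n as [|n IH]; simpl; [rewrite Rabs_R0; lra|].
  eapply Rle_trans; [apply Rabs_triang|]; lra.
Qed.

Lemma rsum_sum_n (n : nat) (f : nat -> R) : sum_n f n = rsum (S n) f.
Proof.
  induction n as [|n IH].
  - rewrite sum_O; simpl; ring.
  - rewrite sum_Sn, IH. reflexivity.
Qed.

(** * Factorials, binomials and finite differences *)

Definition rfact (n : nat) : R := INR (fact n).

Lemma rfact_pos (n : nat) : 0 < rfact n.
Proof. apply INR_fact_lt_0. Qed.

Lemma rfact_neq_0 (n : nat) : rfact n <> 0.
Proof. apply INR_fact_neq_0. Qed.

Lemma rfact_S (n : nat) : rfact (S n) = (INR n + 1) * rfact n.
Proof.
  unfold rfact. rewrite fact_simpl, mult_INR, S_INR. ring.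
Qed.

Lemma rfact_0 : rfact 0 = 1.
Proof. reflexivity. Qed.

Ltac rfact_nz :=
  repeat split; repeat apply Rmult_integral_contrapositive_currified;
  try apply rfact_neq_0.

(* [ff] and [rf] are the falling and the rising factorial powers of a real number;
   [dff] and [drf] are their derivatives with respect to the base. *)
Fixpoint ff (a : R) (s : nat) : R :=
  match s with O => 1 | S s' => ff a s' * (a - INR s') end.

Fixpoint dff (a : R) (s : nat) : R :=
  match s with O => 0 | S s' => dff a s' * (a - INR s') + ff a s' end.

Fixpoint rf (a : R) (s : nat) : R :=
  match s with O => 1 | S s' => rf a s' * (a + INR s') end.

Fixpoint drf (a : R) (s : nat) : R :=
  match s with O => 0 | S s' => drf a s' * (a + INR s') + rf a s' end.

Lemma ff_S (a : R) (s : nat) : ff a (S s) = ff a s * (a - INR s).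
Proof. reflexivity. Qed.

Lemma dff_S (a : R) (s : nat) : dff a (S s) = dff a s * (a - INR s) + ff a s.
Proof. reflexivity. Qed.

Lemma rf_S (a : R) (s : nat) : rf a (S s) = rf a s * (a + INR s).
Proof. reflexivity. Qed.

Lemma drf_S (a : R) (s : nat) : drf a (S s) = drf a s * (a + INR s) + rf a s.
Proof. reflexivity. Qed.

Lemma rf_first (a : R) (s : nat) : rf a (S s) = a * rf (a + 1) s.
Proof.
  induction s as [|s IH]; [simpl; ring|].
  change (rf a (S (S s))) with (rf a (S s) * (a + INR (S s))).
  rewrite IH, rf_S, S_INR. ring.
Qed.

Lemma drf_first (a : R) (s : nat) :
  drf a (S s) = a * drf (a + 1) s + rf (a + 1) s.
Proof.
  induction s as [|s IH]; [simpl; ring|].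
  change (drf a (S (S s))) with (drf a (S s) * (a + INR (S s)) + rf a (S s)).
  rewrite IH, rf_first, drf_S, rf_S, S_INR. ring.
Qed.

Lemma ff_pascal (a : R) (s : nat) :
  ff (a + 1) (S s) = ff a (S s) + (INR s + 1) * ff a s.
Proof.
  induction s as [|s IH]; [simpl; ring|].
  change (ff (a + 1) (S (S s))) with (ff (a + 1) (S s) * (a + 1 - INR (S s))).
  rewrite IH, (ff_S a (S s)), (ff_S a s), S_INR. ring.
Qed.

(** The Pascal rule differentiated in [a]. It is all that the induction for the logarithmic kernel
    needs to know about the differentiated coefficients. *)
Lemma dff_pascal (a : R) (s : nat) :
  dff (a + 1) (S s) = dff a (S s) + (INR s + 1) * dff a s.
Proof.
  induction s as [|s IH]; [simpl; ring|].
  change (dff (a + 1) (S (S s)))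
    with (dff (a + 1) (S s) * (a + 1 - INR (S s)) + ff (a + 1) (S s)).
  rewrite IH, ff_pascal, (dff_S a (S s)), (dff_S a s), (ff_S a s), S_INR. ring.
Qed.

Lemma ff_add (a : R) (n s : nat) : ff a (n + s) = ff a n * ff (a - INR n) s.
Proof.
  induction s as [|s IH]; simpl; [rewrite Nat.add_0_r; ring|].
  rewrite Nat.add_succ_r; simpl. rewrite IH, plus_INR. ring.
Qed.

Lemma dff_add (a : R) (n s : nat) :
  dff a (n + s) = dff a n * ff (a - INR n) s + ff a n * dff (a - INR n) s.
Proof.
  induction s as [|s IH]; simpl; [rewrite Nat.add_0_r; ring|].
  rewrite Nat.add_succ_r; simpl. rewrite IH, ff_add, plus_INR. ring.
Qed.

Lemma ff_fact (k s : nat) : (s <= k)%nat -> ff (INR k) s = rfact k / rfact (k - s).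
Proof.
  induction s as [|s IH]; intros Hs; simpl.
  - rewrite Nat.sub_0_r. field. apply rfact_neq_0.
  - rewrite IH by lia. replace (k - s)%nat with (S (k - S s)) by lia.
    rewrite rfact_S. replace (INR k - INR s) with (INR (k - S s) + 1).
    + field. split; [apply rfact_neq_0|]. rewrite <- S_INR. apply not_0_INR; lia.
    + rewrite minus_INR by lia. rewrite S_INR. ring.
Qed.

Lemma ff_0 (k s : nat) : (k < s)%nat -> ff (INR k) s = 0.
Proof.
  intros H. replace s with (S k + (s - S k))%nat by lia.
  rewrite ff_add. simpl. ring.
Qed.

Lemma rf_fact (k s : nat) : rfact k * rf (INR k + 1) s = rfact (k + s).
Proof.
  induction s as [|s IH]; simpl; [rewrite Nat.add_0_r; ring|].
  rewrite Nat.add_succ_r, rfact_S, <- IH, plus_INR. ring.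
Qed.

Lemma ff_opp (a : R) (s : nat) : ff (- a) s = (-1) ^ s * rf a s.
Proof. induction s as [|s IH]; simpl; [ring|]. rewrite IH; ring. Qed.

Lemma rf_opp (a : R) (s : nat) : rf (- a) s = (-1) ^ s * ff a s.
Proof. induction s as [|s IH]; simpl; [ring|]. rewrite IH; ring. Qed.

Lemma pochhammer_rf (a : R) (s : nat) : pochhammer a s = rf a s.
Proof. induction s as [|s IH]; simpl; [auto|]. rewrite IH; auto. Qed.

Lemma harmonic_S (n : nat) : harmonic (S n) = harmonic n + / (INR n + 1).
Proof.
  unfold harmonic. rewrite sum_n_Sm by lia. rewrite <- S_INR. reflexivity.
Qed.

(** Logarithmic differentiation of a product of factors [a - i]: the reciprocals [1 / (k - i)],
    [i < s], add up to a difference of harmonic numbers. *)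
Lemma dff_harmonic (k s : nat) : (s <= k)%nat ->
  dff (INR k) s = ff (INR k) s * (harmonic k - harmonic (k - s)).
Proof.
  induction s as [|s IH]; intros Hs.
  - simpl. rewrite Nat.sub_0_r. ring.
  - simpl. rewrite IH by lia. replace (k - s)%nat with (S (k - S s)) by lia.
    rewrite harmonic_S. replace (INR k - INR s) with (INR (k - S s) + 1).
    + field. rewrite <- S_INR. apply not_0_INR; lia.
    + rewrite minus_INR by lia. rewrite S_INR. ring.
Qed.

Lemma drf_harmonic (k s : nat) :
  rfact k * drf (INR k + 1) s = rfact (k + s) * (harmonic (k + s) - harmonic k).
Proof.
  induction s as [|s IH].
  - simpl. rewrite Nat.add_0_r. ring.
  - rewrite Nat.add_succ_r, harmonic_S, rfact_S. simpl drf.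
    replace (rfact k * (drf (INR k + 1) s * (INR k + 1 + INR s) + rf (INR k + 1) s))
      with ((rfact k * drf (INR k + 1) s) * (INR k + 1 + INR s)
            + rfact k * rf (INR k + 1) s) by ring.
    rewrite IH, rf_fact, plus_INR. field.
    rewrite <- plus_INR, <- S_INR. apply not_0_INR; lia.
Qed.

(** Exactly one factor of the falling power vanishes at [a = k], so the derivative must fall on it.
    The factors before it give [k!], those after it [(-1)^s s!]. This is why a single Legendre
    function remains when [L > p]. *)
Lemma dff_above (k s : nat) :
  dff (INR k) (S k + s) = (-1) ^ s * rfact k * rfact s.
Proof.
  rewrite dff_add, ff_0, Rmult_0_l, Rplus_0_r by lia.
  simpl dff. rewrite Rminus_diag, Rmult_0_r, Rplus_0_l.
  rewrite ff_fact, Nat.sub_diag, rfact_0 by lia.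
  replace (INR k - INR (S k)) with (Ropp 1) by (rewrite S_INR; ring).
  rewrite ff_opp. replace s with (0 + s)%nat at 4 by lia.
  rewrite <- (rf_fact 0 s), rfact_0. simpl INR.
  rewrite Rplus_0_l. field.
Qed.

Fixpoint chs (n k : nat) : R :=
  match n, k with
  | _, O => 1
  | O, S _ => 0
  | S n', S k' => chs n' k' + chs n' (S k')
  end.

Lemma chs_0_r (n : nat) : chs n 0 = 1.
Proof. destruct n; auto. Qed.

Lemma chs_ff (n k : nat) : chs n k = ff (INR n) k / rfact k.
Proof.
  revert k; induction n as [|n IH]; intros [|k].
  - simpl. rewrite rfact_0. field.
  - rewrite ff_0 by lia. unfold Rdiv. simpl. ring.
  - simpl. rewrite rfact_0. field.
  - simpl chs. rewrite 2!IH, S_INR, ff_pascal, rfact_S. field.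
    split; [apply rfact_neq_0|]. rewrite <- S_INR; apply not_0_INR; lia.
Qed.

Lemma chs_gt (n k : nat) : (n < k)%nat -> chs n k = 0.
Proof. intros H. rewrite chs_ff, ff_0 by auto. unfold Rdiv; ring. Qed.

Lemma chs_fact (n k : nat) : (k <= n)%nat ->
  chs n k = rfact n / (rfact k * rfact (n - k)).
Proof. intros H. rewrite chs_ff, ff_fact by auto. field. rfact_nz. Qed.

Lemma rsum_pascal (n : nat) (f : nat -> R) :
  rsum (S (S n)) (fun j => chs (S n) j * f j)
  = rsum (S n) (fun j => chs n j * (f j + f (S j))).
Proof.
  rewrite rsum_first.
  rewrite (rsum_ext _ _ (fun j => chs n j * f (S j) + chs n (S j) * f (S j)))
    by (intros; simpl; ring).
  rewrite rsum_plus.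
  rewrite (rsum_ext (S n) (fun j => chs n j * (f j + f (S j)))
             (fun j => chs n j * f (S j) + chs n j * f j)) by (intros; ring).
  rewrite rsum_plus, (rsum_first n (fun j => chs n j * f j)).
  change (rsum (S n) (fun i => chs n (S i) * f (S i)))
    with (rsum n (fun i => chs n (S i) * f (S i)) + chs n (S n) * f (S n)).
  rewrite (chs_gt n (S n)) by lia. rewrite 2!chs_0_r. ring.
Qed.

Fixpoint fd (s : nat) (r : nat -> R) : R :=
  match s with O => r O | S s' => fd s' (fun j => r (S j)) - fd s' r end.

Lemma fd_S (s : nat) (r : nat -> R) :
  fd (S s) r = fd s (fun j => r (S j)) - fd s r.
Proof. reflexivity. Qed.

Lemma fd_ext (s : nat) (r r' : nat -> R) :
  (forall j, r j = r' j) -> fd s r = fd s r'.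
Proof.
  revert r r'; induction s as [|s IH]; intros r r' H; simpl; auto.
  rewrite (IH r r'), (IH (fun j => r (S j)) (fun j => r' (S j))); auto.
Qed.

Lemma fd_lin (s : nat) (a b : R) (r r' : nat -> R) :
  fd s (fun j => a * r j + b * r' j) = a * fd s r + b * fd s r'.
Proof.
  revert r r'; induction s as [|s IH]; intros r r'; simpl; auto.
  rewrite 2!IH. ring.
Qed.

Lemma fd_scal (s : nat) (a : R) (r : nat -> R) :
  fd s (fun j => a * r j) = a * fd s r.
Proof.
  rewrite (fd_ext s _ (fun j => a * r j + 0 * r j)) by (intros; ring).
  rewrite fd_lin; ring.
Qed.

(* Chu-Vandermonde, as a formula for iterated differences. *)
Lemma fd_rf (s n : nat) (a : R) :
  fd s (fun j => rf (a + 1) j / rfact (n + j)) = ff (a - INR n) s / rfact (n + s).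
Proof.
  revert n a; induction s as [|s IH]; intros n a; [reflexivity|].
  rewrite fd_S, IH.
  rewrite (fd_ext s _ (fun j => (a + 1) * (rf (a + 1 + 1) j / rfact (S n + j)))).
  2:{ intros j; cbv beta; rewrite rf_first, Nat.add_succ_r.
      change (S n + j)%nat with (S (n + j)). unfold Rdiv. ring. }
  rewrite fd_scal, IH, ff_S.
  replace (a + 1 - INR (S n)) with (a - INR n) by (rewrite S_INR; ring).
  change (S n + s)%nat with (S (n + s)). rewrite Nat.add_succ_r, rfact_S, plus_INR. field.
  split; [apply rfact_neq_0|]. rewrite <- plus_INR, <- S_INR; apply not_0_INR; lia.
Qed.

(** The derivative of [fd_rf] in [a], by the same induction; [drf_first] contributes one extra
    undifferentiated term, which [fd_rf] evaluates. *)
Lemma fd_drf (s n : nat) (a : R) :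
  fd s (fun j => drf (a + 1) j / rfact (n + j)) = dff (a - INR n) s / rfact (n + s).
Proof.
  revert n a; induction s as [|s IH]; intros n a; [reflexivity|].
  rewrite fd_S, IH.
  rewrite (fd_ext s _ (fun j => (a + 1) * (drf (a + 1 + 1) j / rfact (S n + j))
                                + 1 * (rf (a + 1 + 1) j / rfact (S n + j)))).
  2:{ intros j; cbv beta; rewrite drf_first, Nat.add_succ_r.
      change (S n + j)%nat with (S (n + j)). unfold Rdiv. ring. }
  rewrite fd_lin, IH, fd_rf, dff_S.
  replace (a + 1 - INR (S n)) with (a - INR n) by (rewrite S_INR; ring).
  change (S n + s)%nat with (S (n + s)). rewrite Nat.add_succ_r, rfact_S, plus_INR. field.
  split; [apply rfact_neq_0|]. rewrite <- plus_INR, <- S_INR; apply not_0_INR; lia.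
Qed.

(** With [E] the shift of sequences, this is [(1 - y + y E)^N = (1 + y (E - 1))^N] applied to [r] at
    [0]. *)
Lemma fd_binomial (N : nat) (y : R) (r : nat -> R) :
  rsum (S N) (fun j => chs N j * (y ^ j * (1 - y) ^ (N - j) * r j))
  = rsum (S N) (fun s => chs N s * (y ^ s * fd s r)).
Proof.
  revert r; induction N as [|N IH]; intros r; [simpl; ring|].
  rewrite rsum_pascal.
  rewrite (rsum_ext _ _ (fun j =>
     (1 - y) * (chs N j * (y ^ j * (1 - y) ^ (N - j) * r j))
     + y * (chs N j * (y ^ j * (1 - y) ^ (N - j) * r (S j))))).
  2:{ intros j Hj. replace (S N - j)%nat with (S (N - j)) by lia.
      replace (S N - S j)%nat with (N - j)%nat by lia. simpl pow. ring. }
  rewrite rsum_plus, 2!rsum_scal, IH, (IH (fun j => r (S j))).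
  rewrite rsum_pascal.
  rewrite (rsum_ext _ (fun j => chs N j * (y ^ j * fd j r + y ^ S j * fd (S j) r))
   (fun j => (1 - y) * (chs N j * (y ^ j * fd j r))
             + y * (chs N j * (y ^ j * fd j (fun j => r (S j)))))).
  2:{ intros j Hj. simpl. ring. }
  rewrite rsum_plus, 2!rsum_scal. ring.
Qed.

(** A terminating series in [w = y / (1 - y)] becomes a polynomial in [y] whose coefficients are
    iterated differences. Combined with [fd_rf] it gives Pfaff's transformation, combined with
    [fd_drf] the parameter derivative of it. *)
Lemma fd_transform (N : nat) (y : R) (r : nat -> R) : y <> 1 ->
  (1 - y) ^ N * rsum (S N) (fun j => r j / (rfact (N - j) * rfact j) * (y / (1 - y)) ^ j)
  = rsum (S N) (fun s => fd s r / (rfact (N - s) * rfact s) * y ^ s).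
Proof.
  intros Hy. assert (1 - y <> 0) by lra.
  transitivity (/ rfact N * rsum (S N) (fun j => chs N j * (y ^ j * (1 - y) ^ (N - j) * r j))).
  - rewrite <- 2!rsum_scal. apply rsum_ext; intros j Hj.
    rewrite chs_fact by lia. replace N with ((N - j) + j)%nat at 1 by lia.
    unfold Rdiv. rewrite pow_add, Rpow_mult_distr, pow_inv. field. rfact_nz.
    apply pow_nonzero; auto.
  - rewrite fd_binomial, <- rsum_scal. apply rsum_ext; intros j Hj.
    rewrite chs_fact by lia. field. rfact_nz.
Qed.

(** * Legendre polynomials of integer degree and their degree derivative *)

(** The product of [(i - l) (i + l + 1)] over [l < j], which is [0] for [j > i]; the Legendre
    polynomial of degree [i] at [1 + 2 w] has the coefficients [fquot i j / j!^2]. The value [0]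
    lets all degrees below [K] share one range of summation. *)
Definition fquot (i j : nat) : R :=
  if Nat.leb j i then rfact (i + j) / rfact (i - j) else 0.

Lemma fquot_le (i j : nat) : (j <= i)%nat -> fquot i j = rfact (i + j) / rfact (i - j).
Proof. intros H. unfold fquot. apply Nat.leb_le in H; rewrite H; auto. Qed.

Lemma fquot_gt (i j : nat) : (i < j)%nat -> fquot i j = 0.
Proof. intros H. unfold fquot. apply Nat.leb_gt in H; rewrite H; auto. Qed.

Lemma fquot_S_r (i j : nat) :
  fquot i (S j) = (INR i - INR j) * (INR i + INR j + 1) * fquot i j.
Proof.
  destruct (lt_eq_lt_dec i j) as [[H|H]|H].
  - rewrite 2!fquot_gt by lia; ring.
  - subst. rewrite (fquot_gt j (S j)) by lia; ring.
  - rewrite 2!fquot_le by lia. replace (i - j)%nat with (S (i - S j)) by lia.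
    rewrite Nat.add_succ_r, 2!rfact_S, plus_INR.
    replace (INR (i - S j)) with (INR i - INR j - 1)
      by (rewrite minus_INR, S_INR by lia; ring).
    assert (INR j + 1 <= INR i) by (rewrite <- S_INR; apply le_INR; lia).
    field. split; [apply rfact_neq_0|lra].
Qed.

Lemma fquot_S_l (i j : nat) :
  (INR i + 1 - INR j) * fquot (S i) j = (INR i + INR j + 1) * fquot i j.
Proof.
  destruct (lt_eq_lt_dec (S i) j) as [[H|H]|H].
  - rewrite 2!fquot_gt by lia; ring.
  - subst. rewrite (fquot_gt i (S i)) by lia. rewrite S_INR; ring.
  - rewrite 2!fquot_le by lia. replace (S i - j)%nat with (S (i - j)) by lia.
    change (S i + j)%nat with (S (i + j)). rewrite 2!rfact_S, plus_INR, minus_INR by lia.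
    assert (INR j <= INR i) by (apply le_INR; lia).
    field. split; [apply rfact_neq_0|lra].
Qed.

(* The associated Legendre function of degree k and order -n at 1 + 2 w, without its
   factor (w / (1 + w)) ^ (n / 2). *)
Definition legp (n k : nat) (w : R) : R :=
  rsum (S k) (fun j => fquot k j / (rfact j * rfact (n + j)) * w ^ j).

Lemma legp_extend (n k N : nat) (w : R) : (k < N)%nat ->
  legp n k w = rsum N (fun j => fquot k j / (rfact j * rfact (n + j)) * w ^ j).
Proof.
  intros H. symmetry. apply rsum_extend; [lia|].
  intros j Hj. rewrite fquot_gt by lia. unfold Rdiv; ring.
Qed.

Lemma INR_S_neq_0 (n : nat) : INR n + 1 <> 0.
Proof. rewrite <- S_INR; apply not_0_INR; lia. Qed.

Lemma legp_transform (n k : nat) (y : R) : y <> 1 ->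
  (1 - y) ^ k * legp n k (y / (1 - y))
  = rsum (S k) (fun s => rfact k * ff (INR k - INR n) s
                         / (rfact (n + s) * rfact (k - s) * rfact s) * y ^ s).
Proof.
  intros Hy. unfold legp.
  rewrite (rsum_ext _ _ (fun j =>
    (rfact k * (rf (INR k + 1) j / rfact (n + j))) / (rfact (k - j) * rfact j)
    * (y / (1 - y)) ^ j)).
  2:{ intros j Hj. rewrite fquot_le, <- rf_fact by lia. field. rfact_nz; lra. }
  rewrite fd_transform by auto. apply rsum_ext; intros s Hs.
  rewrite fd_scal, fd_rf. field. rfact_nz.
Qed.

(** Euler's transformation, with [1 - y = 1 / (1 + w)]: it trades order [-n] for order [n]. A
    further factor [(1 - y)^(i - n)] makes both sides polynomials in [y], whose coefficients
    Chu-Vandermonde evaluates. *)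
Lemma legp_reflect (n i : nat) (y : R) : y <> 1 -> (n <= i)%nat ->
  (1 - y) ^ n * (fquot i n * legp n i (y / (1 - y)))
  = rsum (S (i - n)) (fun j => fquot i (n + j) / (rfact j * rfact (n + j))
                               * (y / (1 - y)) ^ j).
Proof.
  intros Hy Hn. assert (H1 : (1 - y) <> 0) by lra.
  assert (H2 : (1 - y) ^ (i - n) <> 0) by (apply pow_nonzero; auto).
  apply (Rmult_eq_reg_l ((1 - y) ^ (i - n))); auto.
  rewrite <- Rmult_assoc, <- pow_add. replace (i - n + n)%nat with i by lia.
  rewrite <- Rmult_assoc, (Rmult_comm _ (fquot i n)), Rmult_assoc, legp_transform by auto.
  rewrite (rsum_ext (S (i - n)) _ (fun j =>
    (rfact (i + n) * (rf (INR (i + n) + 1) j / rfact (n + j)))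
    / (rfact (i - n - j) * rfact j) * (y / (1 - y)) ^ j)).
  2:{ intros j Hj. rewrite fquot_le by lia.
      replace (i + (n + j))%nat with (i + n + j)%nat by lia.
      rewrite <- rf_fact. replace (i - (n + j))%nat with (i - n - j)%nat by lia.
      field. rfact_nz; lra. }
  rewrite fd_transform by auto. rewrite <- rsum_scal.
  rewrite (rsum_extend (S (i - n)) (S i)).
  2: lia.
  2:{ intros s Hs. rewrite <- minus_INR by lia. rewrite ff_0 by lia. unfold Rdiv; ring. }
  apply rsum_ext; intros s Hs. rewrite fd_scal, fd_rf.
  replace (INR (i + n) - INR n) with (INR i) by (rewrite plus_INR; ring).
  rewrite <- minus_INR, 2!ff_fact, fquot_le by lia. field. rfact_nz.
Qed.

(** Up to a factor [2], the classical coefficients of the Legendre polynomials of degree [i < K] in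
    the derivative of the Legendre function with respect to its degree at [K]. *)
Definition dcoef (K i : nat) : R :=
  (2 * INR i + 1) * (-1) ^ (K + i) / ((INR K - INR i) * (INR K + INR i + 1)).

Lemma rsum_alternating (n : nat) (b : nat -> R) :
  rsum n (fun i => (-1) ^ i * (b (S i) + b i)) = b O - (-1) ^ n * b n.
Proof. induction n as [|n IH]; simpl; [ring|]. rewrite IH; ring. Qed.

Lemma pow_m1_sq (n : nat) : (-1) ^ n * (-1) ^ n = 1.
Proof. rewrite <- Rpow_mult_distr. replace (-1 * -1) with 1 by ring. apply pow1. Qed.

(** Since [(K - j)(K + j + 1) - (i - j)(i + j + 1) = (K - i)(K + i + 1)], the denominator of [dcoef]
    cancels. What remains is an alternating sum of [(2 i + 1) fquot i j], and [(2 i + 1) fquot i j =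
    (i + 1 - j) fquot (i + 1) j + (i - j) fquot i j] makes it telescope. *)
Lemma sum_dcoef_step (K j : nat) : (j < K)%nat ->
  (INR K - INR j) * (INR K + INR j + 1) * rsum K (fun i => dcoef K i * fquot i j)
  - rsum K (fun i => dcoef K i * fquot i (S j))
  = - ((INR K - INR j) * fquot K j).
Proof.
  intros Hj. rewrite <- rsum_scal, <- rsum_minus.
  rewrite (rsum_ext _ _ (fun i => (-1) ^ K * ((-1) ^ i *
    ((INR (S i) - INR j) * fquot (S i) j + (INR i - INR j) * fquot i j)))).
  2:{ intros i Hi. replace (INR (S i) - INR j) with (INR i + 1 - INR j)
        by (rewrite S_INR; ring).
      rewrite fquot_S_l, fquot_S_r. unfold dcoef. rewrite pow_add.
      assert (INR i + 1 <= INR K) by (rewrite <- S_INR; apply le_INR; lia).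
      pose proof (pos_INR i). field. lra. }
  rewrite rsum_scal.
  rewrite (rsum_alternating K (fun i => (INR i - INR j) * fquot i j)).
  assert (H0 : (INR 0 - INR j) * fquot 0 j = 0).
  { destruct j; [simpl; ring|rewrite fquot_gt by lia; ring]. }
  rewrite H0.
  transitivity (- ((-1) ^ K * (-1) ^ K) * ((INR K - INR j) * fquot K j)); [ring|].
  rewrite pow_m1_sq; ring.
Qed.

(** Downward induction on [j]. At [j = K] both sides vanish, because [fquot i K = 0] for [i < K];
    each step supplies one more reciprocal [1 / (K + j + 1)]. *)
Lemma sum_dcoef (K j : nat) : (j <= K)%nat ->
  rsum K (fun i => dcoef K i * fquot i j)
  = - fquot K j * (harmonic (2 * K) - harmonic (K + j)).
Proof.
  intros Hj. replace j with (K - (K - j))%nat by lia.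
  generalize (Nat.le_sub_l K j). generalize (K - j)%nat. clear j Hj.
  induction n as [|n IH]; intros Hn.
  - rewrite Nat.sub_0_r. replace (2 * K)%nat with (K + K)%nat by lia.
    rewrite rsum_0; [ring|]. intros i Hi. rewrite fquot_gt by lia; ring.
  - set (j := (K - S n)%nat) in *. assert (Hj : (j < K)%nat) by lia.
    replace (K - n)%nat with (S j) in IH by lia. specialize (IH ltac:(lia)).
    pose proof (sum_dcoef_step K j Hj) as H. rewrite IH, fquot_S_r in H.
    replace (K + S j)%nat with (S (K + j)) in H by lia.
    rewrite harmonic_S, plus_INR in H.
    assert (INR j + 1 <= INR K) by (rewrite <- S_INR; apply le_INR; lia).
    pose proof (pos_INR j).
    apply (Rmult_eq_reg_l ((INR K - INR j) * (INR K + INR j + 1)));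
      [|apply Rmult_integral_contrapositive_currified; lra].
    apply Rminus_diag_uniq. apply Rminus_diag_eq in H. rewrite <- H. field. lra.
Qed.

(** The derivative at [nu = K] of [binomial(nu, n + s) binomial(nu, s)], which is, apart from the
    factor [(-x)^n], the coefficient of [x^(2 s)] in the [n]-th Fourier coefficient of
    [(1 - 2 x cos t + x^2)^nu]. *)
Definition dleg (n K : nat) : nat -> R :=
  fun s => dff (INR K) (n + s) / rfact (n + s) * (ff (INR K) s / rfact s)
           + ff (INR K) (n + s) / rfact (n + s) * (dff (INR K) s / rfact s).

(** The differentiated counterpart of [legp_transform]: by [drf_harmonic] the harmonic weights are
    derivatives of rising factorials, and [fd_drf] takes their differences. *)
Lemma dlegp_transform (n K : nat) (y : R) : y <> 1 ->
  (1 - y) ^ K * rsum (S K) (fun j => fquot K j * (harmonic (K + j) - harmonic K)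
                              / (rfact j * rfact (n + j)) * (y / (1 - y)) ^ j)
  = rsum (S K) (fun s => rfact K * dff (INR K - INR n) s
                         / (rfact (n + s) * rfact (K - s) * rfact s) * y ^ s).
Proof.
  intros Hy.
  rewrite (rsum_ext (S K) (fun j => _ / _ * _) (fun j =>
    (rfact K * (drf (INR K + 1) j / rfact (n + j))) / (rfact (K - j) * rfact j)
    * (y / (1 - y)) ^ j)).
  2:{ intros j Hj. rewrite fquot_le by lia.
      transitivity (rfact (K + j) * (harmonic (K + j) - harmonic K)
        / (rfact (K - j) * rfact j * rfact (n + j)) * (y / (1 - y)) ^ j).
      - field. rfact_nz; lra.
      - rewrite <- drf_harmonic. field. rfact_nz; lra. }
  rewrite fd_transform by auto. apply rsum_ext; intros s Hs.
  rewrite fd_scal, fd_drf. field. rfact_nz.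
Qed.

Lemma dlegp_reflect (n K : nat) (y : R) : y <> 1 -> (n <= K)%nat ->
  (1 - y) ^ (K - n) * rsum (S (K - n)) (fun j =>
     fquot K (n + j) * (harmonic (K + (n + j)) - harmonic (K + n))
     / (rfact j * rfact (n + j)) * (y / (1 - y)) ^ j)
  = rsum (S (K - n)) (fun s => rfact (K + n) * dff (INR K) s
                         / (rfact (n + s) * rfact (K - n - s) * rfact s) * y ^ s).
Proof.
  intros Hy Hn.
  rewrite (rsum_ext (S (K - n)) (fun j => _ / _ * _) (fun j =>
    (rfact (K + n) * (drf (INR (K + n) + 1) j / rfact (n + j)))
    / (rfact (K - n - j) * rfact j) * (y / (1 - y)) ^ j)).
  2:{ intros j Hj. rewrite fquot_le by lia.
      replace (K + (n + j))%nat with (K + n + j)%nat by lia.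
      replace (K - (n + j))%nat with (K - n - j)%nat by lia.
      transitivity (rfact (K + n + j) * (harmonic (K + n + j) - harmonic (K + n))
        / (rfact (K - n - j) * rfact j * rfact (n + j)) * (y / (1 - y)) ^ j).
      - field. rfact_nz; lra.
      - rewrite <- drf_harmonic. field. rfact_nz; lra. }
  rewrite fd_transform by auto. apply rsum_ext; intros s Hs.
  rewrite fd_scal, fd_drf.
  replace (INR (K + n) - INR n) with (INR K) by (rewrite plus_INR; ring).
  field. rfact_nz.
Qed.

Lemma sum_dcoef_legp (n K : nat) (w : R) :
  rsum K (fun i => dcoef K i * legp n i w)
  = - rsum (S K) (fun j => fquot K j * (harmonic (2 * K) - harmonic (K + j))
                           / (rfact j * rfact (n + j)) * w ^ j).
Proof.
  rewrite (rsum_ext _ _ (fun i => rsum (S K) (fun j =>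
    dcoef K i * fquot i j * (/ (rfact j * rfact (n + j)) * w ^ j)))).
  2:{ intros i Hi. rewrite (legp_extend n i (S K)) by lia. rewrite <- rsum_scal.
      apply rsum_ext; intros; unfold Rdiv; ring. }
  rewrite rsum_swap.
  transitivity ((-1) * rsum (S K) (fun j =>
    fquot K j * (harmonic (2 * K) - harmonic (K + j)) / (rfact j * rfact (n + j)) * w ^ j));
    [|ring].
  rewrite <- rsum_scal. apply rsum_ext; intros j Hj.
  rewrite (rsum_ext _ _ (fun i => (/ (rfact j * rfact (n + j)) * w ^ j)
                                  * (dcoef K i * fquot i j))) by (intros; ring).
  rewrite rsum_scal, sum_dcoef by lia. unfold Rdiv; ring.
Qed.

Lemma sum_dcoef_legp_reflect (n K : nat) (y : R) : y <> 1 -> (n <= K)%nat ->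
  (1 - y) ^ n * rsum K (fun i => dcoef K i * (fquot i n * legp n i (y / (1 - y))))
  = - rsum (S (K - n)) (fun j =>
        fquot K (n + j) * (harmonic (2 * K) - harmonic (K + (n + j)))
        / (rfact j * rfact (n + j)) * (y / (1 - y)) ^ j).
Proof.
  intros Hy Hn. rewrite <- rsum_scal.
  rewrite (rsum_ext _ _ (fun i => rsum (S (K - n)) (fun j =>
    dcoef K i * fquot i (n + j) * (/ (rfact j * rfact (n + j)) * (y / (1 - y)) ^ j)))).
  2:{ intros i Hi.
      transitivity (dcoef K i * ((1 - y) ^ n * (fquot i n * legp n i (y / (1 - y)))));
        [ring|].
      destruct (le_lt_dec n i) as [Hi'|Hi'].
      - rewrite legp_reflect by auto.
        rewrite <- (rsum_extend (S (i - n)) (S (K - n))).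
        2: lia.
        2:{ intros j Hj. rewrite fquot_gt by lia. unfold Rdiv; ring. }
        rewrite <- rsum_scal. apply rsum_ext; intros; unfold Rdiv; ring.
      - rewrite fquot_gt by lia. rewrite rsum_0; [ring|].
        intros j Hj. rewrite fquot_gt by lia; ring. }
  rewrite rsum_swap.
  transitivity ((-1) * rsum (S (K - n)) (fun j =>
    fquot K (n + j) * (harmonic (2 * K) - harmonic (K + (n + j)))
    / (rfact j * rfact (n + j)) * (y / (1 - y)) ^ j)); [|ring].
  rewrite <- rsum_scal. apply rsum_ext; intros j Hj.
  rewrite (rsum_ext _ _ (fun i => (/ (rfact j * rfact (n + j)) * (y / (1 - y)) ^ j)
                                  * (dcoef K i * fquot i (n + j)))) by (intros; ring).
  rewrite rsum_scal, sum_dcoef by lia. unfold Rdiv; ring.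
Qed.

(* The two families of Legendre functions on the right come from differentiating the
   two terminating forms of 2F1(-k, k + 1; n + 1; -w), at 0 and at -1, in k. *)
Lemma dleg_low (n K : nat) (y : R) : y <> 1 -> (n <= K)%nat ->
  rsum (S K) (fun s => dleg n K s * y ^ s)
  = rfact K * (1 - y) ^ K *
    ((2 * harmonic (2 * K) - harmonic (K + n) - harmonic (K - n)) / rfact (K - n)
       * legp n K (y / (1 - y))
     + rsum K (fun i => dcoef K i * (fquot i n / rfact (K + n) + / rfact (K - n))
                        * legp n i (y / (1 - y)))).
Proof.
  intros Hy Hn. assert (Hy1 : 1 - y <> 0) by lra.
  assert (Hp : forall k, (1 - y) ^ k <> 0) by (intros; apply pow_nonzero; auto).
  rewrite (rsum_ext K _ (fun i =>
     / rfact (K - n) * (dcoef K i * legp n i (y / (1 - y)))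
     + / rfact (K + n) * (dcoef K i * (fquot i n * legp n i (y / (1 - y))))))
    by (intros; field; rfact_nz).
  rewrite rsum_plus, 2!rsum_scal, sum_dcoef_legp.
  assert (HR := sum_dcoef_legp_reflect n K y Hy Hn).
  apply (f_equal (fun t => t / (1 - y) ^ n)) in HR.
  unfold Rdiv at 1 in HR. rewrite Rmult_comm, <- Rmult_assoc, Rinv_l, Rmult_1_l in HR by auto.
  rewrite HR. clear HR.
  set (w := y / (1 - y)).
  assert (E1 : rsum (S K) (fun j => fquot K j * (harmonic (2 * K) - harmonic (K + j))
                 / (rfact j * rfact (n + j)) * w ^ j)
     = (harmonic (2 * K) - harmonic K) * legp n K w
       - rsum (S K) (fun j => fquot K j * (harmonic (K + j) - harmonic K)
                 / (rfact j * rfact (n + j)) * w ^ j)).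
  { unfold legp. rewrite <- rsum_scal, <- rsum_minus. apply rsum_ext; intros.
    field. rfact_nz. }
  assert (E2 : rsum (S (K - n)) (fun j =>
        fquot K (n + j) * (harmonic (2 * K) - harmonic (K + (n + j)))
        / (rfact j * rfact (n + j)) * w ^ j)
     = (harmonic (2 * K) - harmonic (K + n)) * ((1 - y) ^ n * (fquot K n * legp n K w))
       - rsum (S (K - n)) (fun j =>
           fquot K (n + j) * (harmonic (K + (n + j)) - harmonic (K + n))
           / (rfact j * rfact (n + j)) * w ^ j)).
  { unfold w. rewrite legp_reflect by auto.
    rewrite <- rsum_scal, <- rsum_minus. apply rsum_ext; intros.
    field. rfact_nz; auto. }
  rewrite E1, E2. clear E1 E2.
  assert (D1 := dlegp_transform n K y Hy). assert (D2 := dlegp_reflect n K y Hy Hn).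
  fold w in D1, D2.
  set (s1 := rsum (S K) (fun j => fquot K j * _ / _ * _)) in *.
  set (s2 := rsum (S (K - n)) (fun j => fquot K (n + j) * _ / _ * _)) in *.
  assert (HK : (1 - y) ^ K = (1 - y) ^ (K - n) * (1 - y) ^ n)
    by (rewrite <- pow_add; f_equal; lia).
  rewrite fquot_le by auto.
  (* The product [ff K (n + s) * ff K s] splits as [ff K n * ff (K - n) s * ff K s]. The three terms
     below differentiate one of these factors each. *)
  transitivity (rfact K / rfact (K - n) * (harmonic K - harmonic (K - n))
                  * ((1 - y) ^ K * legp n K w)
                + rfact K / rfact (K - n) * ((1 - y) ^ K * s1)
                + rfact K / rfact (K + n) * ((1 - y) ^ (K - n) * s2)).
  2:{ rewrite HK. field. rfact_nz; auto. }
  rewrite D1, D2. unfold w. rewrite legp_transform by auto.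
  rewrite (rsum_ext (S (K - n)) _ (fun s =>
    rfact (K + n) * dff (INR K) s * ff (INR K - INR n) s
    / (rfact (n + s) * rfact (K - n) * rfact s) * y ^ s)).
  2:{ intros s Hs. rewrite <- minus_INR, ff_fact by lia. field. rfact_nz. }
  rewrite <- (rsum_extend (S (K - n)) (S K)).
  2: lia.
  2:{ intros s Hs. rewrite <- minus_INR, ff_0 by lia. unfold Rdiv; ring. }
  rewrite <- 3!rsum_scal, <- 2!rsum_plus. apply rsum_ext; intros s Hs. unfold dleg.
  rewrite dff_add, ff_add, (dff_harmonic K n), (ff_fact K n), (ff_fact K s) by lia.
  field. rfact_nz.
Qed.

(** [binomial(nu, n + s)] vanishes at [nu = K], so only its own derivative contributes, and
    [dff_above] evaluates that derivative in closed form. *)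
Lemma dleg_high (n K : nat) (y : R) : y <> 1 -> (K < n)%nat ->
  rsum (S K) (fun s => dleg n K s * y ^ s)
  = (-1) ^ (n - K - 1) * rfact (n - K - 1) * rfact K
    * (1 - y) ^ K * legp n K (y / (1 - y)).
Proof.
  intros Hy Hn. rewrite Rmult_assoc, legp_transform, <- rsum_scal by auto.
  apply rsum_ext; intros s Hs. unfold dleg.
  rewrite (ff_0 K (n + s)) by lia.
  replace (n + s)%nat with (S K + (n - K - 1 + s))%nat at 1 by lia.
  rewrite dff_above, (ff_fact K s), pow_add by lia.
  replace (INR K - INR n) with (- (INR (n - K - 1) + 1))
    by (rewrite 2!minus_INR by lia; simpl; ring).
  rewrite ff_opp, <- rf_fact. field. rfact_nz.
Qed.

Lemma leg_low (n K : nat) (y : R) : y <> 1 -> (n <= K)%nat ->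
  rsum (S K) (fun s => ff (INR K) (n + s) / rfact (n + s) * (ff (INR K) s / rfact s) * y ^ s)
  = rfact K / rfact (K - n) * (1 - y) ^ K * legp n K (y / (1 - y)).
Proof.
  intros Hy Hn. rewrite Rmult_assoc, legp_transform, <- rsum_scal by auto.
  apply rsum_ext; intros s Hs.
  rewrite ff_add, (ff_fact K n), (ff_fact K s) by lia. field. rfact_nz.
Qed.

(** * Series *)

Definition rser (f : nat -> R) (l : R) : Prop := is_lim_seq (fun N => rsum N f) l.

Lemma rser_is_series (f : nat -> R) (l : R) : rser f l <-> is_series f l.
Proof.
  unfold rser. split; intros H.
  - apply is_lim_seq_incr_1 in H.
    apply (is_lim_seq_ext (fun n => rsum (S n) f) (sum_n f)) in H; [exact H|].
    intros n; symmetry; apply rsum_sum_n.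
  - apply is_lim_seq_incr_1.
    apply (is_lim_seq_ext (sum_n f)); [|exact H].
    intros n; apply rsum_sum_n.
Qed.

Lemma rser_ext (f g : nat -> R) (l : R) :
  (forall i, f i = g i) -> rser f l -> rser g l.
Proof.
  intros H. apply is_lim_seq_ext; intros n; apply rsum_ext; auto.
Qed.

Lemma rser_plus (f g : nat -> R) (l m : R) :
  rser f l -> rser g m -> rser (fun i => f i + g i) (l + m).
Proof.
  intros H1 H2. eapply is_lim_seq_ext; [intros n; symmetry; apply rsum_plus|].
  apply is_lim_seq_plus'; auto.
Qed.

Lemma rser_scal (f : nat -> R) (l c : R) : rser f l -> rser (fun i => c * f i) (c * l).
Proof.
  intros H1. eapply is_lim_seq_ext; [intros n; symmetry; apply rsum_scal|].
  apply (is_lim_seq_scal_l _ c l); auto.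
Qed.

Lemma rser_unique (f : nat -> R) (l m : R) : rser f l -> rser f m -> l = m.
Proof.
  intros H1 H2. apply is_lim_seq_unique in H1. apply is_lim_seq_unique in H2.
  rewrite H1 in H2. injection H2; auto.
Qed.

Lemma is_lim_seq_unique2 (u : nat -> R) (l m : R) :
  is_lim_seq u l -> is_lim_seq u m -> l = m.
Proof.
  intros H1 H2. apply is_lim_seq_unique in H1. apply is_lim_seq_unique in H2.
  rewrite H1 in H2. injection H2; auto.
Qed.

Lemma is_lim_seq_bound (u : nat -> R) (l B : R) :
  (forall n, u n <= B) -> is_lim_seq u l -> l <= B.
Proof.
  intros H Hl. exact (is_lim_seq_le u (fun _ => B) l B H Hl (is_lim_seq_const B)).
Qed.

Lemma rser_nonneg_ex (f : nat -> R) (B : R) :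
  (forall i, 0 <= f i) -> (forall N, rsum N f <= B) -> exists l, rser f l.
Proof.
  intros H0 HB.
  destruct (ex_finite_lim_seq_incr (fun N => rsum N f) B) as [l Hl].
  - intros n. apply rsum_pos_le; auto.
  - auto.
  - exists l; auto.
Qed.

Lemma rser_partial_le (f : nat -> R) (l : R) (N : nat) :
  (forall i, 0 <= f i) -> rser f l -> rsum N f <= l.
Proof.
  intros H0 Hl.
  apply is_lim_seq_incr_n with (N := N) in Hl.
  apply (is_lim_seq_le (fun _ => rsum N f) (fun n => rsum (n + N) f) (rsum N f) l); auto.
  - intros n. apply rsum_pos_le; auto; lia.
  - apply is_lim_seq_const.
Qed.

Lemma rser_abs_ex (f : nat -> R) (B : R) :
  (forall N, rsum N (fun i => Rabs (f i)) <= B) -> exists l, rser f l.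
Proof.
  intros HB.
  destruct (rser_nonneg_ex (fun i => Rabs (f i)) B) as [l Hl]; auto.
  - intros; apply Rabs_pos.
  - destruct (ex_series_Rabs f) as [m Hm].
    + exists l. apply rser_is_series; auto.
    + exists m. apply rser_is_series; auto.
Qed.

(** A block of terms is dominated by the corresponding block of the majorant; this Cauchy estimate
    is behind both the tail bounds and the interchange of limits. *)
Lemma rsum_diff_abs (f M : nat -> R) (n k : nat) :
  (forall i, Rabs (f i) <= M i) ->
  Rabs (rsum (n + k) f - rsum n f) <= rsum (n + k) M - rsum n M.
Proof.
  intros H. rewrite 2!rsum_add.
  replace (rsum n f + _ - _) with (rsum k (fun i => f (n + i)%nat)) by ring.
  replace (rsum n M + _ - _) with (rsum k (fun i => M (n + i)%nat)) by ring.
  eapply Rle_trans; [apply rsum_Rabs|]. apply rsum_le; auto.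
Qed.

Lemma rser_tail_le (f M : nat -> R) (l S : R) (N : nat) :
  (forall i, Rabs (f i) <= M i) -> rser f l -> rser M S ->
  Rabs (l - rsum N f) <= S - rsum N M.
Proof.
  intros H Hf HM.
  apply is_lim_seq_incr_n with (N := N) in Hf.
  apply is_lim_seq_incr_n with (N := N) in HM.
  apply (is_lim_seq_le (fun n => Rabs (rsum (n + N) f - rsum N f))
          (fun n => rsum (n + N) M - rsum N M) (Rabs (l - rsum N f)) (S - rsum N M)).
  - intros n. rewrite (Nat.add_comm n N). apply rsum_diff_abs; auto.
  - apply (is_lim_seq_abs _ (l - rsum N f)). apply is_lim_seq_minus'; auto.
    apply is_lim_seq_const.
  - apply is_lim_seq_minus'; auto. apply is_lim_seq_const.
Qed.

Lemma rser_geom (x : R) : Rabs x < 1 -> rser (fun i => x ^ i) (/ (1 - x)).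
Proof. intros H. apply rser_is_series, is_series_geom; auto. Qed.

Lemma rser_first (f : nat -> R) (l : R) :
  rser (fun i => f (S i)) l -> rser f (f O + l).
Proof.
  intros H. unfold rser. apply is_lim_seq_incr_1.
  eapply is_lim_seq_ext; [intros n; symmetry; apply rsum_first|].
  apply is_lim_seq_plus'; auto. apply is_lim_seq_const.
Qed.

Lemma rser_shift (f : nat -> R) (l : R) (k : nat) :
  (forall i, (i < k)%nat -> f i = 0) ->
  rser (fun i => f (k + i)%nat) l <-> rser f l.
Proof.
  intros H0. unfold rser. rewrite (is_lim_seq_incr_n (fun N => rsum N f) k).
  split; apply is_lim_seq_ext; intros n; rewrite (Nat.add_comm n k), rsum_add,
    (rsum_0 k) by auto; ring.
Qed.

(** * Fourier coefficients *)

(** Normalized so that [f] has the cosine series with terms [epsilon n * l n * cos (n t)]. Half a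
    period suffices because every function used is a function of [cos t]. As a relation it includes
    the existence of the integral. *)
Definition fcoef (n : nat) (f : R -> R) (l : R) : Prop :=
  is_RInt (fun t => f t * cos (INR n * t)) 0 PI (PI * l).

Lemma fcoef_ext (n : nat) (f g : R -> R) (l : R) :
  (forall t, f t = g t) -> fcoef n f l -> fcoef n g l.
Proof.
  intros H. apply is_RInt_ext. intros t _. rewrite H; auto.
Qed.

Lemma fcoef_plus (n : nat) (f g : R -> R) (l m : R) :
  fcoef n f l -> fcoef n g m -> fcoef n (fun t => f t + g t) (l + m).
Proof.
  intros H1 H2. unfold fcoef. rewrite Rmult_plus_distr_l.
  eapply is_RInt_ext; [|apply (@is_RInt_plus R_NormedModule); [apply H1|apply H2]].
  intros t _. cbv beta. unfold plus; simpl. ring.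
Qed.

Lemma fcoef_scal (n : nat) (f : R -> R) (l c : R) :
  fcoef n f l -> fcoef n (fun t => c * f t) (c * l).
Proof.
  intros H1. unfold fcoef. replace (PI * (c * l)) with (c * (PI * l)) by ring.
  eapply is_RInt_ext; [|apply (@is_RInt_scal R_NormedModule); apply H1].
  intros t _. cbv beta. unfold scal; simpl; unfold mult; simpl. ring.
Qed.

Lemma fcoef_unique (n : nat) (f : R -> R) (l m : R) :
  fcoef n f l -> fcoef n f m -> l = m.
Proof.
  intros H1 H2. apply (Rmult_eq_reg_l PI); [|apply PI_neq0].
  rewrite <- (is_RInt_unique _ _ _ _ H1). apply is_RInt_unique; auto.
Qed.

Lemma fcoef_0 (n : nat) : fcoef n (fun _ => 0) 0.
Proof.
  unfold fcoef. rewrite Rmult_0_r.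
  eapply is_RInt_ext with (f := fun _ => 0); [intros; simpl; ring|].
  replace 0 with (scal (PI - 0) (0:R)) at 2; [apply @is_RInt_const|].
  unfold scal; simpl; unfold mult; simpl. ring.
Qed.

Lemma fcoef_rsum (n N : nat) (f : nat -> R -> R) (l : nat -> R) :
  (forall i, (i < N)%nat -> fcoef n (f i) (l i)) ->
  fcoef n (fun t => rsum N (fun i => f i t)) (rsum N l).
Proof.
  induction N as [|N IH]; intros H; simpl; [apply fcoef_0|].
  apply fcoef_plus; auto.
Qed.

Lemma is_RInt_cos (k : Z) :
  is_RInt (fun t => cos (IZR k * t)) 0 PI (if Z.eqb k 0 then PI else 0).
Proof.
  destruct (Z.eqb_spec k 0) as [->|Hk].
  - apply is_RInt_ext with (f := fun _ => 1).
    + intros. rewrite Rmult_0_l, cos_0; auto.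
    + replace PI with (scal (PI - 0) (1:R)) at 2; [apply @is_RInt_const|].
      unfold scal; simpl; unfold mult; simpl. ring.
  - assert (IZR k <> 0) by (apply eq_IZR_contrapositive; auto).
    replace 0 with (minus (sin (IZR k * PI) / IZR k) (sin (IZR k * 0) / IZR k)) at 2.
    + apply (@is_RInt_derive R_CompleteNormedModule (fun t => sin (IZR k * t) / IZR k)).
      * intros t _. auto_derive; auto. field; auto.
      * intros t _. apply continuity_pt_filterlim. apply derivable_continuous_pt.
        apply ex_derive_Reals_0. auto_derive; auto.
    + unfold minus, plus, opp; simpl.
      rewrite Rmult_0_r, sin_0, (sin_eq_0_1 (IZR k * PI)); [field; auto|].
      exists k; auto.
Qed.

Lemma fcoef_cos (n m : nat) :
  fcoef n (fun t => epsilon m * cos (INR m * t)) (if Nat.eqb m n then 1 else 0).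
Proof.
  assert (H1 := is_RInt_cos (Z.of_nat m - Z.of_nat n)).
  assert (H2 := is_RInt_cos (Z.of_nat m + Z.of_nat n)).
  unfold fcoef.
  assert (H := @is_RInt_scal R_NormedModule _ _ _ (epsilon m / 2) _
                 (@is_RInt_plus R_NormedModule _ _ _ _ _ _ H1 H2)).
  eapply is_RInt_ext in H.
  - replace (PI * (if Nat.eqb m n then 1 else 0)) with
      (scal (epsilon m / 2) (plus (if (Z.of_nat m - Z.of_nat n =? 0)%Z then PI else 0)
         (if (Z.of_nat m + Z.of_nat n =? 0)%Z then PI else 0))); [exact H|].
    unfold scal, plus; simpl; unfold mult; simpl. unfold epsilon.
    destruct (Nat.eqb_spec m n), (Nat.eqb_spec m 0),
      (Z.eqb_spec (Z.of_nat m - Z.of_nat n) 0), (Z.eqb_spec (Z.of_nat m + Z.of_nat n) 0);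
      try lia; field.
  - intros t _. unfold scal, plus; simpl; unfold mult; simpl.
    rewrite minus_IZR, plus_IZR, <- 2!INR_IZR_INZ.
    replace ((INR m - INR n) * t) with (INR m * t - INR n * t) by ring.
    replace ((INR m + INR n) * t) with (INR m * t + INR n * t) by ring.
    rewrite cos_minus, cos_plus. field.
Qed.

(** The majorant makes the convergence uniform in [t], so limit and integral may be exchanged; the
    convergence of the series of coefficients comes out as part of the conclusion. *)
Lemma fcoef_series (n : nat) (f : nat -> R -> R) (l M : nat -> R) (F : R -> R) (S : R) :
  (forall i, fcoef n (f i) (l i)) ->
  (forall i t, Rabs (f i t) <= M i) -> rser M S ->
  (forall t, rser (fun i => f i t) (F t)) ->
  exists L, rser l L /\ fcoef n F L.
Proof.
  intros Hf HM HS HF.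
  destruct (@filterlim_RInt nat R_CompleteNormedModule
    (fun N t => rsum N (fun i => f i t) * cos (INR n * t)) 0 PI eventually _
    (fun t => F t * cos (INR n * t)) (fun N => PI * rsum N l)) as [If [H1 H2]].
  - intros N. apply fcoef_rsum; auto.
  - apply filterlim_locally. intros eps.
    assert (HS' := HS). apply is_lim_seq_spec in HS'. destruct (HS' eps) as [N0 HN0].
    exists N0. intros N HN t.
    change (Rabs (rsum N (fun i => f i t) * cos (INR n * t) - F t * cos (INR n * t)) < eps).
    rewrite <- Rmult_minus_distr_r, Rabs_mult, Rabs_minus_sym.
    assert (HT := rser_tail_le _ _ _ _ N (fun i => HM i t) (HF t) HS).
    specialize (HN0 N HN). rewrite Rabs_minus_sym in HN0. apply Rabs_def2 in HN0.
    assert (Rabs (cos (INR n * t)) <= 1) by (apply Rabs_le; apply COS_bound).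
    assert (0 <= Rabs (cos (INR n * t))) by apply Rabs_pos.
    assert (0 <= Rabs (F t - rsum N (fun i => f i t))) by apply Rabs_pos.
    apply Rle_lt_trans with (Rabs (F t - rsum N (fun i => f i t)) * 1); [|lra].
    apply Rmult_le_compat_l; auto.
  - exists (If / PI). split.
    + apply is_lim_seq_ext with (fun N => / PI * (PI * rsum N l)).
      * intros N. field. apply PI_neq0.
      * replace (If / PI) with (/ PI * If) by (unfold Rdiv; ring).
        apply (is_lim_seq_scal_l _ (/ PI) If). exact H1.
    + unfold fcoef. assert (E : forall a : R, PI * (a / PI) = a) by (intros; field; apply PI_neq0).
      rewrite E. exact H2.
Qed.

(** * Powers of cosines *)

(* The coefficient of (t/2)^s in Bessel's I_{L+lam}(t) (t/2)^(-lam). *)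
Definition kap (lam s L : nat) : R :=
  if andb (Nat.leb L s) (Nat.even (s - L))
  then / (rfact ((s - L) / 2) * rfact ((s - L) / 2 + L + lam)) else 0.

Lemma kap_eq (lam L j : nat) :
  kap lam (L + 2 * j) L = / (rfact j * rfact (j + L + lam)).
Proof.
  unfold kap. replace (L + 2 * j - L)%nat with (j * 2)%nat by lia.
  rewrite Nat.div_mul by lia.
  replace (Nat.leb L (L + 2 * j)) with true by (symmetry; apply Nat.leb_le; lia).
  rewrite Nat.even_mul, Bool.orb_true_r. auto.
Qed.

Lemma parity_cases (s L : nat) :
  (exists j, s = (L + 2 * j)%nat) \/ (forall j, s <> (L + 2 * j)%nat).
Proof.
  destruct (le_lt_dec L s) as [H|H]; [|right; lia].
  destruct (Nat.Even_or_Odd (s - L)) as [[j Hj]|[j Hj]].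
  - left; exists j; lia.
  - right; lia.
Qed.

Lemma kap_0 (lam s L : nat) : (forall j, s <> (L + 2 * j)%nat) -> kap lam s L = 0.
Proof.
  intros H. unfold kap. destruct (andb _ _) eqn:E; auto.
  apply andb_prop in E. destruct E as [E1 E2]. apply Nat.leb_le in E1.
  apply Nat.even_spec in E2. destruct E2 as [j Hj]. exfalso. apply (H j). lia.
Qed.

Lemma kap_gt (lam s L : nat) : (s < L)%nat -> kap lam s L = 0.
Proof. intros H; apply kap_0; lia. Qed.

(** The coefficients depend on [L] and [lam] only through [(s - L)/2] and [L + lam]. This carries a
    question in dimension [2 lam + 2] to the circle. *)
Lemma kap_shift (lam s L : nat) : kap lam s L = kap 0 (s + lam) (L + lam).
Proof.
  destruct (parity_cases s L) as [[j ->]|H].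
  - replace (L + 2 * j + lam)%nat with (L + lam + 2 * j)%nat by lia.
    rewrite 2!kap_eq. do 3 f_equal. lia.
  - rewrite 2!kap_0; auto. intros j Hj; apply (H j); lia.
Qed.

Lemma kap_nonneg (lam s L : nat) : 0 <= kap lam s L.
Proof.
  destruct (parity_cases s L) as [[j ->]|H].
  - rewrite kap_eq. left. apply Rinv_0_lt_compat, Rmult_lt_0_compat; apply rfact_pos.
  - rewrite kap_0; auto; lra.
Qed.

(** The Bessel recurrence [2 I_(m+1)' = I_m + I_(m+2)], read off at the coefficient of [(t/2)^s];
    [kap_step_0] is [I_0' = I_1]. *)
Lemma kap_step (s m : nat) :
  (INR s + 1) * kap 0 (S s) (S m) = kap 0 s m + kap 0 s (S (S m)).
Proof.
  destruct (parity_cases s m) as [[j ->]|H].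
  - replace (S (m + 2 * j)) with (S m + 2 * j)%nat by lia. rewrite 2!kap_eq.
    rewrite !Nat.add_0_r, Nat.add_succ_r, rfact_S.
    rewrite plus_INR, mult_INR. simpl (INR 2). pose proof (pos_INR j); pose proof (pos_INR m).
    destruct j as [|j].
    + rewrite kap_gt by lia. simpl. rewrite rfact_0. field.
      split; [apply rfact_neq_0|lra].
    + replace (m + 2 * S j)%nat with (S (S m) + 2 * j)%nat by lia. rewrite kap_eq.
      replace (j + S (S m) + 0)%nat with (S (S j + m)) by lia.
      rewrite (rfact_S (S j + m)), (rfact_S j), plus_INR, S_INR in *.
      field. pose proof (pos_INR j). split; [apply rfact_neq_0|].
      split; [lra|]. split; [apply rfact_neq_0|lra].
  - rewrite 3!kap_0; [ring| | |]; intros j Hj.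
    + apply (H (S j)); lia.
    + apply (H j); lia.
    + apply (H j); lia.
Qed.

Lemma kap_step_0 (s : nat) : (INR s + 1) * kap 0 (S s) 0 = 2 * kap 0 s 1.
Proof.
  destruct (parity_cases s 1) as [[j ->]|H].
  - replace (S (1 + 2 * j)) with (0 + 2 * S j)%nat by lia. rewrite 2!kap_eq.
    replace (S j + 0 + 0)%nat with (S j) by lia. replace (j + 1 + 0)%nat with (S j) by lia.
    rewrite plus_INR, mult_INR. simpl (INR 2). simpl (INR 1). rewrite (rfact_S j).
    pose proof (pos_INR j). field. split; [apply rfact_neq_0|lra].
  - rewrite 2!kap_0; [ring| |]; intros j Hj.
    + apply (H j); lia.
    + destruct j; [lia|]. apply (H j); lia.
Qed.

Lemma epsilon_0 : epsilon 0 = 1.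
Proof. reflexivity. Qed.

Lemma epsilon_S (m : nat) : epsilon (S m) = 2.
Proof. reflexivity. Qed.

Lemma epsilon_ge_1 (m : nat) : 1 <= epsilon m.
Proof. destruct m; [rewrite epsilon_0|rewrite epsilon_S]; lra. Qed.

Lemma cos_step (m : nat) (t : R) :
  cos (INR (S (S m)) * t) = 2 * cos t * cos (INR (S m) * t) - cos (INR m * t).
Proof.
  rewrite !S_INR.
  replace ((INR m + 1 + 1) * t) with ((INR m + 1) * t + t) by ring.
  replace (INR m * t) with ((INR m + 1) * t - t) by ring.
  rewrite cos_plus, cos_minus. ring.
Qed.

(** The coefficient of [(tau/2)^s] in the Jacobi-Anger expansion of [exp (tau cos t)] in Bessel
    functions [I_m(tau)]. In the induction on [s], multiplication by [2 cos t] moves the frequency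
    both ways, which is what [kap_step] does to the coefficients; frequency [0] needs
    [kap_step_0]. *)
Lemma cos_pow_kap (s N : nat) (t : R) : (s < N)%nat ->
  rsum N (fun m => epsilon m * cos (INR m * t) * kap 0 s m) = (2 * cos t) ^ s / rfact s.
Proof.
  revert N; induction s as [|s IH]; intros N HN.
  - rewrite (rsum_single N 0); [|lia|].
    + change (kap 0 0 0) with (kap 0 (0 + 2 * 0) 0). rewrite kap_eq, epsilon_0.
      simpl INR. simpl pow. rewrite Rmult_0_l, cos_0.
      change (0 + 0 + 0)%nat with 0%nat. rewrite rfact_0. field.
    + intros i Hi Hi'. rewrite kap_gt by lia. ring.
  - rewrite rfact_S. simpl pow.
    apply (Rmult_eq_reg_l (INR s + 1)); [|apply INR_S_neq_0].
    transitivity (2 * cos t * ((2 * cos t) ^ s / rfact s)).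
    2:{ field. split; [apply rfact_neq_0|apply INR_S_neq_0]. }
    rewrite <- (IH (S (S N))) by lia. rewrite <- 2!rsum_scal.
    rewrite <- (rsum_extend N (S (S N))).
    2: lia.
    2:{ intros i Hi. rewrite kap_gt by lia. ring. }
    rewrite (rsum_first (S N) (fun i => (INR s + 1) * _)).
    rewrite (rsum_ext (S N) _ (fun i => 2 * cos (INR (S i) * t) * kap 0 s i
                             + 2 * cos (INR (S i) * t) * kap 0 s (S (S i)))).
    2:{ intros i Hi. rewrite epsilon_S.
        transitivity (2 * cos (INR (S i) * t) * ((INR s + 1) * kap 0 (S s) (S i))); [ring|].
        rewrite kap_step. ring. }
    rewrite rsum_plus.
    rewrite (rsum_first (S N) (fun i => 2 * cos t * _)).
    rewrite (rsum_ext (S N) (fun i => 2 * cos t * _)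
              (fun i => 2 * cos (INR i * t) * kap 0 s (S i)
                        + 2 * cos (INR (S (S i)) * t) * kap 0 s (S i))).
    2:{ intros i Hi. rewrite epsilon_S, cos_step. ring. }
    rewrite rsum_plus.
    rewrite (rsum_first N (fun i => 2 * cos (INR i * t) * kap 0 s (S i))).
    rewrite (rsum_first N (fun i => 2 * cos (INR (S i) * t) * kap 0 s i)).
    rewrite (rsum_S N (fun i => 2 * cos (INR (S i) * t) * kap 0 s (S (S i)))).
    rewrite (rsum_S N (fun i => 2 * cos (INR (S (S i)) * t) * kap 0 s (S i))).
    rewrite (kap_gt 0 s (S (S N))), (kap_gt 0 s (S N)), epsilon_0 by lia.
    replace (epsilon 0 * cos (INR 0 * t)) with 1
      by (simpl INR; rewrite Rmult_0_l, cos_0, epsilon_0; ring).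
    replace (cos (INR 0 * t)) with 1 by (simpl INR; rewrite Rmult_0_l, cos_0; ring).
    replace (cos (INR 1 * t)) with (cos t) by (simpl INR; rewrite Rmult_1_l; auto).
    transitivity ((INR s + 1) * kap 0 (S s) 0 +
      (2 * cos t * kap 0 s 0 +
       rsum N (fun i => 2 * cos (INR (S (S i)) * t) * kap 0 s (S i)) +
       rsum N (fun i => 2 * cos (INR (S i) * t) * kap 0 s (S (S i))))); [ring|].
    rewrite kap_step_0. ring.
Qed.

Lemma fcoef_cos_pow (n s : nat) :
  fcoef n (fun t => cos t ^ s) (rfact s / 2 ^ s * kap 0 s n).
Proof.
  assert (H2 : 2 ^ s <> 0) by (apply pow_nonzero; lra).
  set (N := S (s + n)).
  apply fcoef_ext with (fun t => rfact s / 2 ^ s *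
    rsum N (fun m => kap 0 s m * (epsilon m * cos (INR m * t)))).
  - intros t. rewrite (rsum_ext _ _ (fun m => epsilon m * cos (INR m * t) * kap 0 s m))
      by (intros; ring).
    rewrite cos_pow_kap by (unfold N; lia). rewrite Rpow_mult_distr. field.
    split; auto; apply rfact_neq_0.
  - apply fcoef_scal.
    replace (kap 0 s n) with (rsum N (fun m => kap 0 s m * (if Nat.eqb m n then 1 else 0))).
    + apply (fcoef_rsum n N (fun m t => kap 0 s m * (epsilon m * cos (INR m * t)))).
      intros i Hi. apply fcoef_scal, fcoef_cos.
    + rewrite (rsum_single N n); [|unfold N; lia|].
      * rewrite Nat.eqb_refl; ring.
      * intros i _ Hi. apply Nat.eqb_neq in Hi; rewrite Hi; ring.
Qed.

Lemma Rabs_cos_le (t : R) : Rabs (cos t) <= 1.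
Proof. apply Rabs_le, COS_bound. Qed.

(** * Fourier coefficients of the logarithmic kernel *)

Definition kern (x t : R) : R := 1 - 2 * x * cos t + x ^ 2.

Lemma kern_pos (x t : R) : Rabs x < 1 -> 0 < kern x t.
Proof.
  intros H. unfold kern. pose proof (COS_bound t). apply Rabs_def2 in H.
  assert (0 < (1 - x) ^ 2) by (apply pow_lt; lra).
  assert (0 < (1 + x) ^ 2) by (apply pow_lt; lra).
  destruct (Rle_dec 0 x).
  - assert (0 <= x * (1 - cos t)) by (apply Rmult_le_pos; lra). nra.
  - assert (0 <= (- x) * (1 + cos t)) by (apply Rmult_le_pos; lra). nra.
Qed.

(** Multiplying a partial sum by [kern] telescopes it, up to a remainder of absolute value at most
    [2 |x|^N]. *)
Lemma rser_cos_geom (x t : R) : Rabs x < 1 ->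
  rser (fun i => cos (INR (S i) * t) * x ^ i) ((cos t - x) / kern x t).
Proof.
  intros H. assert (Hk := kern_pos x t H).
  apply is_lim_seq_ext with (fun N =>
    (cos t - x - (cos (INR (S N) * t) - cos (INR N * t) * x) * x ^ N) / kern x t).
  - intros N. apply (Rmult_eq_reg_l (kern x t)); [|lra].
    transitivity (cos t - x - (cos (INR (S N) * t) - cos (INR N * t) * x) * x ^ N);
      [field; lra|].
    induction N as [|N IH].
    + simpl. rewrite Rmult_0_l, Rmult_1_l, cos_0. ring.
    + rewrite rsum_S, Rmult_plus_distr_l, <- IH, cos_step. unfold kern. simpl pow. ring.
  - replace (Finite ((cos t - x) / kern x t))
      with (Finite ((cos t - x - 0) / kern x t)) by (rewrite Rminus_0_r; auto).
    unfold Rdiv. apply (is_lim_seq_mult' _ _ (cos t - x - 0) (/ kern x t)).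
    + apply is_lim_seq_minus'; [apply is_lim_seq_const|].
      apply is_lim_seq_abs_0.
      apply is_lim_seq_le_le with (u := fun _ => 0) (w := fun n => 2 * Rabs x ^ n).
      * intros n. split; [apply Rabs_pos|]. rewrite Rabs_mult, RPow_abs.
        apply Rmult_le_compat_r; [apply Rabs_pos|].
        eapply Rle_trans; [apply Rabs_triang|]. rewrite Rabs_Ropp, Rabs_mult.
        assert (H1 := Rabs_cos_le (INR (S n) * t)). assert (H2 := Rabs_cos_le (INR n * t)).
        pose proof (Rabs_pos (cos (INR n * t))). pose proof (Rabs_pos x). nra.
      * apply is_lim_seq_const.
      * replace 0 with (2 * 0) by ring. apply (is_lim_seq_scal_l _ 2 0).
        apply is_lim_seq_geom. rewrite Rabs_Rabsolu; auto.
    + apply is_lim_seq_const.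
Qed.

Definition logcoef (t : R) (i : nat) : R :=
  match i with O => 0 | S _ => -2 * cos (INR i * t) / INR i end.

Lemma logcoef_bound (t : R) (i : nat) : Rabs (logcoef t i) <= 2.
Proof.
  destruct i as [|i]; [simpl; rewrite Rabs_R0; lra|].
  unfold logcoef, Rdiv. assert (1 <= INR (S i)) by (apply (le_INR 1); lia).
  rewrite !Rabs_mult. rewrite (Rabs_left (-2)) by lra.
  assert (H1 := Rabs_cos_le (INR (S i) * t)). pose proof (Rabs_pos (cos (INR (S i) * t))).
  rewrite Rabs_inv, (Rabs_right (INR (S i))) by lra.
  assert (/ INR (S i) <= 1) by (rewrite <- Rinv_1; apply Rinv_le_contravar; lra).
  assert (0 < / INR (S i)) by (apply Rinv_0_lt_compat; lra). nra.
Qed.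

Lemma CV_radius_bounded_coef (a : nat -> R) (B x : R) :
  (forall i, Rabs (a i) <= B) -> Rabs x < 1 -> Rbar_lt (Rabs x) (CV_radius a).
Proof.
  intros H Hx. apply Rbar_lt_le_trans with 1; [exact Hx|].
  destruct (CV_radius_bounded a) as [Hub _]. apply Hub.
  exists B. intros n. rewrite pow1, Rmult_1_r. auto.
Qed.

(** Both sides vanish at [x = 0] and have the same derivative in [x], which [rser_cos_geom] sums. *)
Lemma rser_log_kern (x t : R) : 0 < x < 1 ->
  rser (fun i => logcoef t i * x ^ i) (ln (kern x t)).
Proof.
  intros Hx.
  assert (Hr : forall u, Rabs u < 1 -> Rbar_lt (Rabs u) (CV_radius (logcoef t)))
    by (intros u Hu; apply CV_radius_bounded_coef with 2; auto; apply logcoef_bound).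
  assert (Hu : forall u, 0 <= u <= x -> Rabs u < 1)
    by (intros u Hu; rewrite Rabs_right; lra).
  assert (E : (fun u => ln (kern u t) - PSeries (logcoef t) u) 0
              = (fun u => ln (kern u t) - PSeries (logcoef t) u) x).
  { apply (@eq_is_derive R_NormedModule
      (fun u => ln (kern u t) - PSeries (logcoef t) u) 0 x); [|lra]. intros u Hu'.
    assert (Hk := kern_pos u t (Hu u Hu')).
    replace (@zero R_NormedModule) with ((2 * u - 2 * cos t) / kern u t
               - PSeries (PS_derive (logcoef t)) u).
    - apply (@is_derive_minus R_AbsRing R_NormedModule).
      + unfold kern in *. auto_derive; auto. field. lra.
      + apply is_derive_PSeries. auto.
    - replace (PSeries (PS_derive (logcoef t)) u) with ((2 * u - 2 * cos t) / kern u t);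
        [unfold zero; simpl; ring|].
      symmetry. apply is_series_unique, rser_is_series.
      apply rser_ext with (fun i => -2 * (cos (INR (S i) * t) * u ^ i)).
      + intros i. unfold PS_derive, logcoef. field. apply not_0_INR; lia.
      + replace ((2 * u - 2 * cos t) / kern u t) with (-2 * ((cos t - u) / kern u t))
          by (field; lra).
        apply rser_scal, rser_cos_geom. auto. }
  cbv beta in E. rewrite PSeries_0 in E.
  replace (kern 0 t) with 1 in E by (unfold kern; ring). rewrite ln_1 in E.
  simpl logcoef in E.
  assert (E' : ln (kern x t) = PSeries (logcoef t) x) by lra. rewrite E'.
  apply rser_is_series. apply is_series_ext with (fun n => scal (x ^ n) (logcoef t n)).
  { intros n. unfold scal; simpl; unfold mult; simpl; ring. }
  apply PSeries_correct, CV_radius_inside, Hr, Hu. lra.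
Qed.

Lemma fcoef_kern_series (n : nat) (x : R) (b : nat -> R) (B : R) (F : R -> R) :
  0 < x < 1 -> (forall i, Rabs (b i) <= B) ->
  (forall t, rser (fun i => b i * x ^ i * (epsilon i * cos (INR i * t))) (F t)) ->
  fcoef n F (b n * x ^ n).
Proof.
  intros Hx Hb HF.
  destruct (fcoef_series n (fun i t => b i * x ^ i * (epsilon i * cos (INR i * t)))
    (fun i => b i * x ^ i * (if Nat.eqb i n then 1 else 0))
    (fun i => (B * 2) * x ^ i) F ((B * 2) * / (1 - x))) as [L [H1 H2]].
  - intros i. apply (fcoef_scal n (fun t => epsilon i * cos (INR i * t))). apply fcoef_cos.
  - intros i t. rewrite !Rabs_mult, (Rabs_right (x ^ i)) by (apply Rle_ge, pow_le; lra).
    assert (H1 := Rabs_cos_le (INR i * t)). pose proof (Rabs_pos (cos (INR i * t))).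
    assert (H3 : Rabs (epsilon i) <= 2)
      by (destruct i; [rewrite epsilon_0|rewrite epsilon_S]; rewrite Rabs_right; lra).
    assert (0 <= x ^ i) by (apply pow_le; lra). specialize (Hb i).
    pose proof (Rabs_pos (b i)). pose proof (Rabs_pos (epsilon i)).
    assert (Rabs (epsilon i) * Rabs (cos (INR i * t)) <= 2 * 1)
      by (apply Rmult_le_compat; auto).
    replace (B * 2 * x ^ i) with (B * x ^ i * (2 * 1)) by ring.
    apply Rmult_le_compat; auto; try (apply Rmult_le_pos; auto).
    apply Rmult_le_compat_r; auto.
  - apply rser_scal, rser_geom. rewrite Rabs_right; lra.
  - auto.
  - replace (b n * x ^ n) with L; auto.
    apply (rser_unique _ _ _ H1).
    apply is_lim_seq_incr_n with (N := S n).
    apply is_lim_seq_ext with (fun _ => b n * x ^ n); [|apply is_lim_seq_const].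
    intros N. rewrite (rsum_single _ n); [rewrite Nat.eqb_refl; ring|lia|].
    intros i _ Hi. apply Nat.eqb_neq in Hi; rewrite Hi; ring.
Qed.

Lemma fcoef_log_kern (n : nat) (x : R) : 0 < x < 1 ->
  fcoef n (fun t => ln (kern x t))
        ((match n with O => 0 | S _ => - / INR n end) * x ^ n).
Proof.
  intros Hx.
  apply (fcoef_kern_series n x (fun n => match n with O => 0 | S _ => - / INR n end) 1); auto.
  - intros [|i]; [rewrite Rabs_R0; lra|].
    assert (1 <= INR (S i)) by (apply (le_INR 1); lia).
    rewrite Rabs_Ropp, Rabs_right.
    + rewrite <- Rinv_1. apply Rinv_le_contravar; lra.
    + left. apply Rinv_0_lt_compat. lra.
  - intros t. eapply rser_ext; [|apply rser_log_kern; auto].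
    intros [|i]; [simpl; ring|]. rewrite epsilon_S. unfold logcoef.
    field. apply not_0_INR; lia.
Qed.

Lemma fcoef_poisson (n : nat) (x : R) : 0 < x < 1 ->
  fcoef n (fun t => (1 - x ^ 2) / kern x t) (x ^ n).
Proof.
  intros Hx. rewrite <- (Rmult_1_l (x ^ n)).
  apply (fcoef_kern_series n x (fun _ => 1) 1); auto.
  - intros; rewrite Rabs_R1; lra.
  - intros t. assert (Hx' : Rabs x < 1) by (rewrite Rabs_right; lra).
    assert (Hk := kern_pos x t Hx').
    replace ((1 - x ^ 2) / kern x t)
      with (1 * x ^ 0 * (epsilon 0 * cos (INR 0 * t)) + 2 * x * ((cos t - x) / kern x t)).
    + apply (rser_first (fun i => 1 * x ^ i * (epsilon i * cos (INR i * t)))).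
      eapply rser_ext; [|apply rser_scal, rser_cos_geom; auto].
      intros i. cbv beta. rewrite epsilon_S. simpl pow. ring.
    + simpl INR. rewrite Rmult_0_l, cos_0, epsilon_0. unfold kern in *. simpl pow. field. lra.
Qed.

(** The factor [2 cos t] sends [cos ((n+1) t)] to [cos (n t) + cos ((n+2) t)], so [kern] acts on
    Fourier coefficients as a three-term operator. At [n = 0] the two neighbours coincide, whence
    the factor [2] in [fcoef_mul_0]. *)
Lemma fcoef_mul_S (n : nat) (x : R) (f : R -> R) (l0 l l1 : R) :
  fcoef n f l0 -> fcoef (S n) f l -> fcoef (S (S n)) f l1 ->
  fcoef (S n) (fun t => kern x t * f t) ((1 + x ^ 2) * l - x * (l0 + l1)).
Proof.
  intros H0 H H1. unfold fcoef in *.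
  assert (G := @is_RInt_plus R_NormedModule _ _ _ _ _ _
     (@is_RInt_scal R_NormedModule _ _ _ (1 + x ^ 2) _ H)
     (@is_RInt_scal R_NormedModule _ _ _ (- x) _
        (@is_RInt_plus R_NormedModule _ _ _ _ _ _ H0 H1))).
  replace (PI * ((1 + x ^ 2) * l - x * (l0 + l1)))
    with ((1 + x ^ 2) * (PI * l) + - x * (PI * l0 + PI * l1)) by ring.
  eapply is_RInt_ext; [|exact G].
  intros t _. unfold plus, scal; simpl; unfold mult; simpl.
  change (match n with O => 1 | S _ => INR n + 1 end) with (INR (S n)).
  replace (INR (S n) + 1) with (INR (S (S n))) by (rewrite (S_INR (S n)); ring).
  rewrite cos_step. unfold kern. ring.
Qed.

Lemma fcoef_mul_0 (x : R) (f : R -> R) (l l1 : R) :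
  fcoef 0 f l -> fcoef 1 f l1 ->
  fcoef 0 (fun t => kern x t * f t) ((1 + x ^ 2) * l - 2 * x * l1).
Proof.
  intros H H1. unfold fcoef in *.
  assert (G := @is_RInt_plus R_NormedModule _ _ _ _ _ _
     (@is_RInt_scal R_NormedModule _ _ _ (1 + x ^ 2) _ H)
     (@is_RInt_scal R_NormedModule _ _ _ (- (2 * x)) _ H1)).
  replace (PI * ((1 + x ^ 2) * l - 2 * x * l1))
    with ((1 + x ^ 2) * (PI * l) + - (2 * x) * (PI * l1)) by ring.
  eapply is_RInt_ext; [|exact G].
  intros t _. unfold plus, scal; simpl; unfold mult; simpl.
  rewrite Rmult_0_l, cos_0, Rmult_1_l. unfold kern. ring.
Qed.

(** With [y = x^2], this is the coefficient of [exp (i n t)] in [F(x e^(it)) G(x e^(-it))], divided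
    by [x^n], where [F] and [G] have Taylor coefficients [f] and [g]. *)
Definition bil (f g : nat -> R) (N n : nat) (y : R) : R :=
  rsum N (fun j => f (n + j)%nat * g j * y ^ j).

(** The effect on Taylor coefficients of multiplying a function of [T] by [1 + T]. The sequences
    [binc K] and [dbinc K] below belong to [(1 + T)^K] and [(1 + T)^K log (1 + T)], and [kern] is
    [(1 - x e^(it)) (1 - x e^(-it))]. *)
Definition pascal_step (f f' : nat -> R) : Prop :=
  f' O = f O /\ forall i, f' (S i) = f (S i) + f i.

Lemma bil_step_S (f g f' g' : nat -> R) (N n : nat) (y : R) :
  pascal_step f f' -> pascal_step g g' -> (forall k, f (k + N)%nat * g N = 0) ->
  bil f' g' (S N) (S n) y
  = (1 + y) * bil f g N (S n) y + bil f g N n y + y * bil f g N (S (S n)) y.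
Proof.
  intros [Hf0 Hf] [Hg0 Hg] HN. unfold bil.
  rewrite rsum_first, Hg0.
  rewrite (rsum_ext N _ (fun j => f (S n + S j)%nat * g (S j) * y ^ S j
     + f (n + S j)%nat * g (S j) * y ^ S j
     + y * (f (S n + j)%nat * g j * y ^ j + f (S (S n) + j)%nat * g j * y ^ j))).
  2:{ intros j Hj. change (S n + S j)%nat with (S (n + S j)). rewrite Hf, Hg.
      replace (S (S n) + j)%nat with (S (n + S j)) by lia.
      replace (S n + j)%nat with (n + S j)%nat by lia. simpl pow. ring. }
  rewrite 2!rsum_plus, rsum_scal, rsum_plus.
  change (S n + 0)%nat with (S (n + 0)). rewrite Hf.
  assert (E1 : forall k, rsum N (fun j => f (k + j)%nat * g j * y ^ j)
     = f (k + 0)%nat * g O * y ^ 0 + rsum N (fun j => f (k + S j)%nat * g (S j) * y ^ S j)).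
  { intros k. rewrite <- rsum_first with (f := fun j => f (k + j)%nat * g j * y ^ j).
    simpl. rewrite HN. ring. }
  rewrite (E1 n). pose proof (E1 (S n)) as E2. change (S n + 0)%nat with (S (n + 0)) in E2.
  set (a := rsum N (fun j => f (S n + S j)%nat * g (S j) * y ^ S j)) in *.
  set (b := rsum N (fun j => f (n + S j)%nat * g (S j) * y ^ S j)) in *.
  set (c := rsum N (fun j => f (S n + j)%nat * g j * y ^ j)) in *.
  set (d := rsum N (fun j => f (S (S n) + j)%nat * g j * y ^ j)) in *.
  rewrite E2. ring.
Qed.

(** At frequency [0] the neighbour of frequency [-1] enters; it is frequency [1] with [f] and [g]
    exchanged. *)
Lemma bil_step_0 (f g f' g' : nat -> R) (N : nat) (y : R) :
  pascal_step f f' -> pascal_step g g' -> (forall k, f (k + N)%nat * g N = 0) ->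
  (forall k, g (k + N)%nat * f N = 0) ->
  bil f' g' (S N) 0 y
  = (1 + y) * bil f g N 0 y + y * bil f g N 1 y + y * bil g f N 1 y.
Proof.
  intros [Hf0 Hf] [Hg0 Hg] HN HN'. unfold bil.
  rewrite rsum_first. simpl Nat.add. rewrite Hg0, Hf0.
  rewrite (rsum_ext N _ (fun j => f (S j) * g (S j) * y ^ S j
     + y * (f j * g j * y ^ j) + y * (f (S j) * g j * y ^ j) + y * (g (S j) * f j * y ^ j))).
  2:{ intros j Hj. rewrite Hf, Hg. simpl pow. ring. }
  rewrite 3!rsum_plus, 3!rsum_scal.
  assert (E1 : rsum N (fun j => f j * g j * y ^ j)
     = f O * g O * y ^ 0 + rsum N (fun j => f (S j) * g (S j) * y ^ S j)).
  { rewrite <- rsum_first with (f := fun j => f j * g j * y ^ j).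
    simpl. pose proof (HN O) as H0; simpl in H0. rewrite H0. ring. }
  rewrite Rmult_plus_distr_r, Rmult_1_l, E1. ring.
Qed.

Definition binc (K i : nat) : R := ff (INR K) i / rfact i.
Definition dbinc (K i : nat) : R := dff (INR K) i / rfact i.

Lemma binc_step (K : nat) : pascal_step (binc K) (binc (S K)).
Proof.
  split; [reflexivity|]. intros i. unfold binc. rewrite S_INR, ff_pascal, rfact_S.
  field. split; [apply rfact_neq_0|apply INR_S_neq_0].
Qed.

Lemma dbinc_step (K : nat) : pascal_step (dbinc K) (dbinc (S K)).
Proof.
  split; [reflexivity|]. intros i. unfold dbinc. rewrite S_INR, dff_pascal, rfact_S.
  field. split; [apply rfact_neq_0|apply INR_S_neq_0].
Qed.

Lemma binc_gt (K i : nat) : (K < i)%nat -> binc K i = 0.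
Proof. intros H. unfold binc. rewrite ff_0 by auto. unfold Rdiv; ring. Qed.

(** The logarithm of [kern] is the sum of two conjugate logarithms, which gives the two [bil] terms.
    Induction on [K] avoids any product of infinite series: the case [K = 0] is the known
    logarithmic series, and a factor [kern] acts by the same three-term rule on both sides. *)
Lemma fcoef_kern_pow_log (K n : nat) (x : R) : 0 < x < 1 ->
  fcoef n (fun t => kern x t ^ K * ln (kern x t))
    ((- x) ^ n * rsum (S K) (fun s => dleg n K s * (x ^ 2) ^ s)).
Proof.
  intros Hx.
  assert (E : forall K n, rsum (S K) (fun s => dleg n K s * (x ^ 2) ^ s)
     = bil (dbinc K) (binc K) (S K) n (x ^ 2) + bil (binc K) (dbinc K) (S K) n (x ^ 2)).
  { intros. unfold bil. rewrite <- rsum_plus. apply rsum_ext; intros.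
    unfold dleg, binc, dbinc. ring. }
  assert (G1 : forall K k, dbinc K (k + S K)%nat * binc K (S K) = 0)
    by (intros; rewrite (binc_gt K0 (S K0)) by lia; ring).
  assert (G2 : forall K k, binc K (k + S K)%nat * dbinc K (S K) = 0)
    by (intros; rewrite (binc_gt K0) by lia; ring).
  rewrite E. clear E. revert n; induction K as [|K IH]; intros n.
  - eapply fcoef_ext; [intros t; simpl pow; symmetry; apply Rmult_1_l|].
    replace ((- x) ^ n * _) with ((match n with O => 0 | S _ => - / INR n end) * x ^ n);
      [apply fcoef_log_kern; auto|].
    unfold bil. simpl rsum. rewrite Nat.add_0_r.
    replace (binc 0 0) with 1 by (unfold binc; simpl; rewrite rfact_0; field).
    replace (dbinc 0 0) with 0 by (unfold dbinc; simpl; rewrite rfact_0; field).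
    replace (- x) with (-1 * x) by ring. rewrite Rpow_mult_distr.
    destruct n as [|n]; [unfold dbinc; simpl; rewrite rfact_0; field|].
    unfold dbinc. change (dff (INR 0) (S n)) with (dff (INR 0) (1 + n)).
    rewrite dff_above, rfact_0, rfact_S, S_INR.
    transitivity ((- (((-1) ^ n * (-1) ^ n)) / (INR n + 1)) * x ^ S n).
    + rewrite pow_m1_sq. field. apply INR_S_neq_0.
    + simpl pow. field. split; [apply rfact_neq_0|apply INR_S_neq_0].
  - apply fcoef_ext with (fun t => kern x t * (kern x t ^ K * ln (kern x t)));
      [intros t; simpl pow; ring|].
    destruct n as [|n].
    + rewrite (bil_step_0 (dbinc K) (binc K) (dbinc (S K)) (binc (S K))),
        (bil_step_0 (binc K) (dbinc K) (binc (S K)) (dbinc (S K)));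
        auto using binc_step, dbinc_step.
      match goal with |- fcoef _ _ ?r => replace r with
        ((1 + x ^ 2) * ((- x) ^ 0 * (bil (dbinc K) (binc K) (S K) 0 (x ^ 2)
             + bil (binc K) (dbinc K) (S K) 0 (x ^ 2)))
         - 2 * x * ((- x) ^ 1 * (bil (dbinc K) (binc K) (S K) 1 (x ^ 2)
             + bil (binc K) (dbinc K) (S K) 1 (x ^ 2)))) by (simpl pow; ring) end.
      apply (fcoef_mul_0 x (fun t => kern x t ^ K * ln (kern x t))); apply IH.
    + rewrite (bil_step_S (dbinc K) (binc K) (dbinc (S K)) (binc (S K))),
        (bil_step_S (binc K) (dbinc K) (binc (S K)) (dbinc (S K)));
        auto using binc_step, dbinc_step.
      match goal with |- fcoef _ _ ?r => replace r with
        ((1 + x ^ 2) * ((- x) ^ S n * (bil (dbinc K) (binc K) (S K) (S n) (x ^ 2)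
             + bil (binc K) (dbinc K) (S K) (S n) (x ^ 2)))
         - x * ((- x) ^ n * (bil (dbinc K) (binc K) (S K) n (x ^ 2)
             + bil (binc K) (dbinc K) (S K) n (x ^ 2))
           + (- x) ^ S (S n) * (bil (dbinc K) (binc K) (S K) (S (S n)) (x ^ 2)
             + bil (binc K) (dbinc K) (S K) (S (S n)) (x ^ 2)))) by (simpl pow; ring) end.
      apply (fcoef_mul_S n x (fun t => kern x t ^ K * ln (kern x t))); apply IH.
Qed.

Lemma fcoef_kern_pow (K n : nat) (x : R) :
  fcoef n (fun t => kern x t ^ K)
    ((- x) ^ n * rsum (S K) (fun s => ff (INR K) (n + s) / rfact (n + s)
                                      * (ff (INR K) s / rfact s) * (x ^ 2) ^ s)).
Proof.
  change (fcoef n (fun t => kern x t ^ K)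
            ((- x) ^ n * bil (binc K) (binc K) (S K) n (x ^ 2))).
  assert (G : forall K k, binc K (k + S K)%nat * binc K (S K) = 0)
    by (intros; rewrite (binc_gt K0 (S K0)) by lia; ring).
  revert n; induction K as [|K IH]; intros n.
  - unfold bil. simpl rsum. rewrite Nat.add_0_r.
    replace (binc 0 0) with 1 by (unfold binc; simpl; rewrite rfact_0; field).
    assert (H := fcoef_cos n 0).
    apply fcoef_ext with (g := fun t => kern x t ^ 0) in H.
    2:{ intros t. simpl INR. rewrite Rmult_0_l, cos_0, epsilon_0. simpl; ring. }
    destruct n as [|n].
    + unfold binc. simpl. rewrite rfact_0. simpl in H.
      replace (1 * (0 + 1 / 1 * 1 * 1)) with 1 by field. exact H.
    + rewrite binc_gt by lia.
      match goal with |- fcoef _ _ ?r => replace r with 0 by ring end. exact H.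
  - apply fcoef_ext with (fun t => kern x t * kern x t ^ K); [reflexivity|].
    destruct n as [|n].
    + rewrite (bil_step_0 (binc K) (binc K) (binc (S K)) (binc (S K))); auto using binc_step.
      match goal with |- fcoef _ _ ?r => replace r with
        ((1 + x ^ 2) * ((- x) ^ 0 * bil (binc K) (binc K) (S K) 0 (x ^ 2))
         - 2 * x * ((- x) ^ 1 * bil (binc K) (binc K) (S K) 1 (x ^ 2)))
        by (simpl pow; ring) end.
      apply (fcoef_mul_0 x (fun t => kern x t ^ K)); apply IH.
    + rewrite (bil_step_S (binc K) (binc K) (binc (S K)) (binc (S K))); auto using binc_step.
      match goal with |- fcoef _ _ ?r => replace r with
        ((1 + x ^ 2) * ((- x) ^ S n * bil (binc K) (binc K) (S K) (S n) (x ^ 2))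
         - x * ((- x) ^ n * bil (binc K) (binc K) (S K) n (x ^ 2)
           + (- x) ^ S (S n) * bil (binc K) (binc K) (S K) (S (S n)) (x ^ 2)))
        by (simpl pow; ring) end.
      apply (fcoef_mul_S n x (fun t => kern x t ^ K)); apply IH.
Qed.

(** * Legendre functions of the second kind of half-integer degree and order *)

Fixpoint gamma_prim (n : nat) (t : R) : R :=
  match n with
  | O => - exp (- t)
  | S m => - t ^ S m * exp (- t) + INR (S m) * gamma_prim m t
  end.

Lemma is_derive_gamma_prim (n : nat) (t : R) :
  is_derive (gamma_prim n) t (t ^ n * exp (- t)).
Proof.
  induction n as [|n IH].
  - unfold gamma_prim. auto_derive; auto. simpl. ring.
  - change (gamma_prim (S n))
      with (fun t => - t ^ S n * exp (- t) + INR (S n) * gamma_prim n t).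
    evar_last.
    + apply (@is_derive_plus R_AbsRing R_NormedModule).
      * instantiate (1 := - (INR (S n) * t ^ n) * exp (- t) + t ^ S n * exp (- t)).
        auto_derive; auto. change (match n with O => 1 | S _ => INR n + 1 end) with (INR (S n)).
        simpl pow. ring.
      * apply is_derive_scal. exact IH.
    + match goal with |- plus ?a ?b = _ => change (a + b = t ^ S n * exp (- t)) end.
      cbv beta. ring.
Qed.

Lemma gamma_prim_0 (n : nat) : gamma_prim n 0 = - rfact n.
Proof.
  induction n as [|n IH].
  - simpl. rewrite Ropp_0, exp_0, rfact_0. auto.
  - change (gamma_prim (S n) 0) with (- 0 ^ S n * exp (- 0) + INR (S n) * gamma_prim n 0).
    rewrite IH, rfact_S, S_INR. simpl. ring.
Qed.

Lemma pow_exp_bound (n : nat) (t : R) : 0 < t ->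
  0 <= t ^ n * exp (- t) <= rfact (S n) * / t.
Proof.
  intros Ht. assert (H := exp_ge_taylor t (S n) ltac:(lra)).
  rewrite <- sum_n_Reals, rsum_sum_n in H.
  assert (H1 := rsum_term_le (S (S n)) (S n) (fun k => t ^ k / INR (fact k)) ltac:(lia)).
  assert (H2 : forall k, 0 <= t ^ k / INR (fact k)).
  { intros k. apply Rmult_le_pos; [apply pow_le; lra|].
    left; apply Rinv_0_lt_compat, INR_fact_lt_0. }
  specialize (H1 H2). cbv beta in H1. fold (rfact (S n)) in H1.
  assert (Hp : 0 < t ^ n) by (apply pow_lt; auto).
  pose proof (exp_pos t). rewrite exp_Ropp. pose proof (rfact_pos (S n)).
  split; [apply Rmult_le_pos; [lra|left; apply Rinv_0_lt_compat; lra]|].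
  apply (Rmult_le_reg_r (t * exp t)); [nra|].
  replace (t ^ n * / exp t * (t * exp t)) with (rfact (S n) * (t ^ S n / rfact (S n))).
  - replace (rfact (S n) * / t * (t * exp t)) with (rfact (S n) * exp t) by (field; lra).
    apply Rmult_le_compat_l; lra.
  - simpl pow. field. lra.
Qed.

Lemma gamma_prim_infty (n : nat) : is_lim (gamma_prim n) p_infty 0.
Proof.
  assert (E : forall n, is_lim (fun t => t ^ n * exp (- t)) p_infty 0).
  { clear n. intros n.
    apply (is_lim_le_le_loc (fun _ => 0) (fun t => rfact (S n) * / t)).
    - exists 0. intros t Ht. apply pow_exp_bound; auto.
    - apply is_lim_const.
    - replace (Finite 0) with (Rbar_mult (rfact (S n)) (Rbar_inv p_infty))
        by (simpl; f_equal; ring).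
      apply is_lim_scal_l. apply is_lim_inv; [apply is_lim_id|discriminate]. }
  induction n as [|n IH].
  - apply is_lim_ext with (fun t => -1 * (t ^ 0 * exp (- t))); [intros; simpl; ring|].
    replace (Finite 0) with (Rbar_mult (-1) 0) by (simpl; f_equal; ring).
    apply is_lim_scal_l. apply E.
  - apply is_lim_ext with (fun t => -1 * (t ^ S n * exp (- t)) + INR (S n) * gamma_prim n t).
    { intros t. change (gamma_prim (S n) t)
        with (- t ^ S n * exp (- t) + INR (S n) * gamma_prim n t). ring. }
    replace (Finite 0) with (Finite (-1 * 0 + INR (S n) * 0)) by (f_equal; ring).
    apply is_lim_plus'.
    + apply (is_lim_scal_l _ (-1) _ 0), E.
    + apply (is_lim_scal_l _ (INR (S n)) _ 0), IH.
Qed.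

(** Integer arguments suffice: for degree [n - 1/2] and order [k + 1/2] the two Gamma factors of
    [LegendreQ] have arguments [n + k + 1] and [n + 1]. The explicit primitive [gamma_prim] comes
    from repeated integration by parts. *)
Lemma Gamma_INR (n : nat) : Gamma (INR n + 1) = rfact n.
Proof.
  unfold Gamma. apply (is_RInt_gen_unique (V := R_CompleteNormedModule)).
  assert (ED : Derive (gamma_prim n) = fun t => t ^ n * exp (- t)).
  { apply functional_extensionality; intros t.
    apply is_derive_unique, is_derive_gamma_prim. }
  assert (Hc : forall t, continuous (Derive (gamma_prim n)) t).
  { intros t. rewrite ED. apply (@ex_derive_continuous R_AbsRing R_NormedModule).
    auto_derive; auto. }
  (* [Rpower t] is identified with the integer power for positive [t]; both filters provide positive
     endpoints, so the integrands agree in between. *)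
  assert (Hpos : filter_prod (at_right 0) (Rbar_locally p_infty)
    (fun ab : R * R => 0 < fst ab /\ 0 < snd ab)).
  { exists (fun u => 0 < u) (fun u => 0 < u); auto.
    - unfold at_right, within. exists (mkposreal 1 Rlt_0_1). auto.
    - exists 0. auto. }
  apply (is_RInt_gen_ext (Derive (gamma_prim n))).
  - revert Hpos. apply filter_imp. intros [a b] [Ha Hb] t Ht. simpl in *.
    assert (0 < t) by (apply Rlt_trans with (Rmin a b); [apply Rmin_glb_lt; auto|apply Ht]).
    replace (INR n + 1 - 1) with (INR n) by ring. rewrite Rpower_pow, ED; auto.
  - replace (rfact n) with (0 - - rfact n) by ring.
    apply is_RInt_gen_Derive.
    + apply filter_forall. intros ab t _. eexists; apply is_derive_gamma_prim.
    + apply filter_forall. intros ab t _. apply Hc.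
    + rewrite <- gamma_prim_0. unfold at_right.
      apply filterlim_within_ext with (gamma_prim n); auto.
      apply (filterlim_filter_le_1 (F := locally 0)).
      * apply filter_le_within.
      * apply (ex_derive_continuous (gamma_prim n)).
        eexists; apply is_derive_gamma_prim.
    + apply gamma_prim_infty.
Qed.

(** With [x = exp (- eta)]: [zx x = cosh eta], [shx x = sinh eta] and [1 + 2 * wx x = coth eta], the
    argument on the other side of Whipple's transformation. *)
Definition zx (x : R) : R := (1 + x ^ 2) / (2 * x).
Definition shx (x : R) : R := (1 - x ^ 2) / (2 * x).
Definition wx (x : R) : R := x ^ 2 / (1 - x ^ 2).

Definition hypcoef (n k s : nat) : R :=
  pochhammer ((INR (n + k) + 1) / 2) s * pochhammer ((INR (n + k) + 2) / 2) s
  / (pochhammer (INR n + 1) s * INR (fact s)).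

Lemma pochhammer_pos (a : R) (s : nat) : 0 < a -> 0 < pochhammer a s.
Proof.
  intros Ha. induction s as [|s IH]; simpl; [lra|].
  apply Rmult_lt_0_compat; auto. pose proof (pos_INR s); lra.
Qed.

Lemma hypcoef_pos (n k s : nat) : 0 < hypcoef n k s.
Proof.
  unfold hypcoef. pose proof (pos_INR (n + k)). pose proof (pos_INR n).
  apply Rdiv_lt_0_compat; apply Rmult_lt_0_compat; try apply INR_fact_lt_0;
    apply pochhammer_pos; lra.
Qed.

Lemma hypcoef_S (n k s : nat) :
  hypcoef n k (S s) = hypcoef n k s *
    (((INR (n + k) + 1) / 2 + INR s) * ((INR (n + k) + 2) / 2 + INR s)
     / ((INR n + 1 + INR s) * (INR s + 1))).
Proof.
  unfold hypcoef. rewrite fact_simpl, mult_INR, S_INR. simpl pochhammer.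
  pose proof (pos_INR n). pose proof (pos_INR s).
  assert (0 < pochhammer (INR n + 1) s) by (apply pochhammer_pos; lra).
  field. repeat split; try lra. apply INR_fact_neq_0.
Qed.

Lemma is_lim_seq_ratio (a b : R) : 0 < b ->
  is_lim_seq (fun s => (a + INR s) / (b + INR s)) 1.
Proof.
  intros Hb. apply is_lim_seq_ext with (fun s => 1 + (a - b) * / (b + INR s)).
  - intros s. pose proof (pos_INR s). field. lra.
  - replace (Finite 1) with (Finite (1 + (a - b) * 0)) by (f_equal; ring).
    apply is_lim_seq_plus'; [apply is_lim_seq_const|].
    apply (is_lim_seq_scal_l _ (a - b) 0).
    replace (Finite 0) with (Rbar_inv p_infty) by reflexivity.
    apply is_lim_seq_inv; [|discriminate].
    apply is_lim_seq_ext with (fun s => INR s + b); [intros; ring|].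
    eapply is_lim_seq_plus; [apply is_lim_seq_INR|apply is_lim_seq_const|].
    reflexivity.
Qed.

Lemma CV_radius_hypcoef (n k : nat) : CV_radius (hypcoef n k) = 1.
Proof.
  rewrite <- Rinv_1. apply CV_radius_finite_DAlembert.
  - intros s. apply Rgt_not_eq, hypcoef_pos.
  - lra.
  - apply is_lim_seq_ext with (fun s =>
      (((INR (n + k) + 1) / 2 + INR s) / (INR n + 1 + INR s)) *
      (((INR (n + k) + 2) / 2 + INR s) / (1 + INR s))).
    + intros s. rewrite hypcoef_S. pose proof (hypcoef_pos n k s).
      pose proof (pos_INR n). pose proof (pos_INR s). pose proof (pos_INR (n + k)).
      assert (E : forall h X, h <> 0 -> h * X / h = X) by (intros; field; auto).
      rewrite E by lra. rewrite Rabs_right.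
      * field. lra.
      * left. apply Rdiv_lt_0_compat; apply Rmult_lt_0_compat; lra.
    + replace (Finite 1) with (Finite (1 * 1)) by (f_equal; ring).
      pose proof (pos_INR n).
      apply is_lim_seq_mult'; apply is_lim_seq_ratio; lra.
Qed.

Lemma hyp2F1_hypcoef (n k : nat) (t : R) :
  hyp2F1 ((INR (n + k) + 1) / 2) ((INR (n + k) + 2) / 2) (INR n + 1) t
  = PSeries (hypcoef n k) t.
Proof. reflexivity. Qed.

(** With [a = (n + k + 1)/2] the numerator is [(a)_s (a + 1/2)_s]. Raising [k] replaces [(a)_s] by
    [(a + 1)_s = (a)_s (a + s)/a], and the factor [s] is the operator [t d/dt]. *)
Lemma hypcoef_step (n k : nat) (t : R) : Rabs t < 1 ->
  (INR (n + k) + 1) * PSeries (hypcoef n (S k)) t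
  = (INR (n + k) + 1) * PSeries (hypcoef n k) t
    + 2 * t * PSeries (PS_derive (hypcoef n k)) t.
Proof.
  intros Ht. assert (Hr : Rbar_lt (Rabs t) (CV_radius (hypcoef n k)))
    by (rewrite CV_radius_hypcoef; exact Ht).
  assert (Hd : Rbar_lt (Rabs t) (CV_radius (PS_derive (hypcoef n k))))
    by (rewrite CV_radius_derive; exact Hr).
  rewrite (Rmult_assoc 2 t), <- PSeries_incr_1.
  rewrite <- 3!PSeries_scal, <- PSeries_plus.
  - apply PSeries_ext. intros s.
    change ((INR (n + k) + 1) * hypcoef n (S k) s
      = (INR (n + k) + 1) * hypcoef n k s
        + 2 * PS_incr_1 (V := R_NormedModule) (PS_derive (hypcoef n k)) s).
    assert (E : (INR (n + k) + 1) * hypcoef n (S k) s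
                = (INR (n + k) + 1 + 2 * INR s) * hypcoef n k s).
    { unfold hypcoef. rewrite Nat.add_succ_r, S_INR.
      pose proof (pos_INR (n + k)). pose proof (pos_INR n).
      replace ((INR (n + k) + 1 + 1) / 2) with ((INR (n + k) + 2) / 2) by field.
      replace ((INR (n + k) + 1 + 2) / 2) with ((INR (n + k) + 1) / 2 + 1) by field.
      set (a := (INR (n + k) + 1) / 2). replace (INR (n + k) + 1) with (2 * a) by (unfold a; field).
      assert (P : a * pochhammer (a + 1) s = pochhammer a s * (a + INR s)).
      { rewrite (pochhammer_rf (a + 1) s), (pochhammer_rf a s), <- (rf_first a s). reflexivity. }
      assert (0 < pochhammer (INR n + 1) s) by (apply pochhammer_pos; lra).
      pose proof (INR_fact_lt_0 s).
      transitivity (2 * (a * pochhammer (a + 1) s) * pochhammer ((INR (n + k) + 2) / 2) s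
                    / (pochhammer (INR n + 1) s * INR (fact s))); [field; lra|].
      rewrite P. field. lra. }
    rewrite E. destruct s as [|s].
    + unfold PS_incr_1, zero; simpl. ring.
    + unfold PS_incr_1, PS_derive. ring.
  - apply ex_pseries_scal; [apply Rmult_comm|]. apply CV_radius_inside; auto.
  - apply ex_pseries_scal; [apply Rmult_comm|]. apply ex_pseries_incr_1.
    apply CV_radius_inside; auto.
Qed.

Definition dlegp (n k : nat) (w : R) : R :=
  rsum (S k) (fun j => fquot k j / (rfact j * rfact (n + j)) * (INR j * w ^ (j - 1))).

Lemma is_derive_rsum (N : nat) (f df : nat -> R -> R) (x : R) :
  (forall i, is_derive (f i) x (df i x)) ->
  is_derive (fun t => rsum N (fun i => f i t)) x (rsum N (fun i => df i x)).
Proof.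
  intros H. induction N as [|N IH].
  - exact (@is_derive_const R_AbsRing R_NormedModule 0 x).
  - apply (@is_derive_plus R_AbsRing R_NormedModule); auto.
Qed.

Lemma is_derive_legp (n k : nat) (w : R) : is_derive (legp n k) w (dlegp n k w).
Proof.
  apply (is_derive_rsum (S k) (fun j w => fquot k j / (rfact j * rfact (n + j)) * w ^ j)
    (fun j w => fquot k j / (rfact j * rfact (n + j)) * (INR j * w ^ (j - 1)))).
  intros j. apply is_derive_scal. evar_last.
  - apply is_derive_pow. apply is_derive_id.
  - unfold one; simpl. rewrite Rmult_1_r. f_equal. f_equal. lia.
Qed.

(** The differential relation that raises the degree, compared coefficient by coefficient in [w]. It
    is the counterpart of [hypcoef_step] in the induction of [hyp_closed]. *)
Lemma legp_step (n k : nat) (w : R) :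
  INR (n + k + 1) * legp n (S k) w
  = (INR (n + k + 1) + 2 * (INR k + 1) * w) * legp n k w
    + 2 * w * (1 + w) * dlegp n k w.
Proof.
  set (a := fun j => fquot k j / (rfact j * rfact (n + j))).
  assert (Ea : a (S k) = 0) by (unfold a; rewrite fquot_gt by lia; unfold Rdiv; ring).
  assert (E1 : w * dlegp n k w = rsum (S k) (fun j => INR j * (a j * w ^ j))).
  { unfold dlegp. rewrite <- rsum_scal. apply rsum_ext. intros [|j] Hj.
    - simpl. ring.
    - replace (S j - 1)%nat with j by lia. unfold a. simpl pow. ring. }
  transitivity ((INR (n + k + 1) + 2 * (INR k + 1) * w) * legp n k w
                + 2 * (1 + w) * (w * dlegp n k w)); [|ring].
  rewrite E1. unfold legp. fold a.
  transitivity (rsum (S (S k)) (fun j => (INR (n + k + 1) + 2 * INR j) * (a j * w ^ j))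
                + w * rsum (S k) (fun j => 2 * (INR k + 1 + INR j) * (a j * w ^ j))).
  2:{ rewrite (rsum_S (S k)), Ea.
      rewrite (rsum_ext (S k) (fun j => (INR (n + k + 1) + 2 * INR j) * (a j * w ^ j))
        (fun j => INR (n + k + 1) * (a j * w ^ j) + 2 * (INR j * (a j * w ^ j))))
        by (intros; ring).
      rewrite (rsum_ext (S k) (fun j => 2 * (INR k + 1 + INR j) * (a j * w ^ j))
        (fun j => 2 * (INR k + 1) * (a j * w ^ j) + 2 * (INR j * (a j * w ^ j))))
        by (intros; ring).
      rewrite 2!rsum_plus, !rsum_scal.
      change (rsum (S k) (fun j => fquot k j / (rfact j * rfact (n + j)) * w ^ j))
        with (rsum (S k) (fun j => a j * w ^ j)). ring. }
  rewrite rsum_first, (rsum_first (S k) (fun j => (INR (n + k + 1) + 2 * INR j) * _)).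
  rewrite Rmult_plus_distr_l, <- !rsum_scal, Rplus_assoc, <- rsum_plus. f_equal.
  - unfold a. rewrite 2!fquot_le by lia. simpl INR. rewrite Nat.sub_0_r.
    rewrite 2!Nat.add_0_r, Nat.sub_0_r. rewrite Nat.add_0_r. simpl pow. field. rfact_nz.
  - apply rsum_ext; intros i Hi. unfold a.
    assert (F1 : fquot (S k) (S i)
                 = (INR k + INR i + 2) * (INR k + INR i + 1) * fquot k i).
    { rewrite fquot_S_r, S_INR.
      transitivity ((INR k + INR i + 2) * ((INR k + 1 - INR i) * fquot (S k) i)); [ring|].
      rewrite fquot_S_l. ring. }
    rewrite F1, fquot_S_r, (Nat.add_succ_r n i), 2!rfact_S, !plus_INR, !S_INR. simpl pow.
    change (INR 0) with 0.
    pose proof (pos_INR n). pose proof (pos_INR i).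
    field. repeat split; try apply rfact_neq_0; lra.
Qed.

Lemma rser_spread (F : nat -> R) (n : nat) (l : R) :
  (forall s, (forall j, s <> (n + 2 * j)%nat) -> F s = 0) ->
  rser F l -> rser (fun j => F (n + 2 * j)%nat) l.
Proof.
  intros H0 H.
  assert (E : forall J, rsum (n + 2 * J) F = rsum J (fun j => F (n + 2 * j)%nat)).
  { induction J as [|J IH].
    - simpl. rewrite Nat.add_0_r. apply rsum_0. intros i Hi. apply H0. lia.
    - replace (n + 2 * S J)%nat with (S (S (n + 2 * J))) by lia.
      rewrite 3!rsum_S, IH, (H0 (S _)); [ring|]. intros j. lia. }
  apply is_lim_seq_ext with (fun J => rsum (n + 2 * J) F); [exact E|].
  apply (is_lim_seq_subseq (fun N => rsum N F) l (fun J => (n + 2 * J)%nat)).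
  - apply eventually_subseq. intros; lia.
  - exact H.
Qed.

Lemma zx_gt_1 (x : R) : 0 < x < 1 -> 1 < zx x.
Proof.
  intros Hx. unfold zx. apply (Rmult_lt_reg_r (2 * x)); [lra|].
  unfold Rdiv. rewrite Rmult_assoc, Rinv_l, Rmult_1_r by lra. nra.
Qed.

Lemma shx_pos (x : R) : 0 < x < 1 -> 0 < shx x.
Proof. intros Hx. unfold shx. apply Rdiv_lt_0_compat; nra. Qed.

Lemma zx_shx (x : R) : 0 < x < 1 -> zx x ^ 2 - 1 = shx x ^ 2.
Proof. intros Hx. unfold zx, shx. field. lra. Qed.

Lemma kern_zx (x t : R) : 0 < x -> kern x t = 2 * x * (zx x - cos t).
Proof. intros Hx. unfold kern, zx. field. lra. Qed.

Lemma rf_double (a : R) (j : nat) :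
  rf a (2 * j) = 4 ^ j * (rf (a / 2) j * rf ((a + 1) / 2) j).
Proof.
  induction j as [|j IH]; [simpl; ring|].
  replace (2 * S j)%nat with (S (S (2 * j))) by lia.
  rewrite (rf_S a (S _)), (rf_S a (2 * j)), IH, 2!(rf_S _ j), S_INR, mult_INR.
  simpl (INR 2). simpl pow. field.
Qed.

(** The [n]-th Fourier coefficient of [1 / (z - cos t)] computed twice: from the geometric series in
    [cos t / z], which becomes hypergeometric by the duplication formula [rf_double], and from the
    Poisson kernel, which gives [x^n / shx x]. *)
Lemma hyp_base (n : nat) (x : R) : 0 < x < 1 ->
  PSeries (hypcoef n 0) (1 / zx x ^ 2) / zx x ^ (n + 1) = 2 ^ n * x ^ n / shx x.
Proof.
  intros Hx. assert (Hz := zx_gt_1 x Hx). assert (Hs := shx_pos x Hx).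
  set (z := zx x) in *.
  destruct (fcoef_series n (fun s t => / z ^ (s + 1) * cos t ^ s)
     (fun s => / z ^ (s + 1) * (rfact s / 2 ^ s * kap 0 s n))
     (fun s => / z * (/ z) ^ s) (fun t => / (z - cos t)) (/ z * / (1 - / z)))
    as [L [HL HF]].
  - intros s. apply (fcoef_scal n (fun t => cos t ^ s)). apply fcoef_cos_pow.
  - intros s t. rewrite Rabs_mult, <- RPow_abs.
    rewrite Rabs_right by (left; apply Rinv_0_lt_compat, pow_lt; lra).
    rewrite pow_add, pow_1, Rinv_mult, pow_inv, (Rmult_comm (/ z)).
    rewrite <- (Rmult_1_r (/ z ^ s * / z)) at 2. apply Rmult_le_compat_l.
    + apply Rmult_le_pos; left; apply Rinv_0_lt_compat; [apply pow_lt|]; lra.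
    + rewrite <- (pow1 s). apply pow_incr. split; [apply Rabs_pos|apply Rabs_cos_le].
  - apply rser_scal, rser_geom. rewrite Rabs_right.
    + rewrite <- Rinv_1. apply Rinv_lt_contravar; lra.
    + left. apply Rinv_0_lt_compat; lra.
  - intros t. pose proof (COS_bound t). pose proof (Rabs_cos_le t).
    replace (/ (z - cos t)) with (/ z * / (1 - cos t / z)) by (field; lra).
    apply rser_ext with (fun s => / z * (cos t / z) ^ s).
    + intros s. unfold Rdiv. rewrite Rpow_mult_distr, pow_inv, pow_add, pow_1.
      field. split; [|apply pow_nonzero]; lra.
    + apply rser_scal, rser_geom. unfold Rdiv. rewrite Rabs_mult, Rabs_inv, (Rabs_right z) by lra.
      apply (Rmult_lt_reg_r z); [lra|]. rewrite Rmult_assoc, Rinv_l by lra. lra.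
  - assert (EL : L = x ^ n / shx x).
    { apply (fcoef_unique n _ _ _ HF). unfold Rdiv. rewrite Rmult_comm.
      apply fcoef_ext with (fun t => / shx x * ((1 - x ^ 2) / kern x t)).
      - intros t. rewrite kern_zx by lra. fold z. unfold shx. pose proof (COS_bound t).
        field. repeat split; try lra; nra.
      - apply fcoef_scal, fcoef_poisson; auto. }
    apply rser_spread with (n := n) in HL.
    2:{ intros s H. rewrite kap_0; auto; ring. }
    rewrite EL in HL.
    apply (rser_scal _ _ (z ^ (n + 1) * 2 ^ n)) in HL.
    assert (EP : PSeries (hypcoef n 0) (1 / z ^ 2) = z ^ (n + 1) * 2 ^ n * (x ^ n / shx x)).
    { apply is_series_unique, rser_is_series. eapply rser_ext; [|exact HL].
      intros j. cbv beta. rewrite kap_eq.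
      assert (EH : hypcoef n 0 j = rfact (n + 2 * j) / (4 ^ j * (rfact (n + j) * rfact j))).
      { unfold hypcoef. fold (rfact j). change pochhammer with rf. rewrite Nat.add_0_r.
        rewrite <- (rf_fact n (2 * j)), <- (rf_fact n j), rf_double.
        replace ((INR n + 1 + 1) / 2) with ((INR n + 2) / 2) by field.
        assert (rf (INR n + 1) j <> 0).
        { rewrite <- pochhammer_rf. apply Rgt_not_eq, pochhammer_pos.
          pose proof (pos_INR n); lra. }
        field. repeat split; auto; try apply rfact_neq_0. apply pow_nonzero; lra. }
      rewrite EH. replace (j + n + 0)%nat with (n + j)%nat by lia.
      unfold Rdiv. rewrite Rmult_1_l, pow_inv, !pow_add, pow_1, !pow_mult.
      replace (2 ^ 2) with 4 by ring.
      field. repeat split; try apply rfact_neq_0; try apply pow_nonzero; try lra.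
      all: apply pow_nonzero; lra. }
    rewrite EP. field. split; [lra|apply pow_nonzero; lra].
Qed.

(** Induction on [k] by differentiating the identity in [x]. By [hypcoef_step] on the left and
    [legp_step] on the right, both derivatives are the sides of the next identity times a common
    nonzero factor. *)
Lemma hyp_closed (n k : nat) (x : R) : 0 < x < 1 ->
  PSeries (hypcoef n k) (1 / zx x ^ 2) / zx x ^ (n + k + 1)
  = rfact n * 2 ^ n * x ^ n * legp n k (wx x) / shx x ^ (k + 1).
Proof.
  revert x; induction k as [|k IH]; intros x Hx.
  - rewrite Nat.add_0_r, hyp_base by auto. unfold legp. simpl rsum.
    rewrite fquot_le by lia. simpl. rewrite Nat.add_0_r, rfact_0.
    field. split; [apply rfact_neq_0|apply Rgt_not_eq, shx_pos; auto].
  - assert (Hz := zx_gt_1 x Hx). assert (Hs := shx_pos x Hx).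
    assert (D1 : is_derive (fun x => PSeries (hypcoef n k) (1 / zx x ^ 2)
                                     / zx x ^ (n + k + 1)) x
      (shx x / x * INR (n + k + 1)
       * (PSeries (hypcoef n (S k)) (1 / zx x ^ 2) / zx x ^ (n + k + 2)))).
    { assert (Ht : Rabs (1 / zx x ^ 2) < 1).
      { rewrite Rabs_right.
        - unfold Rdiv. rewrite Rmult_1_l, <- Rinv_1. apply Rinv_lt_contravar; nra.
        - apply Rle_ge, Rlt_le, Rdiv_lt_0_compat; nra. }
      assert (Dz : is_derive zx x (- (shx x / x))).
      { unfold zx, shx. auto_derive; [lra|]. field. lra. }
      assert (DH : is_derive (PSeries (hypcoef n k)) (1 / zx x ^ 2)
                     (PSeries (PS_derive (hypcoef n k)) (1 / zx x ^ 2)))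
        by (apply is_derive_PSeries; rewrite CV_radius_hypcoef; exact Ht).
      assert (HS := hypcoef_step n k _ Ht).
      set (H0 := PSeries (hypcoef n k)) in *.
      set (H1 := PSeries (PS_derive (hypcoef n k)) (1 / zx x ^ 2)) in *.
      set (H2 := PSeries (hypcoef n (S k)) (1 / zx x ^ 2)) in *.
      assert (DG : is_derive (fun z => H0 (1 / z ^ 2) / z ^ (n + k + 1)) (zx x)
        (- 2 / zx x ^ 3 * H1 / zx x ^ (n + k + 1)
         + H0 (1 / zx x ^ 2) * (- INR (n + k + 1) / zx x ^ (n + k + 2)))).
      { unfold Rdiv at 1. apply (@is_derive_mult R_AbsRing (fun z => H0 (1 / z ^ 2))
          (fun z => / z ^ (n + k + 1)) (zx x) (- 2 / zx x ^ 3 * H1)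
          (- INR (n + k + 1) / zx x ^ (n + k + 2))).
        - apply (is_derive_comp H0 (fun z => 1 / z ^ 2) (zx x) H1 (- 2 / zx x ^ 3)).
          + exact DH.
          + auto_derive; [apply Rgt_not_eq; nra|]. field. lra.
        - auto_derive; [apply pow_nonzero; lra|].
          replace (n + k + 2)%nat with (S (S (n + k))) by lia.
          replace (n + k + 1)%nat with (S (n + k)) by lia. simpl Nat.pred.
          simpl pow. field. split; [apply pow_nonzero|]; lra.
        - intros; apply Rmult_comm. }
      assert (DC := is_derive_comp _ _ _ _ _ DG Dz).
      cbv beta in DC.
      replace (shx x / x * INR (n + k + 1) * (H2 / zx x ^ (n + k + 2)))
        with (scal (- (shx x / x)) (- 2 / zx x ^ 3 * H1 / zx x ^ (n + k + 1)
         + H0 (1 / zx x ^ 2) * (- INR (n + k + 1) / zx x ^ (n + k + 2)))); [exact DC|].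
      match goal with |- scal ?a ?b = ?c => change (a * b = c) end.
      replace (INR (n + k + 1)) with (INR (n + k) + 1) by (rewrite (plus_INR _ 1); auto).
      transitivity (shx x / x * (((INR (n + k) + 1) * H2) / zx x ^ (n + k + 2))).
      - rewrite HS. replace (n + k + 2)%nat with (S (n + k + 1)) by lia.
        change (zx x ^ S (n + k + 1)) with (zx x * zx x ^ (n + k + 1)).
        field. repeat split; try lra. apply pow_nonzero; lra.
      - field. repeat split; try lra. apply pow_nonzero; lra. }
    assert (D2 : is_derive (fun x => rfact n * 2 ^ n * x ^ n * legp n k (wx x)
                                     / shx x ^ (k + 1)) x
      (rfact n * 2 ^ n * (/ x * INR (n + k + 1)) * x ^ n * legp n (S k) (wx x)
       / shx x ^ (k + 1))).
    { assert (Hx2 : 0 < 1 - x ^ 2) by nra.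
      assert (Dw : is_derive wx x (2 * wx x * (1 + wx x) / x)).
      { unfold wx. auto_derive; [apply Rgt_not_eq; nra|]. field. lra. }
      assert (DL := is_derive_comp _ _ _ _ _ (is_derive_legp n k (wx x)) Dw).
      assert (Dn : is_derive (fun x => rfact n * 2 ^ n * x ^ n) x
                     (rfact n * 2 ^ n * (INR n / x * x ^ n))).
      { apply is_derive_scal. auto_derive; auto. destruct n; simpl Nat.pred.
        - simpl. field. lra.
        - change (x ^ S n) with (x * x ^ n). field. lra. }
      assert (Ds : is_derive shx x (- (zx x / x))).
      { unfold zx, shx. auto_derive; [lra|]. field. lra. }
      assert (Dp : is_derive (fun s => / s ^ (k + 1)) (shx x)
                     (- (INR k + 1) / (shx x * shx x ^ (k + 1)))).
      { auto_derive; [apply pow_nonzero; lra|].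
        replace (k + 1)%nat with (S k) by lia. rewrite S_INR. simpl Nat.pred. simpl pow.
        field. split; [apply pow_nonzero; lra|lra]. }
      assert (DC := is_derive_comp _ _ _ _ _ Dp Ds).
      assert (D := @is_derive_mult R_AbsRing _ _ _ _ _
        (@is_derive_mult R_AbsRing _ _ _ _ _ Dn DL Rmult_comm) DC Rmult_comm).
      cbv beta in D.
      match type of D with is_derive _ _ ?v =>
        match goal with |- is_derive _ _ ?u => replace u with (v : R); [exact D|] end end.
      repeat match goal with
        | |- context [@plus ?K ?a ?b] => change (@plus K a b) with (Rplus a b)
        | |- context [@mult ?K ?a ?b] => change (@mult K a b) with (Rmult a b)
        | |- context [@scal ?K ?V ?a ?b] => change (@scal K V a b) with (Rmult a b) end.
      assert (Ez : zx x = shx x * (1 + 2 * wx x)) by (unfold zx, shx, wx; field; lra).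
      transitivity (rfact n * 2 ^ n * x ^ n / x * (INR (n + k + 1) * legp n (S k) (wx x))
                    / shx x ^ (k + 1)); [|field; split; [lra|apply pow_nonzero; lra]].
      rewrite legp_step, !plus_INR, Ez. change (INR 1) with 1.
      field. repeat split; try lra; apply pow_nonzero; lra. }
    assert (E : shx x / x * INR (n + k + 1)
         * (PSeries (hypcoef n (S k)) (1 / zx x ^ 2) / zx x ^ (n + k + 2))
        = rfact n * 2 ^ n * (/ x * INR (n + k + 1)) * x ^ n * legp n (S k) (wx x)
       / shx x ^ (k + 1)).
    { rewrite <- (is_derive_unique _ _ _ D1), <- (is_derive_unique _ _ _ D2).
      (* Equality of the derivatives needs the induction hypothesis near [x]; the radius
         [Rmin x (1 - x)] stays inside the unit interval. *)
      apply Derive_ext_loc.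
      assert (Hd : 0 < Rmin x (1 - x)) by (apply Rmin_glb_lt; lra).
      exists (mkposreal _ Hd). intros u Hu. apply IH.
      change (Rabs (u - x) < Rmin x (1 - x)) in Hu. apply Rabs_def2 in Hu.
      pose proof (Rmin_l x (1 - x)). pose proof (Rmin_r x (1 - x)). lra. }
    assert (0 < INR (n + k + 1)) by (apply lt_0_INR; lia).
    replace (n + S k + 1)%nat with (n + k + 2)%nat by lia.
    apply (Rmult_eq_reg_l (shx x / x * INR (n + k + 1))).
    + rewrite E. replace (S k + 1)%nat with (S (k + 1)) by lia. simpl pow.
      field. repeat split; try lra. apply pow_nonzero; lra.
    + apply Rmult_integral_contrapositive_currified; [|lra].
      apply Rgt_not_eq, Rdiv_lt_0_compat; lra.
Qed.

Lemma Rpower_half (a : R) : 0 < a -> Rpower a (/ 2) = sqrt a.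
Proof. apply Rpower_sqrt. Qed.

Lemma expi_half (k : nat) : expi (PI * (INR k + 1 / 2)) = (Ci * RtoC ((-1) ^ k))%C.
Proof.
  unfold expi. replace (PI * (INR k + 1 / 2)) with (PI / 2 + INR k * PI) by field.
  induction k as [|k IH].
  - simpl INR. rewrite Rmult_0_l, Rplus_0_r, cos_PI2, sin_PI2. simpl pow.
    unfold Cmult, Ci, RtoC; simpl. f_equal; ring.
  - rewrite S_INR. replace (PI / 2 + (INR k + 1) * PI) with (PI / 2 + INR k * PI + PI) by ring.
    rewrite neg_cos, neg_sin. injection IH as E1 E2. rewrite E1, E2.
    unfold Cmult, Ci, RtoC; simpl. f_equal; ring.
Qed.

(* Whipple's transformation, for half-integer degree and order. *)
Lemma LegendreQ_closed (n k : nat) (x : R) : 0 < x < 1 ->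
  LegendreQ (INR n - 1 / 2) (INR k + 1 / 2) (zx x)
  = (Ci * RtoC (sqrt (PI / 2) / sqrt (shx x)
       * ((-1) ^ k * rfact (n + k) * x ^ n * legp n k (wx x))))%C.
Proof.
  intros Hx. assert (Hz := zx_gt_1 x Hx). assert (Hs := shx_pos x Hx).
  unfold LegendreQ. rewrite expi_half, <- Cmult_assoc, <- RtoC_mult. do 2 f_equal.
  replace (INR n - 1 / 2 + (INR k + 1 / 2) + 1) with (INR (n + k) + 1)
    by (rewrite plus_INR; field).
  replace (INR n - 1 / 2 + (INR k + 1 / 2) + 2) with (INR (n + k) + 2)
    by (rewrite plus_INR; field).
  replace (INR n - 1 / 2 + 3 / 2) with (INR n + 1) by field.
  rewrite 2!Gamma_INR, hyp2F1_hypcoef, zx_shx by auto.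
  replace (INR (n + k) + 1) with (INR (n + k + 1)) by (rewrite (plus_INR _ 1); auto).
  rewrite Rpower_pow by lra.
  replace (INR n - 1 / 2 + 1) with (INR n + / 2) by field.
  rewrite (Rpower_plus (INR n)), Rpower_pow, Rpower_half by lra.
  replace (shx x ^ 2) with (Rpower (shx x) (INR 2)) by (apply Rpower_pow; auto).
  rewrite Rpower_mult. replace (INR 2 * ((INR k + 1 / 2) / 2)) with (INR k + / 2)
    by (simpl; field).
  rewrite Rpower_plus, Rpower_pow, Rpower_half by auto.
  assert (HC := hyp_closed n k x Hx).
  assert (Hp : 0 < zx x ^ (n + k + 1)) by (apply pow_lt; lra).
  assert (Hsp : 0 < shx x ^ k) by (apply pow_lt; lra).
  assert (H2 : 0 < 2 ^ n) by (apply pow_lt; lra).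
  assert (Hss : sqrt (shx x) * sqrt (shx x) = shx x) by (apply sqrt_sqrt; lra).
  assert (0 < sqrt (shx x)) by (apply sqrt_lt_R0; auto).
  assert (0 < sqrt 2) by (apply sqrt_lt_R0; lra).
  rewrite sqrt_div by (pose proof PI_RGT_0; lra).
  transitivity ((-1) ^ k * (sqrt PI * rfact (n + k) * (shx x ^ k * sqrt (shx x))
     / (2 ^ n * sqrt 2 * rfact n)
     * (PSeries (hypcoef n k) (1 / zx x ^ 2) / zx x ^ (n + k + 1)))).
  - field. repeat split; try lra; apply rfact_neq_0.
  - rewrite HC. rewrite pow_add, pow_1.
    set (sk := shx x ^ k) in *. set (r := sqrt (shx x)) in *. rewrite <- Hss.
    field. repeat split; try lra; try apply rfact_neq_0.
Qed.

(** * Power series of (z - u)^p (log (z - u) + c) *)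

Definition mulzu (z : R) (a : nat -> R) (s : nat) : R :=
  z * a s - match s with O => 0 | S t => a t end.

Fixpoint polc (z : R) (K : nat) : nat -> R :=
  match K with
  | O => fun s => match s with O => 1 | S _ => 0 end
  | S K' => mulzu z (polc z K')
  end.

(** Taylor coefficients in [u] of [(z - u)^K log (z - u)]; the case [K = 0] is the series of
    [log z + log (1 - u/z)]. *)
Fixpoint logc (z : R) (K : nat) : nat -> R :=
  match K with
  | O => fun s => match s with O => ln z | S _ => - / (INR s * z ^ s) end
  | S K' => mulzu z (logc z K')
  end.

Definition lpc (z c : R) (K s : nat) : R := logc z K s + c * polc z K s.

Definition pd (a : nat -> R) (s : nat) : R := (INR s + 1) * a (S s).

Lemma pd_mulzu (z : R) (a : nat -> R) (s : nat) :
  pd (mulzu z a) s = mulzu z (pd a) s - a s.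
Proof.
  unfold pd, mulzu. destruct s as [|s]; [simpl; ring|]. rewrite S_INR. ring.
Qed.

Lemma mulzu_lin (z c e : R) (a b : nat -> R) (s : nat) :
  mulzu z (fun s => c * a s + e * b s) s = c * mulzu z a s + e * mulzu z b s.
Proof. unfold mulzu. destruct s; ring. Qed.

Lemma mulzu_ext (z : R) (a b : nat -> R) (s : nat) :
  (forall s, a s = b s) -> mulzu z a s = mulzu z b s.
Proof. intros H. unfold mulzu. destruct s; rewrite ?H; ring. Qed.

Lemma pd_polc (z : R) (K s : nat) : pd (polc z (S K)) s = - (INR K + 1) * polc z K s.
Proof.
  revert s; induction K as [|K IH]; intros s; change (polc z (S ?k)) with (mulzu z (polc z k));
    rewrite pd_mulzu.
  - rewrite (mulzu_ext _ _ (fun _ => 0 * 0 + 0 * 0)) by (intros; unfold pd; simpl; ring).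
    rewrite (mulzu_lin z 0 0 (fun _ => 0) (fun _ => 0)). simpl INR. ring.
  - rewrite (mulzu_ext _ _ (fun s => - (INR K + 1) * polc z K s + 0 * polc z K s))
      by (intros t; rewrite IH; ring).
    rewrite mulzu_lin, S_INR. change (polc z (S K)) with (mulzu z (polc z K)). ring.
Qed.

Lemma pd_logc (z : R) (K s : nat) : 0 < z ->
  pd (logc z (S K)) s = - (INR K + 1) * logc z K s - polc z K s.
Proof.
  intros Hz. revert s; induction K as [|K IH]; intros s;
    change (logc z (S ?k)) with (mulzu z (logc z k)); rewrite pd_mulzu.
  - assert (E : mulzu z (pd (logc z 0)) s = - polc z 0 s).
    { unfold mulzu, pd, logc, polc. destruct s as [|s].
      - simpl. field. lra.
      - rewrite (S_INR (S s)), (S_INR s). change (z ^ S (S s)) with (z * (z * z ^ s)).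
        change (z ^ S s) with (z * z ^ s). pose proof (pos_INR s).
        field. repeat split; try lra. apply pow_nonzero; lra. }
    rewrite E. simpl INR. ring.
  - rewrite (mulzu_ext _ _ (fun s => - (INR K + 1) * logc z K s + -1 * polc z K s))
      by (intros t; rewrite IH; ring).
    rewrite mulzu_lin, S_INR. change (polc z (S K)) with (mulzu z (polc z K)).
    change (logc z (S K)) with (mulzu z (logc z K)). ring.
Qed.

(** Differentiating [(z - u)^(p + lam) (log (z - u) + c)] [lam] times yields [(-1)^lam (p + lam)!/p!
    (z - u)^p (log (z - u) + c + H_(p+lam) - H_p)]. The constant on the left is chosen so that [ell]
    results. *)
Lemma lpc_shift (z ell : R) (p lam s : nat) : 0 < z ->
  rfact (s + lam) * lpc z (ell - harmonic (p + lam) + harmonic p) (p + lam) (s + lam)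
  = (-1) ^ lam * (rfact (p + lam) / rfact p) * (rfact s * lpc z ell p s).
Proof.
  intros Hz. induction lam as [|lam IH].
  - rewrite !Nat.add_0_r. replace (ell - harmonic p + harmonic p) with ell by ring.
    simpl. field. apply rfact_neq_0.
  - rewrite !Nat.add_succ_r, harmonic_S, 2!rfact_S.
    set (K := (p + lam)%nat) in *. set (t := (s + lam)%nat) in *.
    set (c := ell - harmonic K + harmonic p) in *.
    replace (ell - (harmonic K + / (INR K + 1)) + harmonic p) with (c - / (INR K + 1))
      by (unfold c; ring).
    assert (E : (INR t + 1) * lpc z (c - / (INR K + 1)) (S K) (S t)
                = - (INR K + 1) * lpc z c K t).
    { unfold lpc. assert (H1 := pd_polc z K t). assert (H2 := pd_logc z K t Hz).
      unfold pd in H1, H2.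
      transitivity ((INR t + 1) * logc z (S K) (S t)
        + (c - / (INR K + 1)) * ((INR t + 1) * polc z (S K) (S t))); [ring|].
      rewrite H1, H2. field. apply INR_S_neq_0. }
    transitivity (rfact t * ((INR t + 1) * lpc z (c - / (INR K + 1)) (S K) (S t))); [ring|].
    rewrite E. transitivity (- (INR K + 1) * (rfact t * lpc z c K t)); [ring|].
    rewrite IH. simpl pow. field. apply rfact_neq_0.
Qed.

(** The second clause bounds the absolute series on each smaller radius. It provides the uniform
    convergence for Fourier coefficients and, at a radius above [1], the majorants of the box
    sums. *)
Definition psum (z : R) (a : nat -> R) (f : R -> R) : Prop :=
  (forall u, Rabs u < z -> rser (fun s => a s * u ^ s) (f u)) /\
  (forall r, 0 <= r < z -> exists B, forall N, rsum N (fun s => Rabs (a s) * r ^ s) <= B).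

Lemma psum_lin (z c e : R) (a b : nat -> R) (f g : R -> R) :
  psum z a f -> psum z b g ->
  psum z (fun s => c * a s + e * b s) (fun u => c * f u + e * g u).
Proof.
  intros [H1 H2] [G1 G2]. split.
  - intros u Hu. eapply rser_ext.
    2: apply rser_plus; apply rser_scal; [apply H1|apply G1]; auto.
    intros s; cbv beta; ring.
  - intros r Hr. destruct (H2 r Hr) as [A HA], (G2 r Hr) as [B HB].
    exists (Rabs c * A + Rabs e * B). intros N.
    apply Rle_trans with (Rabs c * rsum N (fun s => Rabs (a s) * r ^ s)
                          + Rabs e * rsum N (fun s => Rabs (b s) * r ^ s)).
    + rewrite <- 2!rsum_scal, <- rsum_plus. apply rsum_le; intros s _.
      rewrite <- 2!Rmult_assoc, <- Rmult_plus_distr_r, <- 2!Rabs_mult.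
      apply Rmult_le_compat_r; [apply pow_le; lra|apply Rabs_triang].
    + apply Rplus_le_compat; apply Rmult_le_compat_l; auto using Rabs_pos.
Qed.

Lemma psum_ext (z : R) (a b : nat -> R) (f g : R -> R) :
  (forall s, a s = b s) -> (forall u, f u = g u) -> psum z a f -> psum z b g.
Proof.
  intros Ha Hf. replace b with a by (apply functional_extensionality; auto).
  replace g with f by (apply functional_extensionality; auto). auto.
Qed.

Lemma psum_incr (z : R) (a : nat -> R) (f : R -> R) :
  psum z a f -> psum z (fun s => match s with O => 0 | S t => a t end) (fun u => u * f u).
Proof.
  intros [H1 H2]. split.
  - intros u Hu.
    assert (E := rser_first (fun s => match s with O => 0 | S t => a t end * u ^ s) (u * f u)).
    simpl in E. rewrite Rmult_0_l, Rplus_0_l in E. apply E.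
    eapply rser_ext; [|apply rser_scal, H1, Hu]. intros s; cbv beta; ring.
  - intros r Hr. destruct (H2 r Hr) as [B HB]. exists (r * B). intros [|N].
    + simpl. specialize (HB O). simpl in HB. apply Rmult_le_pos; lra.
    + rewrite rsum_first, Rabs_R0, Rmult_0_l, Rplus_0_l.
      rewrite (rsum_ext _ _ (fun s => r * (Rabs (a s) * r ^ s))) by (intros; simpl pow; ring).
      rewrite rsum_scal. apply Rmult_le_compat_l; [lra|auto].
Qed.

Lemma psum_mulzu (z : R) (a : nat -> R) (f : R -> R) :
  psum z a f -> psum z (mulzu z a) (fun u => (z - u) * f u).
Proof.
  intros H. eapply psum_ext; [| |apply (psum_lin z z (-1)); [exact H|apply psum_incr, H]].
  - intros s. unfold mulzu. ring.
  - intros u. cbv beta. ring.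
Qed.

Lemma psum_polc (z : R) (K : nat) : psum z (polc z K) (fun u => (z - u) ^ K).
Proof.
  induction K as [|K IH].
  - split.
    + intros u Hu.
      assert (E := rser_first (fun s => polc z 0 s * u ^ s) 0).
      simpl in E. replace (1 * 1 + 0) with 1 in E by ring. apply E.
      apply rser_ext with (fun _ => 0); [intros; ring|].
      apply is_lim_seq_ext with (fun _ => 0); [|apply is_lim_seq_const].
      intros; symmetry; apply rsum_0; auto.
    + intros r Hr. exists 1. intros [|N]; [simpl; lra|].
      rewrite rsum_first, (rsum_0 N); [simpl; rewrite Rabs_R1; lra|].
      intros; simpl; rewrite Rabs_R0; ring.
  - apply (psum_mulzu z (polc z K)) in IH. exact IH.
Qed.

Lemma cos_INR_PI (i : nat) : cos (INR i * PI) = (-1) ^ i.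
Proof.
  induction i as [|i IH]; [simpl; rewrite Rmult_0_l; apply cos_0|].
  rewrite S_INR, Rmult_plus_distr_r, Rmult_1_l, neg_cos, IH. simpl; ring.
Qed.

(** The logarithmic kernel at the extreme angles is a square: [kern u 0] and [kern (- u) PI] both
    equal [(1 - u)^2]. The sign of [u] decides which one has its first argument in the range of
    [rser_log_kern]. *)
Lemma rser_ln (u : R) : Rabs u < 1 ->
  rser (fun s => match s with O => 0 | S _ => - / INR s end * u ^ s) (ln (1 - u)).
Proof.
  intros Hu. assert (Hu' := Hu). apply Rabs_def2 in Hu'.
  destruct (Rtotal_order u 0) as [H|[H|H]].
  - replace (ln (1 - u)) with (/ 2 * ln (kern (- u) PI)).
    + eapply rser_ext; [|apply rser_scal, rser_log_kern; lra].
      intros [|s]; cbv beta; [unfold logcoef; ring|]. unfold logcoef. rewrite cos_INR_PI.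
      replace (- u) with (-1 * u) by ring. rewrite Rpow_mult_distr.
      transitivity (- / INR (S s) * u ^ S s * ((-1) ^ S s * (-1) ^ S s)).
      * unfold Rdiv. field. apply not_0_INR; lia.
      * rewrite pow_m1_sq. ring.
    + unfold kern. rewrite cos_PI.
      replace (1 - 2 * - u * -1 + (- u) ^ 2) with ((1 - u) ^ 2) by ring.
      rewrite ln_pow by lra. simpl. field.
  - subst. rewrite Rminus_0_r, ln_1.
    apply rser_ext with (fun _ => 0); [intros [|s]; simpl; ring|].
    apply is_lim_seq_ext with (fun _ => 0); [|apply is_lim_seq_const].
    intros; symmetry; apply rsum_0; auto.
  - replace (ln (1 - u)) with (/ 2 * ln (kern u 0)).
    + eapply rser_ext; [|apply rser_scal, rser_log_kern; lra].
      intros [|s]; cbv beta; [unfold logcoef; ring|]. unfold logcoef.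
      rewrite Rmult_0_r, cos_0. field. apply not_0_INR; lia.
    + unfold kern. rewrite cos_0. replace (1 - 2 * u * 1 + u ^ 2) with ((1 - u) ^ 2) by ring.
      rewrite ln_pow by lra. simpl. field.
Qed.

Lemma psum_logc (z : R) (K : nat) : 0 < z ->
  psum z (logc z K) (fun u => (z - u) ^ K * ln (z - u)).
Proof.
  intros Hz. induction K as [|K IH].
  - split.
    + intros u Hu. assert (Hq : Rabs (u / z) < 1).
      { unfold Rdiv. rewrite Rabs_mult, Rabs_inv, (Rabs_right z) by lra.
        apply (Rmult_lt_reg_r z); [lra|]. rewrite Rmult_assoc, Rinv_l by lra. lra. }
      assert (Hq' := Hq). apply Rabs_def2 in Hq'.
      assert (E := rser_first (fun s => logc z 0 s * u ^ s) (ln (1 - u / z))).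
      replace ((z - u) ^ 0 * ln (z - u)) with (logc z 0 0 * u ^ 0 + ln (1 - u / z)).
      * apply E.
        assert (G := rser_ln _ Hq).
        apply (rser_shift _ _ 1) in G; [|intros i Hi; replace i with O by lia; ring].
        eapply rser_ext; [|exact G]. intros s; cbv beta. change (1 + s)%nat with (S s).
        unfold logc, Rdiv. rewrite Rpow_mult_distr, pow_inv.
        field. split; [apply pow_nonzero; lra|apply not_0_INR; lia].
      * replace (z - u) with (z * (1 - u / z)) by (field; lra).
        rewrite ln_mult by lra. simpl. ring.
    + intros r Hr. exists (Rabs (ln z) + / (1 - r / z)).
      assert (Hq : 0 <= r / z < 1).
      { split; [apply Rmult_le_pos; [lra|left; apply Rinv_0_lt_compat; lra]|].
        apply (Rmult_lt_reg_r z); [lra|]. unfold Rdiv. rewrite Rmult_assoc, Rinv_l; lra. }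
      assert (0 < / (1 - r / z)) by (apply Rinv_0_lt_compat; lra).
      pose proof (Rabs_pos (ln z)).
      intros [|N]; [simpl; lra|].
      rewrite rsum_first. simpl pow. simpl logc. rewrite Rmult_1_r. apply Rplus_le_compat_l.
      apply Rle_trans with (rsum N (fun s => (r / z) ^ S s)).
      * apply rsum_le; intros s _.
        change (match s with O => 1 | S _ => INR s + 1 end) with (INR (S s)).
        unfold Rdiv. change (r * r ^ s) with (r ^ S s). change (z * z ^ s) with (z ^ S s).
        assert (1 <= INR (S s)) by (apply (le_INR 1); lia).
        assert (0 < z ^ S s) by (apply pow_lt; lra).
        rewrite Rabs_Ropp, Rinv_mult, Rpow_mult_distr, pow_inv.
        rewrite Rabs_right.
        -- rewrite Rmult_comm. apply Rmult_le_compat_l; [apply pow_le; lra|].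
           rewrite <- (Rmult_1_l (/ z ^ S s)) at 2.
           apply Rmult_le_compat_r; [left; apply Rinv_0_lt_compat; lra|].
           rewrite <- Rinv_1. apply Rinv_le_contravar; lra.
        -- apply Rle_ge, Rmult_le_pos; left; apply Rinv_0_lt_compat; lra.
      * apply Rle_trans with (rsum (S N) (fun s => (r / z) ^ s)).
        -- rewrite rsum_first. simpl pow. lra.
        -- apply rser_partial_le; [intros; apply pow_le; lra|].
           apply rser_geom. rewrite Rabs_right; lra.
  - apply (psum_mulzu z (logc z K)) in IH.
    eapply psum_ext; [reflexivity| |exact IH]. intros u; simpl; ring.
Qed.

Lemma psum_lpc (z c : R) (K : nat) : 0 < z ->
  psum z (lpc z c K) (fun u => (z - u) ^ K * (ln (z - u) + c)).
Proof.
  intros Hz. eapply psum_ext;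
    [| |apply (psum_lin z 1 c); [apply (psum_logc z K Hz)|apply (psum_polc z K)]].
  - intros s. unfold lpc. ring.
  - intros u. cbv beta. ring.
Qed.

(* Uniform convergence on [-u0, u0] turns a power series in a function of the angle
   into a series of Fourier coefficients. *)
Lemma fcoef_psum (n : nat) (z u0 : R) (a : nat -> R) (f g : R -> R) (l : nat -> R) :
  psum z a f -> 0 <= u0 < z -> (forall t, Rabs (g t) <= u0) ->
  (forall s, fcoef n (fun t => g t ^ s) (l s)) ->
  exists L, rser (fun s => a s * l s) L /\ fcoef n (fun t => f (g t)) L.
Proof.
  intros [H1 H2] Hu Hg Hl. destruct (H2 u0 Hu) as [B HB].
  destruct (rser_nonneg_ex (fun s => Rabs (a s) * u0 ^ s) B) as [S HS]; auto.
  { intros; apply Rmult_le_pos; [apply Rabs_pos|apply pow_le; lra]. }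
  apply (fcoef_series n (fun s t => a s * g t ^ s) _ (fun s => Rabs (a s) * u0 ^ s) _ S); auto.
  - intros s. apply (fcoef_scal n (fun t => g t ^ s)); auto.
  - intros s t. rewrite Rabs_mult, <- RPow_abs. apply Rmult_le_compat_l; [apply Rabs_pos|].
    apply pow_incr. split; [apply Rabs_pos|auto].
  - intros t. apply H1. specialize (Hg t). lra.
Qed.

Lemma fcoef_lp (n K : nat) (x c : R) : 0 < x < 1 ->
  fcoef n (fun t => (zx x - cos t) ^ K * (ln (zx x - cos t) + c))
    (/ (2 * x) ^ K * (- x) ^ n *
      (rsum (S K) (fun s => dleg n K s * (x ^ 2) ^ s)
       + (c - ln (2 * x)) * rsum (S K) (fun s =>
           ff (INR K) (n + s) / rfact (n + s) * (ff (INR K) s / rfact s) * (x ^ 2) ^ s))).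
Proof.
  intros Hx. assert (Hz := zx_gt_1 x Hx).
  assert (G := fcoef_scal _ _ _ (/ (2 * x) ^ K)
    (fcoef_plus _ _ _ _ _ (fcoef_kern_pow_log K n x Hx)
      (fcoef_scal _ _ _ (c - ln (2 * x)) (fcoef_kern_pow K n x)))).
  match goal with |- fcoef _ _ ?v => match type of G with fcoef _ _ ?v' =>
    replace v with v' by ring end end.
  eapply fcoef_ext; [|exact G].
  intros t. cbv beta. rewrite kern_zx by lra. pose proof (COS_bound t).
  rewrite (Rpow_mult_distr (2 * x)), (ln_mult (2 * x)) by lra. field. apply pow_nonzero; lra.
Qed.

(** * Radial coefficients *)

(** By [kap_shift] and [lpc_shift] each term is a multiple of the term of index [s + lam] for the
    circle, with exponent [p + lam] and order [L + lam]. The sum is therefore a Fourier coefficient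
    of the logarithmic kernel, given by [fcoef_lp]. *)
Lemma radial_coef (x ell : R) (p lam L : nat) : 0 < x < 1 ->
  rser (fun s => lpc (zx x) ell p s * (rfact s / 2 ^ s * kap lam s L))
    ((-2) ^ lam * (rfact p / rfact (p + lam)) *
     (/ (2 * x) ^ (p + lam) * (- x) ^ (L + lam) *
      (rsum (S (p + lam)) (fun s => dleg (L + lam) (p + lam) s * (x ^ 2) ^ s)
       + (ell - harmonic (p + lam) + harmonic p - ln (2 * x))
         * rsum (S (p + lam)) (fun s =>
           ff (INR (p + lam)) (L + lam + s) / rfact (L + lam + s)
           * (ff (INR (p + lam)) s / rfact s) * (x ^ 2) ^ s)))).
Proof.
  intros Hx. assert (Hz := zx_gt_1 x Hx).
  set (c := ell - harmonic (p + lam) + harmonic p).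
  destruct (fcoef_psum (L + lam) (zx x) 1 _ _ cos
    (fun s => rfact s / 2 ^ s * kap 0 s (L + lam)) (psum_lpc (zx x) c (p + lam) ltac:(lra)))
    as [V [HV HF]].
  - lra.
  - apply Rabs_cos_le.
  - intros s. apply fcoef_cos_pow.
  - assert (EV := fcoef_unique _ _ _ _ HF (fcoef_lp (L + lam) (p + lam) x c Hx)).
    rewrite <- EV. clear EV.
    (* The circle series starts at index [0], but its first [lam] terms vanish because the order is
       at least [lam]. *)
    apply (rser_shift _ _ lam) in HV.
    2:{ intros i Hi. rewrite kap_gt by lia. ring. }
    apply (rser_scal _ _ ((-2) ^ lam * (rfact p / rfact (p + lam)))) in HV.
    eapply rser_ext; [|exact HV]. intros s; cbv beta.
    rewrite (kap_shift lam s L), (Nat.add_comm lam s).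
    assert (E := lpc_shift (zx x) ell p lam s ltac:(lra)). fold c in E.
    assert (H2 : forall k, 2 ^ k <> 0) by (intros; apply pow_nonzero; lra).
    transitivity ((-2) ^ lam * (rfact p / rfact (p + lam)) / 2 ^ (s + lam)
       * kap 0 (s + lam) (L + lam)
       * (rfact (s + lam) * lpc (zx x) c (p + lam) (s + lam))).
    + unfold Rdiv. ring.
    + rewrite E. replace (-2) with (-1 * 2) by ring. rewrite Rpow_mult_distr, pow_add.
      transitivity (lpc (zx x) ell p s * (rfact s / 2 ^ s * kap 0 (s + lam) (L + lam))
                    * ((-1) ^ lam * (-1) ^ lam)).
      * field. repeat split; auto; apply rfact_neq_0.
      * rewrite pow_m1_sq. ring.
Qed.

(** The bracket of the theorem with [n = L + lam] and [K = p + lam]. Its single sum joins two finite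
    sums of the statement: for [i < n] the factor [fquot i n] is [0] and the last sum remains, for
    [i >= n] both summands are present. *)
Definition low_bracket (n K : nat) (e w : R) : R :=
  (e + 2 * harmonic (2 * K) - harmonic (K + n) - harmonic (K - n)) / rfact (K - n)
    * legp n K w
  + rsum K (fun i => dcoef K i * (fquot i n / rfact (K + n) + / rfact (K - n))
                     * legp n i w).

Lemma shx_pow (x : R) (K : nat) : 0 < x < 1 ->
  shx x ^ K = / (2 * x) ^ K * (1 - x ^ 2) ^ K.
Proof.
  intros Hx. unfold shx, Rdiv. rewrite Rpow_mult_distr, pow_inv. ring.
Qed.

Lemma radial_coef_low (x ell : R) (p lam L : nat) : 0 < x < 1 -> (L <= p)%nat ->
  rser (fun s => lpc (zx x) ell p s * (rfact s / 2 ^ s * kap lam s L))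
    ((-2) ^ lam * rfact p * shx x ^ (p + lam) * (- x) ^ (L + lam)
     * low_bracket (L + lam) (p + lam)
         (ell - ln (2 * x) - harmonic (p + lam) + harmonic p) (wx x)).
Proof.
  intros Hx HL. assert (H := radial_coef x ell p lam L Hx).
  assert (Hx2 : x ^ 2 <> 1) by nra.
  rewrite dleg_low, leg_low in H by (auto; lia).
  match goal with |- rser _ ?v => match type of H with rser _ ?v' =>
    replace v with v'; [exact H|] end end.
  unfold low_bracket. fold (wx x). rewrite shx_pow by auto.
  assert ((2 * x) ^ (p + lam) <> 0) by (apply pow_nonzero; lra).
  field. repeat split; auto; apply rfact_neq_0.
Qed.

Lemma radial_coef_high (x ell : R) (p lam L : nat) : 0 < x < 1 -> (p < L)%nat ->
  rser (fun s => lpc (zx x) ell p s * (rfact s / 2 ^ s * kap lam s L))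
    ((-2) ^ lam * rfact p * shx x ^ (p + lam) * (- x) ^ (L + lam)
     * ((-1) ^ (L - p - 1) * rfact (L - p - 1) * legp (L + lam) (p + lam) (wx x))).
Proof.
  intros Hx HL. assert (H := radial_coef x ell p lam L Hx).
  assert (Hx2 : x ^ 2 <> 1) by nra.
  rewrite dleg_high in H by (auto; lia).
  rewrite (rsum_0 _ (fun s => ff _ (L + lam + s) / _ * _ * _)) in H
    by (intros i Hi; rewrite ff_0 by lia; unfold Rdiv; ring).
  match goal with |- rser _ ?v => match type of H with rser _ ?v' =>
    replace v with v'; [exact H|] end end.
  fold (wx x). rewrite shx_pow by auto.
  replace (L + lam - (p + lam) - 1)%nat with (L - p - 1)%nat by lia.
  assert ((2 * x) ^ (p + lam) <> 0) by (apply pow_nonzero; lra).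
  field. repeat split; auto; apply rfact_neq_0.
Qed.

(** * Bateman's expansion of a product of Bessel functions *)

(* Coefficients, in c^(i-b) e^b, of homogeneous polynomials of degree i in (c, e).
   [hmul] is multiplication by c + e; [hlap] sends c^a e^b to
   a (a + al) c^(a-1) e^b + b (b + be) c^a e^(b-1). *)
Definition hmul (g : nat -> R) (b : nat) : R :=
  g b + match b with O => 0 | S b' => g b' end.

Definition hlap (al be i : nat) (g : nat -> R) (b : nat) : R :=
  (INR i - INR b) * (INR i - INR b + INR al) * g b
  + (INR b + 1) * (INR b + 1 + INR be) * g (S b).

(** On functions of two squared radii, [hlap] is a quarter of the Laplacian of R^(2 al + 2) x R^(2
    be + 2), and [c + e] is the squared norm. [hker] is the degree-[i] part of a product of two
    Bessel series in [c c'] and [e e'], seen as a polynomial in [(c', e')]. *)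
Definition hker (al be : nat) (c e : R) (i b : nat) : R :=
  if Nat.leb b i then
    c ^ (i - b) * e ^ b / (rfact (i - b) * rfact (al + (i - b)) * (rfact b * rfact (be + b)))
  else 0.

Lemma hker_le (al be : nat) (c e : R) (i b : nat) : (b <= i)%nat ->
  hker al be c e i b =
  c ^ (i - b) * e ^ b / (rfact (i - b) * rfact (al + (i - b)) * (rfact b * rfact (be + b))).
Proof. intros H. unfold hker. apply Nat.leb_le in H; rewrite H; auto. Qed.

Lemma hker_gt (al be : nat) (c e : R) (i b : nat) : (i < b)%nat -> hker al be c e i b = 0.
Proof. intros H. unfold hker. apply Nat.leb_gt in H; rewrite H; auto. Qed.

(** The commutator of the Laplacian with multiplication by the squared norm: a multiple of the
    identity on each degree. *)
Lemma hlap_hmul (al be i : nat) (g : nat -> R) (b : nat) :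
  hlap al be (S i) (hmul g) b
  = hmul (hlap al be i g) b + (2 * INR i + INR (al + be) + 2) * g b.
Proof.
  unfold hlap, hmul. rewrite plus_INR, S_INR.
  destruct b as [|b]; [simpl; ring|]. rewrite !S_INR. ring.
Qed.

Lemma hlap_hker (al be : nat) (c e : R) (i b : nat) :
  hlap al be (S i) (hker al be c e (S i)) b = (c + e) * hker al be c e i b.
Proof.
  unfold hlap. destruct (lt_eq_lt_dec b (S i)) as [[H|H]|H].
  - rewrite 3!hker_le by lia. replace (S i - b)%nat with (S (i - b)) by lia.
    replace (S i - S b)%nat with (i - b)%nat by lia.
    rewrite 2!Nat.add_succ_r, 4!rfact_S, S_INR, minus_INR, !plus_INR, minus_INR by lia.
    assert (INR b <= INR i) by (apply le_INR; lia).
    pose proof (pos_INR al). pose proof (pos_INR be). pose proof (pos_INR b).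
    simpl pow. field. repeat split; try apply rfact_neq_0; lra.
  - subst. rewrite (hker_gt al be c e _ (S (S i))), (hker_gt al be c e i) by lia.
    replace (INR (S i) - INR (S i)) with 0 by ring. ring.
  - rewrite 3!hker_gt by lia. ring.
Qed.

Lemma hlap_0 (al be : nat) (c e : R) (b : nat) : hlap al be 0 (hker al be c e 0) b = 0.
Proof.
  unfold hlap. rewrite (hker_gt al be c e 0 (S b)) by lia.
  destruct b; [simpl; ring|]. rewrite (hker_gt al be c e 0 (S b)) by lia. ring.
Qed.

(** The point [(1, -1)] lies on the cone [c + e = 0], so by [hlap_hker] this kernel is harmonic. Up
    to normalization it is the homogeneous form of a Jacobi polynomial, see [JacobiP_jhom]. *)
Definition hharm (al be n : nat) : nat -> R := hker al be 1 (-1) n.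

Lemma hlap_hharm (al be n b : nat) : hlap al be n (hharm al be n) b = 0.
Proof.
  destruct n as [|n]; [apply hlap_0|]. unfold hharm. rewrite hlap_hker. ring.
Qed.

Fixpoint hpow (k : nat) (g : nat -> R) : nat -> R :=
  match k with O => g | S k' => hmul (hpow k' g) end.

Lemma hmul_ext (f g : nat -> R) (b : nat) :
  (forall b, f b = g b) -> hmul f b = hmul g b.
Proof. intros H. unfold hmul. destruct b; rewrite !H; auto. Qed.

Lemma hmul_scal (a : R) (g : nat -> R) (b : nat) :
  hmul (fun b => a * g b) b = a * hmul g b.
Proof. unfold hmul. destruct b; ring. Qed.

Lemma hlap_hpow (al be n k b : nat) :
  hlap al be (n + S k) (hpow (S k) (hharm al be n)) b
  = (INR k + 1) * (INR k + 1 + 2 * INR n + INR (al + be) + 1)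
    * hpow k (hharm al be n) b.
Proof.
  revert b; induction k as [|k IH]; intros b.
  - rewrite Nat.add_1_r. simpl hpow. rewrite hlap_hmul.
    rewrite (hmul_ext _ (fun b => 0 * 0)) by (intros; rewrite hlap_hharm; ring).
    rewrite (hmul_scal 0 (fun _ => 0)). simpl INR. ring.
  - change (hpow (S (S k)) (hharm al be n)) with (hmul (hpow (S k) (hharm al be n))).
    rewrite Nat.add_succ_r, hlap_hmul.
    rewrite (hmul_ext _ (fun b => (INR k + 1) * (INR k + 1 + 2 * INR n + INR (al + be) + 1)
                                  * hpow k (hharm al be n) b) b) by apply IH.
    rewrite hmul_scal. change (hmul (hpow k (hharm al be n)) b)
      with (hpow (S k) (hharm al be n) b).
    rewrite !plus_INR, !S_INR. ring.
Qed.

Lemma hpow_supp (k N : nat) (g : nat -> R) :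
  (forall b, (N < b)%nat -> g b = 0) -> forall b, (N + k < b)%nat -> hpow k g b = 0.
Proof.
  intros Hg. induction k as [|k IH]; intros b Hb; simpl; [apply Hg; lia|].
  unfold hmul. rewrite IH by lia. destruct b; [ring|]. rewrite IH by lia. ring.
Qed.

Definition hev (c e : R) (N : nat) (g : nat -> R) : R :=
  rsum (S N) (fun b => g b * (c ^ (N - b) * e ^ b)).

Lemma hev_hmul (c e : R) (N : nat) (g : nat -> R) : g (S N) = 0 ->
  hev c e (S N) (hmul g) = (c + e) * hev c e N g.
Proof.
  intros H. unfold hev, hmul.
  rewrite (rsum_ext _ _ (fun b => g b * (c ^ (S N - b) * e ^ b)
     + match b with O => 0 | S b' => g b' end * (c ^ (S N - b) * e ^ b)))
    by (intros; ring).
  rewrite rsum_plus, (rsum_first (S N) (fun b => match b with O => 0 | _ => _ end * _)).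
  rewrite rsum_S, H, 2!Rmult_0_l, Rplus_0_r, Rplus_0_l, Rmult_plus_distr_r.
  rewrite <- 2!rsum_scal. f_equal; apply rsum_ext; intros b Hb.
  - replace (S N - b)%nat with (S (N - b)) by lia. simpl pow. ring.
  - replace (S N - S b)%nat with (N - b)%nat by lia. simpl pow. ring.
Qed.

Lemma hharm_supp (al be n b : nat) : (n < b)%nat -> hharm al be n b = 0.
Proof. apply hker_gt. Qed.

Lemma hev_hpow (c e : R) (al be n k : nat) :
  hev c e (n + k) (hpow k (hharm al be n)) = (c + e) ^ k * hev c e n (hharm al be n).
Proof.
  induction k as [|k IH]; [simpl; rewrite Nat.add_0_r; ring|].
  rewrite Nat.add_succ_r. simpl hpow. rewrite hev_hmul, IH; [simpl; ring|].
  apply (hpow_supp k n); [apply hharm_supp|lia].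
Qed.

Lemma hker_pos (al be i b : nat) : (b <= i)%nat -> 0 < hker al be 1 1 i b.
Proof.
  intros H. rewrite hker_le, 2!pow1 by auto.
  apply Rdiv_lt_0_compat; [lra|]. repeat apply Rmult_lt_0_compat; apply rfact_pos.
Qed.

(** The Laplace equation is a two-term recurrence in [b], so [g] is a multiple of one harmonic
    polynomial with alternating coefficients. Its value at [(1, -1)] is a sum of positive terms;
    vanishing there forces the multiple to be [0]. *)
Lemma hlap_unique (al be N : nat) (g : nat -> R) :
  (forall b, hlap al be N g b = 0) -> (forall b, (N < b)%nat -> g b = 0) ->
  hev 1 (-1) N g = 0 -> forall b, g b = 0.
Proof.
  intros HD Hs He.
  assert (HK : forall b, hlap al be N (fun b => (-1) ^ b * hker al be 1 1 N b) b = 0).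
  { intros b. rewrite <- (hlap_hharm al be N b). unfold hlap, hharm.
    assert (E : forall b, (-1) ^ b * hker al be 1 1 N b = hker al be 1 (-1) N b).
    { intros b'. destruct (le_lt_dec b' N).
      - rewrite 2!hker_le, 2!pow1 by auto. unfold Rdiv. ring.
      - rewrite 2!hker_gt by auto. ring. }
    rewrite !E. ring. }
  assert (H : forall b, (b <= N)%nat ->
    g b * hker al be 1 1 N 0 = g O * ((-1) ^ b * hker al be 1 1 N b)).
  { induction b as [|b IH]; intros Hb; [simpl; ring|].
    specialize (HD b). specialize (HK b). unfold hlap in HD, HK. specialize (IH ltac:(lia)).
    pose proof (pos_INR b). pose proof (pos_INR be).
    apply (Rmult_eq_reg_l ((INR b + 1) * (INR b + 1 + INR be))); [|nra].
    transitivity (- ((INR N - INR b) * (INR N - INR b + INR al)) * (g b * hker al be 1 1 N 0)).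
    - transitivity ((((INR N - INR b) * (INR N - INR b + INR al) * g b +
        (INR b + 1) * (INR b + 1 + INR be) * g (S b)) * hker al be 1 1 N 0)
        - (INR N - INR b) * (INR N - INR b + INR al) * (g b * hker al be 1 1 N 0)); [ring|].
      rewrite HD. ring.
    - rewrite IH.
      transitivity (g O * (((INR N - INR b) * (INR N - INR b + INR al)
          * ((-1) ^ b * hker al be 1 1 N b) +
        (INR b + 1) * (INR b + 1 + INR be) * ((-1) ^ S b * hker al be 1 1 N (S b)))
        - (INR N - INR b) * (INR N - INR b + INR al) * ((-1) ^ b * hker al be 1 1 N b)));
        [rewrite HK|]; ring. }
  assert (H0 : 0 < hker al be 1 1 N 0) by (apply hker_pos; lia).
  assert (G0 : g O = 0).
  { assert (E : hev 1 (-1) N g * hker al be 1 1 N 0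
                = g O * rsum (S N) (fun b => hker al be 1 1 N b)).
    { unfold hev. rewrite (Rmult_comm (rsum _ _)), <- 2!rsum_scal.
      apply rsum_ext; intros b Hb. rewrite pow1.
      transitivity (g b * hker al be 1 1 N 0 * (-1) ^ b); [ring|].
      rewrite H by lia.
      transitivity (g O * hker al be 1 1 N b * ((-1) ^ b * (-1) ^ b)); [ring|].
      rewrite pow_m1_sq. ring. }
    rewrite He, Rmult_0_l in E. symmetry in E. apply Rmult_integral in E.
    destruct E as [E|E]; auto. exfalso.
    assert (hker al be 1 1 N 0 <= rsum (S N) (fun b => hker al be 1 1 N b)); [|lra].
    apply (rsum_term_le (S N) 0 (fun b => hker al be 1 1 N b)); [lia|].
    intros b. destruct (le_lt_dec b N); [left; apply hker_pos; auto|].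
    rewrite hker_gt by auto. lra. }
  intros b. destruct (le_lt_dec b N) as [Hb|Hb]; [|auto].
  specialize (H b Hb). rewrite G0, Rmult_0_l in H.
  apply Rmult_integral in H. destruct H; auto. lra.
Qed.

Lemma fd_sum (n : nat) (r : nat -> R) :
  fd n r = (-1) ^ n * rsum (S n) (fun j => chs n j * ((-1) ^ j * r j)).
Proof.
  revert r; induction n as [|n IH]; intros r; [simpl; ring|].
  rewrite fd_S, 2!IH, rsum_pascal.
  rewrite (rsum_ext (S n) (fun j => chs n j * ((-1) ^ j * r j + (-1) ^ S j * r (S j)))
    (fun j => chs n j * ((-1) ^ j * r j) + -1 * (chs n j * ((-1) ^ j * r (S j)))))
    by (intros; simpl pow; ring).
  rewrite rsum_plus, rsum_scal. simpl pow. ring.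
Qed.

Lemma rf_neg_nat (A b : nat) : (b <= A)%nat ->
  rf (- INR A) b = (-1) ^ b * rfact A / rfact (A - b).
Proof. intros H. rewrite rf_opp, ff_fact by auto. unfold Rdiv; ring. Qed.

(** Chu-Vandermonde in the form [fd_rf], with a base for which the rising factorial is that of the
    negative integer [-(al + n)]. *)
Lemma hharm_norm (al be n : nat) :
  hev 1 (-1) n (hharm al be n)
  = rfact (al + be + 2 * n) / (rfact n * rfact (al + n) * rfact (be + n) * rfact (al + be + n)).
Proof.
  assert (E := fd_rf n be (- (INR (al + n) + 1))).
  replace (- (INR (al + n) + 1) + 1) with (- INR (al + n)) in E by ring.
  replace (- (INR (al + n) + 1) - INR be) with (- (INR (al + n + be) + 1)) in E
    by (rewrite (plus_INR (al + n)); ring).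
  rewrite fd_sum, ff_opp in E.
  apply (f_equal (fun t => (-1) ^ n * t)) in E. rewrite <- Rmult_assoc, pow_m1_sq in E.
  rewrite Rmult_1_l in E. unfold Rdiv in E. rewrite <- 2!Rmult_assoc, pow_m1_sq, Rmult_1_l in E.
  transitivity (/ (rfact n * rfact (al + n)) *
    rsum (S n) (fun j => chs n j * ((-1) ^ j * (rf (- INR (al + n)) j * / rfact (be + j))))).
  - unfold hev, hharm. rewrite <- rsum_scal. apply rsum_ext; intros b Hb.
    rewrite rf_neg_nat, chs_fact, hker_le, pow1 by lia.
    replace (al + n - b)%nat with (al + (n - b))%nat by lia. field. rfact_nz.
  - rewrite E. assert (G := rf_fact (al + n + be) n).
    replace (al + n + be + n)%nat with (al + be + 2 * n)%nat in G by lia.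
    rewrite <- G. replace (al + n + be)%nat with (al + be + n)%nat by lia.
    field. rfact_nz.
Qed.

(** This is [(al + be + 2 n + 1)!] divided by the value of [hharm] at [(1, -1)], as the top term of
    [hker_expansion] requires. *)
Definition jnorm (al be n : nat) : R :=
  INR (2 * n + al + be + 1) * rfact (n + al + be) * rfact n * rfact (n + al) * rfact (n + be).

Definition jhom (al be n : nat) (c e : R) : R := hev c e n (hharm al be n).

(** The decomposition of a homogeneous polynomial into powers of the squared norm times harmonic
    polynomials. By induction on the degree both sides have the same Laplacian, so their difference
    is harmonic. At [(1, -1)] all terms with a positive power of the norm vanish and the top terms
    agree, so [hlap_unique] applies. *)
Lemma hker_expansion (al be : nat) (c e : R) (i : nat) : c + e = 1 ->
  forall b, hker al be c e i b
  = rsum (S i) (fun n => jnorm al be n * jhom al be n c e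
       / (rfact (i - n) * rfact (al + be + 1 + n + i)) * hpow (i - n) (hharm al be n) b).
Proof.
  intros Hce.
  assert (Htop : forall i, jnorm al be i / (rfact 0 * rfact (al + be + 1 + i + i))
            * hev 1 (-1) i (hharm al be i) = 1).
  { clear i. intros i. rewrite hharm_norm. unfold jnorm.
    replace (al + be + 1 + i + i)%nat with (S (al + be + 2 * i)) by lia.
    rewrite rfact_S, rfact_0, <- S_INR.
    replace (S (al + be + 2 * i)) with (2 * i + al + be + 1)%nat by lia.
    replace (i + al + be)%nat with (al + be + i)%nat by lia.
    rewrite (Nat.add_comm i al), (Nat.add_comm i be).
    field. repeat split; try apply rfact_neq_0. apply not_0_INR; lia. }
  (* The kernel is symmetric: the kernel of [(c, e)] at [(1, -1)] is the kernel of [(1, -1)] at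
     [(c, e)]. *)
  assert (Hdual : forall i, hev 1 (-1) i (hker al be c e i) = jhom al be i c e).
  { clear i. intros i. unfold jhom, hev, hharm. apply rsum_ext; intros b Hb.
    rewrite 2!hker_le, pow1 by lia. unfold Rdiv. ring. }
  induction i as [|i IH]; intros b.
  - simpl rsum. change (hpow (0 - 0) (hharm al be 0)) with (hharm al be 0).
    assert (E := Htop O). change (0 - 0)%nat with 0%nat.
    assert (E0 : hev 1 (-1) 0 (hharm al be 0) = hharm al be 0 0) by (unfold hev; simpl; ring).
    assert (E1 : jhom al be 0 c e = hharm al be 0 0) by (unfold jhom, hev; simpl; ring).
    destruct b as [|b].
    + rewrite E1. rewrite E0 in E.
      replace (hker al be c e 0 0) with (hharm al be 0 0)
        by (unfold hharm; rewrite 2!hker_le by lia; reflexivity).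
      rewrite Rplus_0_l, <- Rmult_1_r at 1. rewrite <- E. unfold Rdiv. ring.
    + rewrite hker_gt, hharm_supp by lia. ring.
  - set (RR := fun b => rsum (S (S i)) (fun n => jnorm al be n * jhom al be n c e
       / (rfact (S i - n) * rfact (al + be + 1 + n + S i))
       * hpow (S i - n) (hharm al be n) b)).
    change (hker al be c e (S i) b = RR b). apply Rminus_diag_uniq.
    apply (hlap_unique al be (S i) (fun b => hker al be c e (S i) b - RR b)).
    + clear b. intros b.
      transitivity (hlap al be (S i) (hker al be c e (S i)) b - hlap al be (S i) RR b);
        [unfold hlap; ring|].
      rewrite hlap_hker, Hce, Rmult_1_l, IH. apply Rminus_diag_eq.
      transitivity (rsum (S (S i)) (fun n => jnorm al be n * jhom al be n c e
       / (rfact (S i - n) * rfact (al + be + 1 + n + S i))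
       * hlap al be (S i) (hpow (S i - n) (hharm al be n)) b)).
      * rewrite (rsum_S (S i)), Nat.sub_diag. simpl (hpow 0).
        rewrite hlap_hharm, Rmult_0_r, Rplus_0_r.
        apply rsum_ext; intros n Hn. replace (S i - n)%nat with (S (i - n)) by lia.
        replace (hlap al be (S i)) with (hlap al be (n + S (i - n))) by (f_equal; lia).
        rewrite hlap_hpow.
        replace (al + be + 1 + n + S i)%nat with (S (al + be + 1 + n + i)) by lia.
        rewrite 2!rfact_S, minus_INR, !plus_INR by lia. change (INR 1) with 1.
        assert (INR n <= INR i) by (apply le_INR; lia). pose proof (pos_INR n).
        pose proof (pos_INR al). pose proof (pos_INR be).
        field. repeat split; try apply rfact_neq_0; lra.
      * unfold RR, hlap. rewrite <- 2!rsum_scal, <- rsum_plus.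
        apply rsum_ext; intros; ring.
    + clear b. intros b Hb. rewrite hker_gt by lia. unfold RR.
      rewrite rsum_0; [ring|]. intros n Hn.
      rewrite (hpow_supp (S i - n) n); [ring|apply hharm_supp|lia].
    + transitivity (hev 1 (-1) (S i) (hker al be c e (S i)) - hev 1 (-1) (S i) RR).
      { unfold hev. rewrite <- rsum_minus. apply rsum_ext; intros; ring. }
      rewrite Hdual. apply Rminus_diag_eq.
      transitivity (rsum (S (S i)) (fun n => jnorm al be n * jhom al be n c e
       / (rfact (S i - n) * rfact (al + be + 1 + n + S i))
       * hev 1 (-1) (S i) (hpow (S i - n) (hharm al be n)))).
      * rewrite (rsum_S (S i)), rsum_0.
        -- rewrite Nat.sub_diag. simpl (hpow 0).
           assert (E := Htop (S i)).
           transitivity (jhom al be (S i) c e * (jnorm al be (S i)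
             / (rfact 0 * rfact (al + be + 1 + S i + S i)) * hev 1 (-1) (S i) (hharm al be (S i))));
             [rewrite E|unfold Rdiv]; ring.
        -- intros n Hn. replace (S i) with (n + (S i - n))%nat at 3 by lia.
           rewrite hev_hpow. replace (1 + -1) with 0 by ring.
           rewrite pow_i by lia. ring.
      * unfold hev at 1.
        rewrite (rsum_ext _ (fun n => _ / _ * _) (fun n => rsum (S (S i)) (fun b =>
          jnorm al be n * jhom al be n c e
           / (rfact (S i - n) * rfact (al + be + 1 + n + S i))
           * (hpow (S i - n) (hharm al be n) b * (1 ^ (S i - b) * (-1) ^ b)))))
          by (intros; rewrite rsum_scal; reflexivity).
        rewrite rsum_swap. unfold hev. apply rsum_ext; intros b' Hb'. unfold RR.
        symmetry. rewrite Rmult_comm, <- rsum_scal. apply rsum_ext; intros; ring.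
Qed.

(** The kernel of [(c', e')] is evaluated at [(c, e)], once directly and once through
    [hker_expansion]; [c + e = 1] turns the powers of the norm into [1]. *)
Lemma bateman (al be : nat) (c e c' e' : R) (i : nat) : c + e = 1 -> c' + e' = 1 ->
  rsum (S i) (fun b => (c * c') ^ (i - b) * (e * e') ^ b
     / (rfact (i - b) * rfact (al + (i - b)) * (rfact b * rfact (be + b))))
  = rsum (S i) (fun n => jnorm al be n * jhom al be n c e * jhom al be n c' e'
       / (rfact (i - n) * rfact (al + be + 1 + n + i))).
Proof.
  intros H H'.
  transitivity (hev c e i (hker al be c' e' i)).
  - unfold hev. apply rsum_ext; intros b Hb. rewrite hker_le by lia.
    rewrite 2!Rpow_mult_distr. field. rfact_nz.
  - unfold hev. rewrite (rsum_ext _ _ (fun b => rsum (S i) (fun n =>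
      jnorm al be n * jhom al be n c' e'
       / (rfact (i - n) * rfact (al + be + 1 + n + i))
       * (hpow (i - n) (hharm al be n) b * (c ^ (i - b) * e ^ b))))).
    2:{ intros b Hb. rewrite (hker_expansion al be c' e' i H'), Rmult_comm, <- rsum_scal.
        apply rsum_ext; intros; ring. }
    rewrite rsum_swap. apply rsum_ext; intros n Hn. rewrite rsum_scal.
    change (rsum (S i) (fun b => hpow (i - n) (hharm al be n) b * (c ^ (i - b) * e ^ b)))
      with (hev c e i (hpow (i - n) (hharm al be n))).
    replace (hev c e i) with (hev c e (n + (i - n))) by (f_equal; lia).
    rewrite hev_hpow, H, pow1. unfold jhom. field. rfact_nz.
Qed.

Lemma PSeries_finite (a : nat -> R) (n : nat) (t : R) :
  (forall j, (n < j)%nat -> a j = 0) -> PSeries a t = rsum (S n) (fun j => a j * t ^ j).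
Proof.
  intros H. apply is_series_unique, rser_is_series.
  apply (is_lim_seq_incr_n _ (S n)).
  apply is_lim_seq_ext with (fun _ => rsum (S n) (fun j => a j * t ^ j));
    [|apply is_lim_seq_const].
  intros N. symmetry. apply rsum_extend; [lia|]. intros i Hi. rewrite H by lia. ring.
Qed.

(** [fd_binomial] passes between the expansion in powers of [e], which is the hypergeometric form,
    and the homogeneous form in [c = 1 - e] and [e]. *)
Lemma JacobiP_jhom (al be n : nat) (c e : R) : c + e = 1 ->
  JacobiP n (INR be) (INR al) (c - e) = rfact (n + al) * rfact (n + be) * jhom al be n c e.
Proof.
  intros H. unfold JacobiP, hyp2F1. replace ((1 - (c - e)) / 2) with e by (rewrite <- H; field).
  change pochhammer with rf.
  rewrite (PSeries_finite _ n).
  2:{ intros j Hj. rewrite rf_opp, ff_0 by auto. unfold Rdiv. ring. }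
  assert (E := fd_binomial n e (fun j => rf (- (INR (al + n) + 1) + 1) j / rfact (be + j))).
  assert (Hc : c = 1 - e) by lra.
  transitivity (rfact (n + be) / rfact n *
    rsum (S n) (fun s => chs n s * (e ^ s *
      fd s (fun j => rf (- (INR (al + n) + 1) + 1) j / rfact (be + j))))).
  - rewrite <- 2!rsum_scal. apply rsum_ext; intros s Hs.
    rewrite fd_rf.
    replace (- (INR (al + n) + 1) - INR be) with (- (INR n + INR be + INR al + 1))
      by (rewrite plus_INR; ring).
    rewrite ff_opp, rf_opp, ff_fact, chs_fact by lia. fold (rfact n) (rfact s).
    rewrite (Nat.add_comm n be), <- (rf_fact be n), <- (rf_fact be s).
    assert (rf (INR be + 1) s <> 0).
    { rewrite <- pochhammer_rf. apply Rgt_not_eq, pochhammer_pos.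
      pose proof (pos_INR be); lra. }
    field. repeat split; auto; apply rfact_neq_0.
  - rewrite <- E. unfold jhom, hev. rewrite <- 2!rsum_scal. apply rsum_ext; intros b Hb.
    replace (- (INR (al + n) + 1) + 1) with (- INR (al + n)) by ring.
    unfold hharm. rewrite rf_neg_nat, hker_le, chs_fact, pow1, Hc by lia.
    rewrite (Nat.add_comm n al). replace (al + n - b)%nat with (al + (n - b))%nat by lia.
    field. rfact_nz.
Qed.

(** * Convolution of sequences *)

Definition conv (f g : nat -> R) (s : nat) : R := rsum (S s) (fun a => f a * g (s - a)%nat).

Definition delta0 (s : nat) : R := match s with O => 1 | S _ => 0 end.

Definition expq (x : R) (s : nat) : R := x ^ s / rfact s.

Lemma conv_ext (f f' g g' : nat -> R) (s : nat) :
  (forall a, (a <= s)%nat -> f a = f' a) -> (forall a, (a <= s)%nat -> g a = g' a) ->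
  conv f g s = conv f' g' s.
Proof.
  intros Hf Hg. apply rsum_ext; intros a Ha. rewrite Hf, Hg by lia. auto.
Qed.

Lemma conv_comm (f g : nat -> R) (s : nat) : conv f g s = conv g f s.
Proof.
  unfold conv. rewrite rsum_rev. apply rsum_ext; intros a Ha.
  replace (s - (S s - 1 - a))%nat with a by lia.
  replace (S s - 1 - a)%nat with (s - a)%nat by lia. ring.
Qed.

Lemma rsum_triangle (F : nat -> nat -> R) (s : nat) :
  rsum (S s) (fun a => rsum (S a) (fun b => F b (a - b)%nat))
  = rsum (S s) (fun b => rsum (S (s - b)) (F b)).
Proof.
  induction s as [|s IH]; [reflexivity|].
  rewrite rsum_S, IH, (rsum_S (S s) (fun b => rsum _ _)), (rsum_S (S s) (fun b => F b _)).
  rewrite (rsum_ext (S s) (fun b => rsum (S (S s - b)) (F b))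
            (fun b => rsum (S (s - b)) (F b) + F b (S s - b)%nat)).
  2:{ intros b Hb. replace (S s - b)%nat with (S (s - b)) by lia. reflexivity. }
  rewrite rsum_plus, Nat.sub_diag. simpl (rsum 1 _). ring.
Qed.

Lemma conv_assoc (f g h : nat -> R) (s : nat) :
  conv (conv f g) h s = conv f (conv g h) s.
Proof.
  unfold conv.
  transitivity (rsum (S s) (fun b => rsum (S (s - b)) (fun c =>
                  f b * g c * h (s - b - c)%nat))).
  - rewrite <- (rsum_triangle (fun b c => f b * g c * h (s - b - c)%nat)).
    apply rsum_ext; intros a Ha. rewrite Rmult_comm, <- rsum_scal.
    apply rsum_ext; intros b Hb. replace (s - b - (a - b))%nat with (s - a)%nat by lia. ring.
  - apply rsum_ext; intros b Hb. rewrite <- rsum_scal. apply rsum_ext; intros; ring.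
Qed.

Lemma conv_delta0_l (f : nat -> R) (s : nat) : conv delta0 f s = f s.
Proof.
  unfold conv. rewrite rsum_first, rsum_0.
  - rewrite Nat.sub_0_r. simpl. ring.
  - intros; simpl; ring.
Qed.

Lemma conv_delta0_r (f : nat -> R) (s : nat) : conv f delta0 s = f s.
Proof. rewrite conv_comm; apply conv_delta0_l. Qed.

Lemma conv_rsum_l (N : nat) (F : nat -> nat -> R) (g : nat -> R) (s : nat) :
  conv (fun a => rsum N (fun i => F i a)) g s = rsum N (fun i => conv (F i) g s).
Proof.
  unfold conv. rewrite rsum_swap. apply rsum_ext; intros a Ha.
  rewrite Rmult_comm, <- rsum_scal. apply rsum_ext; intros; ring.
Qed.

Lemma conv_scal_l (c : R) (f g : nat -> R) (s : nat) :
  conv (fun a => c * f a) g s = c * conv f g s.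
Proof. unfold conv. rewrite <- rsum_scal. apply rsum_ext; intros; ring. Qed.

Lemma conv_pow (c : R) (f g : nat -> R) (s : nat) :
  conv (fun a => c ^ a * f a) (fun a => c ^ a * g a) s = c ^ s * conv f g s.
Proof.
  unfold conv. rewrite <- rsum_scal. apply rsum_ext; intros a Ha.
  replace s with (a + (s - a))%nat at 3 by lia. rewrite pow_add. ring.
Qed.

Lemma conv_expq (x y : R) (s : nat) : conv (expq x) (expq y) s = expq (x + y) s.
Proof.
  unfold conv, expq. rewrite binomial, <- sum_n_Reals, rsum_sum_n. unfold Rdiv at 3.
  rewrite Rmult_comm, <- rsum_scal. apply rsum_ext; intros a Ha.
  unfold Binomial.C. fold (rfact s) (rfact a) (rfact (s - a)).
  field. rfact_nz.
Qed.

Lemma expq_0 (s : nat) : expq 0 s = delta0 s.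
Proof.
  unfold expq. destruct s; simpl; [rewrite rfact_0; field|]. unfold Rdiv; ring.
Qed.

Lemma conv_nonneg (f g : nat -> R) (s : nat) :
  (forall a, 0 <= f a) -> (forall a, 0 <= g a) -> 0 <= conv f g s.
Proof. intros Hf Hg. apply rsum_nonneg; intros. apply Rmult_le_pos; auto. Qed.

Definition cprod (l : list (nat -> R)) : nat -> R := fold_right conv delta0 l.

Lemma cprod_app (l l' : list (nat -> R)) (s : nat) :
  cprod (l ++ l')%list s = conv (cprod l) (cprod l') s.
Proof.
  revert s; induction l as [|f l IH]; intros s; simpl.
  - rewrite conv_delta0_l; auto.
  - rewrite conv_assoc. apply conv_ext; auto.
Qed.

(** * The node identity *)

Record node_data := {
  nd_c : R; nd_e : R; nd_c' : R; nd_e' : R; nd_t : R; nd_tau : R }.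

Definition node_valid (D : node_data) : Prop :=
  nd_c D + nd_e D = 1 /\ nd_c' D + nd_e' D = 1 /\
  nd_t D ^ 2 = nd_c D * nd_c' D /\ nd_tau D ^ 2 = nd_e D * nd_e' D.

Definition node_weight (D : node_data) (al be L1 L2 n : nat) : R :=
  jnorm al be n * nd_t D ^ L1 * nd_tau D ^ L2
  * jhom al be n (nd_c D) (nd_e D) * jhom al be n (nd_c' D) (nd_e' D).

Lemma rsum_spread (F : nat -> R) (n J : nat) :
  (forall s, (forall j, s <> (n + 2 * j)%nat) -> F s = 0) ->
  rsum (n + 2 * J) F = rsum J (fun j => F (n + 2 * j)%nat).
Proof.
  intros H0. induction J as [|J IH].
  - simpl. rewrite Nat.add_0_r. apply rsum_0. intros i Hi. apply H0. lia.
  - replace (n + 2 * S J)%nat with (S (S (n + 2 * J))) by lia.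
    rewrite 3!rsum_S, IH, (H0 (S _)); [ring|]. intros j. lia.
Qed.

(** On the right stands a coefficient of the product of the Bessel functions of the two children. It
    vanishes unless [s = L1 + L2 + 2 i], and then [bateman] in degree [i] applies. The offset
    [2 lam + 1] reflects that the dimension doubles at the parent. *)
Lemma node_sum (D : node_data) (lam L1 L2 N s : nat) : node_valid D -> (s < N)%nat ->
  rsum N (fun n => node_weight D (L1 + lam) (L2 + lam) L1 L2 n
                   * kap (2 * lam + 1) s (2 * n + L1 + L2))
  = conv (fun a => nd_t D ^ a * kap lam a L1) (fun b => nd_tau D ^ b * kap lam b L2) s.
Proof.
  intros [H1 [H2 [H3 H4]]] HN.
  destruct (parity_cases s (L1 + L2)) as [[i Hi]|Hno].
  2:{ rewrite rsum_0.
      2:{ intros n Hn. rewrite kap_0; [ring|]. intros j Hj. apply (Hno (n + j)%nat). lia. }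
      symmetry. apply rsum_0. intros a Ha.
      destruct (parity_cases a L1) as [[j1 E1]|E1]; [|rewrite (kap_0 lam a L1) by auto; ring].
      destruct (parity_cases (s - a) L2) as [[j2 E2]|E2].
      - exfalso. apply (Hno (j1 + j2)%nat). lia.
      - rewrite (kap_0 lam (s - a) L2) by auto; ring. }
  rewrite (rsum_extend (S i) N).
  2: lia.
  2:{ intros n Hn. rewrite kap_gt by lia. ring. }
  unfold conv.
  set (F := fun a => nd_t D ^ a * kap lam a L1 * (nd_tau D ^ (s - a) * kap lam (s - a) L2)).
  assert (EF : rsum (S s) F = rsum (L1 + 2 * S i) F).
  { destruct (le_lt_dec (S s) (L1 + 2 * S i)) as [Hl|Hl].
    - symmetry. apply rsum_extend; auto. intros a Ha. unfold F.
      rewrite (kap_0 lam a L1); [ring|]. lia.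
    - apply rsum_extend; [lia|]. intros a Ha. unfold F.
      rewrite (kap_gt lam (s - a) L2) by lia. ring. }
  change (fun a => nd_t D ^ a * kap lam a L1 * (nd_tau D ^ (s - a) * kap lam (s - a) L2))
    with F.
  rewrite EF, rsum_spread.
  2:{ intros a Ha. unfold F. rewrite kap_0 by auto. ring. }
  assert (B := bateman (L1 + lam) (L2 + lam) (nd_c D) (nd_e D) (nd_c' D) (nd_e' D) i H1 H2).
  transitivity (nd_t D ^ L1 * nd_tau D ^ L2 * rsum (S i) (fun n =>
    jnorm (L1 + lam) (L2 + lam) n * jhom (L1 + lam) (L2 + lam) n (nd_c D) (nd_e D)
    * jhom (L1 + lam) (L2 + lam) n (nd_c' D) (nd_e' D)
    / (rfact (i - n) * rfact (L1 + lam + (L2 + lam) + 1 + n + i)))).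
  - rewrite <- rsum_scal. apply rsum_ext; intros n Hn.
    replace s with (2 * n + L1 + L2 + 2 * (i - n))%nat by lia. rewrite kap_eq.
    replace (i - n + (2 * n + L1 + L2) + (2 * lam + 1))%nat
      with (L1 + lam + (L2 + lam) + 1 + n + i)%nat by lia.
    unfold node_weight. field. rfact_nz.
  - rewrite <- B, rsum_rev, <- rsum_scal. apply rsum_ext; intros j Hj. unfold F.
    replace (S i - 1 - j)%nat with (i - j)%nat by lia.
    replace (s - (L1 + 2 * j))%nat with (L2 + 2 * (i - j))%nat by lia.
    rewrite 2!kap_eq, 2!pow_add, 2!pow_mult, H3, H4.
    replace (i - (i - j))%nat with j by lia.
    replace (j + L1 + lam)%nat with (L1 + lam + j)%nat by lia.
    replace (i - j + L2 + lam)%nat with (L2 + lam + (i - j))%nat by lia.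
    field. rfact_nz.
Qed.

(** * The tree of quantum numbers *)

(** The subtree at [k] describes a subspace of dimension [D = 2^(q - log2 k)], and [lamk] is
    [D/2 - 1], the offset of the Bessel index. *)
Definition lamk (q k : nat) : nat := (2 ^ (q - 1 - Nat.log2 k) - 1)%nat.

Lemma pow2_half (q : nat) : (1 <= q)%nat -> (2 ^ q / 2 = 2 ^ (q - 1))%nat.
Proof.
  intros H. replace q with (S (q - 1)) at 1 by lia.
  rewrite Nat.pow_succ_r', Nat.mul_comm, Nat.div_mul; lia.
Qed.

Lemma pow2_pos (q : nat) : (1 <= 2 ^ q)%nat.
Proof. pose proof (Nat.pow_nonzero 2 q). lia. Qed.

Lemma log2_lt (q k : nat) : (2 <= q)%nat -> (1 <= k < 2 ^ (q - 1))%nat ->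
  (Nat.log2 k <= q - 2)%nat.
Proof.
  intros Hq Hk. assert (Nat.log2 k < q - 1)%nat; [|lia].
  apply Nat.log2_lt_pow2; lia.
Qed.

Lemma log2_leaf (q i : nat) : (1 <= q)%nat -> (2 ^ (q - 1) <= i < 2 ^ q)%nat ->
  Nat.log2 i = (q - 1)%nat.
Proof.
  intros Hq Hi. apply Nat.log2_unique; [lia|]. replace (S (q - 1)) with q by lia. lia.
Qed.

Lemma lamk_child (q k : nat) : (2 <= q)%nat -> (1 <= k < 2 ^ (q - 1))%nat ->
  lamk q k = (2 * lamk q (2 * k) + 1)%nat /\ lamk q (2 * k + 1) = lamk q (2 * k) /\
  (lamk q (2 * k) = 2 ^ (q - 2 - Nat.log2 k) - 1)%nat.
Proof.
  intros Hq Hk. assert (H := log2_lt q k Hq Hk). unfold lamk.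
  rewrite Nat.log2_double, Nat.log2_succ_double by lia.
  replace (q - 1 - S (Nat.log2 k))%nat with (q - 2 - Nat.log2 k)%nat by lia.
  replace (q - 1 - Nat.log2 k)%nat with (S (q - 2 - Nat.log2 k)) by lia.
  rewrite Nat.pow_succ_r'. pose proof (pow2_pos (q - 2 - Nat.log2 k)). lia.
Qed.

Lemma lamk_leaf (q i : nat) : (1 <= q)%nat -> (2 ^ (q - 1) <= i < 2 ^ q)%nat ->
  lamk q i = 0%nat.
Proof. intros Hq Hi. unfold lamk. rewrite (log2_leaf q i), Nat.sub_diag by auto. auto. Qed.

Lemma lnum_node (q : nat) (m n : nat -> nat) (k : nat) :
  (2 <= q)%nat -> (1 <= k < 2 ^ (q - 1))%nat ->
  lnum q m n k = (2 * n k + lnum q m n (2 * k) + lnum q m n (2 * k + 1))%nat.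
Proof.
  intros Hq Hk. assert (H := log2_lt q k Hq Hk). unfold lnum.
  rewrite Nat.log2_double, Nat.log2_succ_double by lia.
  replace (q - 1 - Nat.log2 k)%nat with (S (q - 1 - S (Nat.log2 k))) by lia. reflexivity.
Qed.

Lemma lnum_leaf (q : nat) (m n : nat -> nat) (i : nat) :
  (1 <= q)%nat -> (2 ^ (q - 1) <= i < 2 ^ q)%nat -> lnum q m n i = m (2 ^ q - i)%nat.
Proof.
  intros Hq Hi. unfold lnum. rewrite (log2_leaf q i), Nat.sub_diag by auto. auto.
Qed.

Lemma update_eq (v : nat -> nat) (j i : nat) : update v j i j = i.
Proof. unfold update. rewrite Nat.eqb_refl; auto. Qed.

Lemma update_neq (v : nat -> nat) (j i k : nat) : k <> j -> update v j i k = v k.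
Proof. intros H. unfold update. apply Nat.eqb_neq in H; rewrite H; auto. Qed.

Lemma update_same (v : nat -> nat) (j : nat) : update v j (v j) = v.
Proof.
  apply functional_extensionality; intros k. unfold update.
  destruct (Nat.eqb_spec k j); subst; auto.
Qed.

Lemma lnum_update (q : nat) (m n : nat -> nat) (j i k : nat) : (j < k)%nat ->
  lnum q m (update n j i) k = lnum q m n k.
Proof.
  unfold lnum. generalize (q - 1 - Nat.log2 k)%nat.
  intros h; revert k; induction h as [|h IH]; intros k Hk; simpl; auto.
  rewrite update_neq, IH, IH by lia. auto.
Qed.

Lemma alpha_lamk (q : nat) (m n : nat -> nat) (k : nat) :
  (2 <= q)%nat -> (1 <= k < 2 ^ (q - 1))%nat ->
  alpha q m n k = (lnum q m n (2 * k) + lamk q (2 * k))%nat.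
Proof.
  intros Hq Hk. destruct (lamk_child q k Hq Hk) as [_ [_ ->]]. unfold alpha.
  pose proof (pow2_pos (q - 2 - Nat.log2 k)). lia.
Qed.

Lemma beta_lamk (q : nat) (m n : nat -> nat) (k : nat) :
  (2 <= q)%nat -> (1 <= k < 2 ^ (q - 1))%nat ->
  beta q m n k = (lnum q m n (2 * k + 1) + lamk q (2 * k))%nat.
Proof.
  intros Hq Hk. destruct (lamk_child q k Hq Hk) as [_ [_ ->]]. unfold beta.
  pose proof (pow2_pos (q - 2 - Nat.log2 k)). lia.
Qed.

(** * Box sums *)

(** One cutoff [N] for all indices, whatever the ranges of the sums in the statement; the summand is
    made to vanish outside those ranges. *)
Fixpoint wbox (N : nat) (js : list nat) (w : nat -> (nat -> nat) -> R)
    (G : (nat -> nat) -> R) (v : nat -> nat) : R :=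
  match js with
  | nil => G v
  | j :: js' => rsum N (fun i => w j (update v j i) * wbox N js' w G (update v j i))
  end.

Definition tree_weight (q : nat) (D : nat -> node_data) (m : nat -> nat)
    (k : nat) (n : nat -> nat) : R :=
  node_weight (D k) (alpha q m n k) (beta q m n k)
    (lnum q m n (2 * k)) (lnum q m n (2 * k + 1)) (n k).

Definition fseq (q : nat) (cf : nat -> R) (m n : nat -> nat) (i a : nat) : R :=
  cf i ^ a * kap (lamk q i) a (lnum q m n i).

(** [cf i] is the product of the factors [t] and [tau] along the path from the root to [i]; for Hopf
    coordinates it is [rho_i rho_i' / (r r')]. *)
Definition edge_weights (q : nat) (D : nat -> node_data) (cf : nat -> R) : Prop :=
  cf 1%nat = 1 /\ forall k, (1 <= k < 2 ^ (q - 1))%nat ->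
    cf (2 * k)%nat = cf k * nd_t (D k) /\ cf (2 * k + 1)%nat = cf k * nd_tau (D k).

(** In the heap numbering the nodes [k, ..., 2 k - 1] form a cut of the tree. Summing over [n_k]
    replaces [k] by its children [2 k] and [2 k + 1], which gives the next cut; the other nodes of
    the cut do not depend on [n_k]. *)
Lemma tree_step (q : nat) (D : nat -> node_data) (cf : nat -> R) (m n : nat -> nat)
    (k N s : nat) :
  (2 <= q)%nat -> (1 <= k < 2 ^ (q - 1))%nat -> (forall k, node_valid (D k)) ->
  edge_weights q D cf -> (s < N)%nat ->
  rsum N (fun i => tree_weight q D m k (update n k i)
    * cprod (map (fseq q cf m (update n k i)) (seq k k)) s)
  = cprod (map (fseq q cf m n) (seq (S k) (S k))) s.
Proof.
  intros Hq Hk HD [_ Hcf] HN. destruct (Hcf k Hk) as [Hc1 Hc2].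
  destruct (lamk_child q k Hq Hk) as [Hl1 [Hl2 _]].
  set (L1 := lnum q m n (2 * k)). set (L2 := lnum q m n (2 * k + 1)).
  set (lam := lamk q (2 * k)) in *.
  set (R := cprod (map (fseq q cf m n) (seq (S k) (k - 1)))).
  assert (ER : forall i, cprod (map (fseq q cf m (update n k i)) (seq (S k) (k - 1))) = R).
  { intros i. unfold R. f_equal. apply map_ext_in. intros j Hj. apply in_seq in Hj.
    apply functional_extensionality; intros a. unfold fseq. rewrite lnum_update by lia. auto. }
  rewrite (rsum_ext _ _ (fun i => conv (fun a => cf k ^ a *
     (node_weight (D k) (L1 + lam) (L2 + lam) L1 L2 i * kap (2 * lam + 1) a (2 * i + L1 + L2)))
     R s)).
  2:{ intros i Hi. replace (seq k k) with (k :: seq (S k) (k - 1))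
        by (destruct k; [lia|simpl; rewrite Nat.sub_0_r; auto]).
      cbn [map]. change (cprod (?f :: ?l)) with (conv f (cprod l)).
      rewrite ER, <- conv_scal_l. apply conv_ext; auto.
      intros a Ha. unfold tree_weight, fseq.
      rewrite alpha_lamk, beta_lamk, (lnum_node q m (update n k i) k),
        !lnum_update, update_eq by (auto; lia).
      fold L1 L2 lam. rewrite Hl1. ring. }
  rewrite <- conv_rsum_l.
  replace (seq (S k) (S k)) with (seq (S k) (k - 1) ++ (2 * k :: 2 * k + 1 :: nil))%nat%list.
  2:{ change (2 * k :: 2 * k + 1 :: nil)%nat with ((2 * k :: nil) ++ (2 * k + 1 :: nil))%nat%list.
      replace (2 * k :: nil)%nat with (seq (S k + (k - 1)) 1)
        by (apply (f_equal (fun x => x :: nil)); lia).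
      replace (2 * k + 1 :: nil)%nat with (seq (S k + (k - 1) + 1) 1)
        by (apply (f_equal (fun x => x :: nil)); lia).
      rewrite app_assoc, <- seq_app.
      replace (S k + (k - 1) + 1)%nat with (S k + (k - 1 + 1))%nat by lia.
      rewrite <- seq_app. f_equal. lia. }
  rewrite map_app, cprod_app. fold R. rewrite conv_comm. apply conv_ext; auto.
  intros a Ha. rewrite rsum_scal, node_sum by (auto; lia).
  cbn [map]. change (cprod (?f :: ?g :: nil)) with (conv f (conv g delta0)).
  rewrite <- conv_pow. apply conv_ext; intros b Hb.
  - unfold fseq. rewrite Hc1, Rpow_mult_distr. fold lam L1. ring.
  - rewrite conv_delta0_r. unfold fseq. rewrite Hc2, Rpow_mult_distr, Hl2. fold L2. ring.
Qed.

Lemma wbox_ext (N : nat) (js : list nat) (w w' : nat -> (nat -> nat) -> R)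
    (G G' : (nat -> nat) -> R) (v : nat -> nat) :
  (forall j v, w j v = w' j v) -> (forall v, G v = G' v) ->
  wbox N js w G v = wbox N js w' G' v.
Proof.
  intros Hw HG. revert v; induction js as [|j js IH]; intros v; simpl; auto.
  apply rsum_ext; intros. rewrite Hw, IH; auto.
Qed.

Lemma tree_nodes (q : nat) (D : nat -> node_data) (cf : nat -> R) (m n : nat -> nat)
    (k N s : nat) :
  (2 <= q)%nat -> (k < 2 ^ (q - 1))%nat -> (forall k, node_valid (D k)) ->
  edge_weights q D cf -> (s < N)%nat ->
  wbox N (rev (seq 1 k)) (tree_weight q D m) (fun n => kap (lamk q 1) s (lnum q m n 1)) n
  = cprod (map (fseq q cf m n) (seq (S k) (S k))) s.
Proof.
  intros Hq Hk HD Hcf HN. revert n; induction k as [|k IH]; intros n.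
  - simpl. change (cprod (?f :: nil)) with (conv f delta0).
    rewrite conv_delta0_r. unfold fseq. destruct Hcf as [-> _]. rewrite pow1. ring.
  - rewrite seq_S, rev_app_distr. simpl (rev (_ :: nil)). simpl app. simpl wbox.
    rewrite <- (tree_step q D cf m n (S k) N s) by (auto; lia).
    apply rsum_ext; intros i Hi. rewrite IH by lia. reflexivity.
Qed.

(** Each sum over some [m_i] is a Jacobi-Anger sum at the leaf [2^q - i] and leaves the coefficients
    of an exponential; [conv_expq] merges these exponentials into one. *)
Lemma tree_leaves (q : nat) (cf psi : nat -> R) (m n : nat -> nat) (j N s : nat) :
  (2 <= q)%nat -> (1 <= j <= 2 ^ (q - 1))%nat -> (s < N)%nat ->
  wbox N (seq (S j) (2 ^ (q - 1) - j))
    (fun i m => epsilon (m i) * cos (INR (m i) * psi i))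
    (fun m => cprod (map (fseq q cf m n) (seq (2 ^ (q - 1)) (2 ^ (q - 1)))) s) m
  = conv (expq (2 * rsum (2 ^ (q - 1) - j) (fun i =>
                      cf (2 ^ q - (S j + i))%nat * cos (psi (S j + i)%nat))))
      (cprod (map (fseq q cf m n) (seq (2 ^ q - j) j))) s.
Proof.
  intros Hq Hj HN.
  assert (Hd : (2 ^ q = 2 * 2 ^ (q - 1))%nat)
    by (rewrite <- Nat.pow_succ_r'; f_equal; lia).
  set (h := (2 ^ (q - 1))%nat) in *.
  remember (h - j)%nat as r eqn:Er. revert j Hj Er m.
  induction r as [|r IH]; intros j Hj Er m.
  - assert (j = h) by lia. subst j. simpl wbox. simpl rsum.
    replace (2 ^ q - h)%nat with h by lia. rewrite Rmult_0_r.
    rewrite (conv_ext _ delta0 _ (cprod (map (fseq q cf m n) (seq h h))))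
      by (auto; intros; apply expq_0).
    rewrite conv_delta0_l. auto.
  - change (seq (S j) (S r)) with (S j :: seq (S (S j)) r). simpl wbox.
    set (E := expq (2 * rsum r (fun i =>
                      cf (2 ^ q - (S (S j) + i))%nat * cos (psi (S (S j) + i)%nat)))).
    set (R := cprod (map (fseq q cf m n) (seq (2 ^ q - j) j))).
    set (c := cf (2 ^ q - S j)%nat).
    rewrite (rsum_ext _ _ (fun i => conv (fun a => c ^ a *
        (epsilon i * cos (INR i * psi (S j)) * kap 0 a i)) (conv E R) s)).
    2:{ intros i Hi. rewrite IH by lia. fold E. rewrite update_eq.
        replace (seq (2 ^ q - S j) (S j)) with ((2 ^ q - S j)%nat :: seq (2 ^ q - j) j)
          by (simpl; do 2 f_equal; lia).
        cbn [map]. change (cprod (?f :: ?l)) with (conv f (cprod l)).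
        replace (cprod (map (fseq q cf (update m (S j) i) n) (seq (2 ^ q - j) j))) with R.
        2:{ unfold R. f_equal. apply map_ext_in. intros t Ht. apply in_seq in Ht.
            apply functional_extensionality; intros a. unfold fseq.
            rewrite 2!lnum_leaf by (fold h; lia). rewrite update_neq by lia. auto. }
        rewrite <- conv_assoc.
        rewrite (conv_ext (conv E _) (conv (fseq q cf (update m (S j) i) n (2 ^ q - S j)) E)
                   R R) by (auto; intros; apply conv_comm).
        rewrite conv_assoc, <- conv_scal_l. apply conv_ext; auto.
        intros a Ha. unfold fseq. fold c.
        rewrite lnum_leaf, lamk_leaf by (fold h; lia).
        replace (2 ^ q - (2 ^ q - S j))%nat with (S j) by lia. rewrite update_eq. ring. }
    rewrite <- conv_rsum_l, <- conv_assoc.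
    apply conv_ext; auto. intros a Ha.
    rewrite (rsum_first r). rewrite Rmult_plus_distr_l, <- conv_expq.
    rewrite (conv_ext _ (expq (2 * (c * cos (psi (S j))))) E E).
    + apply conv_ext.
      * intros b Hb. unfold c. do 3 f_equal; rewrite Nat.add_0_r; auto.
      * intros b Hb. unfold E. do 2 f_equal. apply rsum_ext; intros i Hi.
        do 3 f_equal; lia.
    + intros b Hb. rewrite rsum_scal, cos_pow_kap by lia. unfold expq.
      replace (2 * (c * cos (psi (S j)))) with (c * (2 * cos (psi (S j)))) by ring.
      rewrite (Rpow_mult_distr c). unfold Rdiv; ring.
    + auto.
Qed.

(* Summing out all quantum numbers but m_1 leaves the m_1-th Fourier coefficient of a
   power of the cosine of the angle between x and x'. *)
Lemma tree_sum (q : nat) (D : nat -> node_data) (cf psi : nat -> R) (m n : nat -> nat)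
    (N s : nat) :
  (2 <= q)%nat -> (forall k, node_valid (D k)) -> edge_weights q D cf -> (s < N)%nat ->
  wbox N (seq 2 (2 ^ (q - 1) - 1)) (fun i m => epsilon (m i) * cos (INR (m i) * psi i))
    (fun m => wbox N (rev (seq 1 (2 ^ (q - 1) - 1))) (tree_weight q D m)
       (fun n => kap (lamk q 1) s (lnum q m n 1)) n) m
  = conv (expq (2 * rsum (2 ^ (q - 1) - 1) (fun i =>
                      cf (2 ^ q - (2 + i))%nat * cos (psi (2 + i)%nat))))
      (fun b => cf (2 ^ q - 1)%nat ^ b * kap 0 b (m 1%nat)) s.
Proof.
  intros Hq HD Hcf HN. pose proof (pow2_pos (q - 1)).
  assert (Hd : (2 ^ q = 2 * 2 ^ (q - 1))%nat)
    by (rewrite <- Nat.pow_succ_r'; f_equal; lia).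
  rewrite (wbox_ext _ _ _ (fun i m => epsilon (m i) * cos (INR (m i) * psi i)) _
    (fun m => cprod (map (fseq q cf m n) (seq (2 ^ (q - 1)) (2 ^ (q - 1)))) s)); auto.
  2:{ intros m'. rewrite (tree_nodes q D cf m' n) by (auto; lia).
      replace (S (2 ^ (q - 1) - 1)) with (2 ^ (q - 1))%nat by lia. auto. }
  rewrite tree_leaves by (auto; lia). apply conv_ext; [auto|]. intros a Ha.
  simpl seq. cbn [map]. change (cprod (?f :: nil)) with (conv f delta0).
  rewrite conv_delta0_r. unfold fseq. rewrite lnum_leaf, lamk_leaf by lia.
  replace (2 ^ q - (2 ^ q - 1))%nat with 1%nat by lia. auto.
Qed.

(** * Iterated series as limits of box sums *)

Lemma rser_complex (c0 : C) (f : nat -> R) (l : R) : rser f l ->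
  @is_series R_AbsRing C_R_NormedModule (fun i => (c0 * RtoC (f i))%C) (c0 * RtoC l)%C.
Proof.
  intros H. apply rser_is_series in H. unfold is_series in *.
  assert (E : forall r : R, @scal R_AbsRing C_R_NormedModule r c0 = (c0 * RtoC r)%C).
  { intros r. unfold scal; simpl. unfold prod_scal, scal; simpl. unfold mult; simpl.
    destruct c0 as [a b]. unfold Cmult, RtoC; simpl. f_equal; ring. }
  rewrite <- E.
  apply filterlim_ext with (fun n => @scal R_AbsRing C_R_NormedModule (sum_n f n) c0).
  - intros n. induction n as [|n IH].
    + rewrite 2!sum_O. apply E.
    + rewrite 2!sum_Sn, <- IH, <- E. apply (@scal_distr_r R_AbsRing C_R_NormedModule).
  - apply (filterlim_comp nat R C (sum_n f)
      (fun r => @scal R_AbsRing C_R_NormedModule r c0) eventually (locally l)).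
    + exact H.
    + apply (@filterlim_scal_l R_AbsRing C_R_NormedModule l c0).
Qed.

Lemma rsum_bound_lim (b : nat -> nat -> R) (A : nat -> R) (M : nat) (B : R) :
  (forall i, is_lim_seq (b i) (A i)) ->
  (forall N, (M <= N)%nat -> rsum M (fun i => b i N) <= B) -> rsum M A <= B.
Proof.
  intros HA HB.
  apply is_lim_seq_bound with (fun n => rsum M (fun i => b i (n + M)%nat)).
  - intros n. apply HB. lia.
  - clear HB. apply (is_lim_seq_incr_n (fun n => rsum M (fun i => b i n))).
    induction M as [|M IH]; simpl; [apply is_lim_seq_const|].
    apply is_lim_seq_plus'; auto.
Qed.

Lemma rsum_lim (a : nat -> nat -> R) (s : nat -> R) (M : nat) :
  (forall i, is_lim_seq (a i) (s i)) -> is_lim_seq (fun N => rsum M (fun i => a i N)) (rsum M s).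
Proof.
  intros H. induction M as [|M IH]; simpl; [apply is_lim_seq_const|].
  apply is_lim_seq_plus'; auto.
Qed.

(** Tannery's theorem with majorants that may grow with the cutoff: bounded diagonal sums are what
    boxes with one common cutoff provide. The limits of the increasing [b i] are the summable
    majorant. *)
Lemma tannery (a b : nat -> nat -> R) (s : nat -> R) (B : R) :
  (forall i, is_lim_seq (a i) (s i)) ->
  (forall i N, Rabs (a i N) <= b i N) -> (forall i N, b i N <= b i (S N)) ->
  (forall N, rsum N (fun i => b i N) <= B) ->
  exists l, rser s l /\ is_lim_seq (fun N => rsum N (fun i => a i N)) l.
Proof.
  intros Hs Hab Hmono HB.
  assert (Hb0 : forall i N, 0 <= b i N)
    by (intros; eapply Rle_trans; [apply Rabs_pos|apply Hab]).
  assert (Hmono' : forall i N k, b i N <= b i (N + k)%nat).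
  { intros i N k. induction k as [|k IH]; [rewrite Nat.add_0_r; lra|].
    rewrite Nat.add_succ_r. eapply Rle_trans; [apply IH|apply Hmono]. }
  assert (Hbb : forall i N, b i N <= B).
  { intros i N. apply Rle_trans with (b i (N + S i)%nat); [apply Hmono'|].
    eapply Rle_trans; [|apply (HB (N + S i)%nat)].
    apply (rsum_term_le (N + S i) i (fun t => b t (N + S i)%nat)); [lia|auto]. }
  set (A := fun i => real (Lim_seq (b i))).
  assert (HA : forall i, is_lim_seq (b i) (A i)).
  { intros i. apply Lim_seq_correct'. apply ex_finite_lim_seq_incr with B; auto. }
  assert (HbA : forall i N, b i N <= A i).
  { intros i N. assert (H := HA i). apply is_lim_seq_incr_n with (N := N) in H.
    apply (is_lim_seq_le (fun _ => b i N) (fun n => b i (n + N)%nat) (b i N) (A i)); auto.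
    - intros n. rewrite Nat.add_comm. apply Hmono'.
    - apply is_lim_seq_const. }
  assert (HAB : forall M, rsum M A <= B).
  { intros M. apply (rsum_bound_lim b); auto. intros N HN.
    eapply Rle_trans; [|apply (HB N)]. apply rsum_pos_le; auto. }
  assert (HsA : forall i, Rabs (s i) <= A i).
  { intros i. apply is_lim_seq_bound with (fun n => Rabs (a i n)).
    - intros n. eapply Rle_trans; [apply Hab|apply HbA].
    - apply (is_lim_seq_abs _ (s i)); auto. }
  assert (HA0 : forall i, 0 <= A i)
    by (intros; eapply Rle_trans; [apply Rabs_pos|apply HsA]).
  destruct (rser_nonneg_ex A B HA0 HAB) as [SA HSA].
  destruct (rser_abs_ex s SA) as [l Hl].
  { intros N. apply Rle_trans with (rsum N A); [apply rsum_le; auto|].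
    apply rser_partial_le; auto. }
  exists l. split; auto.
  apply is_lim_seq_spec. intros eps.
  assert (He : 0 < eps / 4) by (pose proof (cond_pos eps); lra).
  assert (HSA' := HSA). apply is_lim_seq_spec in HSA'.
  destruct (HSA' (mkposreal _ He)) as [M HM]. specialize (HM M (Nat.le_refl M)). simpl in HM.
  assert (HSM : SA - rsum M A < eps / 4) by (apply Rabs_def2 in HM; lra).
  assert (Hlim := rsum_lim a s M Hs). apply is_lim_seq_spec in Hlim.
  destruct (Hlim (mkposreal _ He)) as [N0 HN0]. simpl in HN0.
  exists (N0 + M)%nat. intros N HN. specialize (HN0 N ltac:(lia)).
  assert (H1 : Rabs (l - rsum M s) <= SA - rsum M A) by (apply rser_tail_le; auto).
  assert (H2 : Rabs (rsum N (fun i => a i N) - rsum M (fun i => a i N)) <= rsum N A - rsum M A).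
  { assert (H := rsum_diff_abs (fun i => a i N) A M (N - M)).
    replace (M + (N - M))%nat with N in H by lia. apply H.
    intros i. eapply Rle_trans; [apply Hab|apply HbA]. }
  assert (H3 : rsum N A <= SA) by (apply rser_partial_le; auto).
  replace (rsum N (fun i => a i N) - l)
    with ((rsum N (fun i => a i N) - rsum M (fun i => a i N))
          + (rsum M (fun i => a i N) - rsum M s) + - (l - rsum M s)) by ring.
  eapply Rle_lt_trans; [apply Rabs_triang|]. rewrite Rabs_Ropp.
  eapply Rle_lt_trans; [apply Rplus_le_compat_r, Rabs_triang|]. lra.
Qed.

Definition wabs (w : nat -> (nat -> nat) -> R) (j : nat) (v : nat -> nat) : R := Rabs (w j v).

Lemma wbox_nonneg (N : nat) (js : list nat) (w : nat -> (nat -> nat) -> R)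
    (G : (nat -> nat) -> R) (v : nat -> nat) :
  (forall j v, 0 <= w j v) -> (forall v, 0 <= G v) -> 0 <= wbox N js w G v.
Proof.
  intros Hw HG. revert v; induction js as [|j js IH]; intros v; simpl; auto.
  apply rsum_nonneg; intros. apply Rmult_le_pos; auto.
Qed.

Lemma wbox_le (N N' : nat) (js : list nat) (w w' : nat -> (nat -> nat) -> R)
    (G G' : (nat -> nat) -> R) (v : nat -> nat) :
  (N <= N')%nat -> (forall j v, Rabs (w j v) <= w' j v) ->
  (forall v, Rabs (G v) <= G' v) ->
  Rabs (wbox N js w G v) <= wbox N' js w' G' v.
Proof.
  intros HN Hw HG.
  assert (Hw0 : forall j v, 0 <= w' j v)
    by (intros; eapply Rle_trans; [apply Rabs_pos|apply Hw]).
  assert (HG0 : forall v, 0 <= G' v)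
    by (intros; eapply Rle_trans; [apply Rabs_pos|apply HG]).
  revert v; induction js as [|j js IH]; intros v; simpl; auto.
  eapply Rle_trans; [apply rsum_Rabs|].
  apply Rle_trans with (rsum N (fun i => w' j (update v j i) * wbox N' js w' G' (update v j i))).
  - apply rsum_le; intros i Hi. rewrite Rabs_mult.
    apply Rmult_le_compat; auto using Rabs_pos.
  - apply rsum_pos_le; auto. intros i. apply Rmult_le_pos; auto.
    apply wbox_nonneg; auto.
Qed.

(** What each level of an iterated series needs: bounded absolute boxes, and inner boxes that vanish
    below the lower limit, so that boxes starting at [0] compute series starting at [lo]. The
    requirement descends through all index values, also those below [lo], whereas [good] descends
    only through those reached by the series. *)
Fixpoint hsum (js : list nat) (lo : nat -> (nat -> nat) -> nat)
    (w : nat -> (nat -> nat) -> R) (Gb Ga : nat -> (nat -> nat) -> R)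
    (Hb : (nat -> nat) -> Prop) (v : nat -> nat) : Prop :=
  match js with
  | nil => Hb v
  | j :: js' =>
      (exists B, forall N, wbox N (j :: js') (wabs w) (Ga N) v <= B)
      /\ (forall N i, (i < lo j v)%nat -> wbox N js' w (Gb N) (update v j i) = 0)
      /\ (forall i, hsum js' lo w Gb Ga Hb (update v j i))
  end.

Fixpoint good (js : list nat) (lo : nat -> (nat -> nat) -> nat)
    (Rb : (nat -> nat) -> Prop) (v : nat -> nat) : Prop :=
  match js with
  | nil => Rb v
  | j :: js' => forall i, (lo j v <= i)%nat -> good js' lo Rb (update v j i)
  end.

(** The summands [Gb N] and [Ga N] may depend on the cutoff, so that a box over the node indices can
    be the summand of a box over the leaf indices. *)
Lemma multiseries_box (js : list nat) (lo : nat -> (nat -> nat) -> nat)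
    (w : nat -> (nat -> nat) -> R) (F : (nat -> nat) -> C -> Prop) (c0 : C)
    (Gb Ga : nat -> (nat -> nat) -> R) (Hb Rb : (nat -> nat) -> Prop) (v : nat -> nat) :
  (forall v, Hb v -> exists s : R, is_lim_seq (fun N => Gb N v) s
                               /\ (Rb v -> F v (c0 * RtoC s)%C)) ->
  (forall N v, Rabs (Gb N v) <= Ga N v) -> (forall N v, Ga N v <= Ga (S N) v) ->
  hsum js lo w Gb Ga Hb v ->
  exists s : R, is_lim_seq (fun N => wbox N js w (Gb N) v) s
            /\ (good js lo Rb v -> is_multiseries js lo w F v (c0 * RtoC s)%C).
Proof.
  intros Hbase Hdom Hmono. revert v; induction js as [|j js IH]; intros v H.
  - apply Hbase; auto.
  - destruct H as [[B HB] [Hlo H]].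
    assert (Ga0 : forall N v, 0 <= Ga N v)
      by (intros; eapply Rle_trans; [apply Rabs_pos|apply Hdom]).
    set (s := fun i => real (Lim_seq (fun N => wbox N js w (Gb N) (update v j i)))).
    assert (Hs : forall i, is_lim_seq (fun N => wbox N js w (Gb N) (update v j i)) (s i)
       /\ (good js lo Rb (update v j i) ->
           is_multiseries js lo w F (update v j i) (c0 * RtoC (s i))%C)).
    { intros i. destruct (IH (update v j i) (H i)) as [t [Ht1 Ht2]].
      assert (E : s i = t) by (unfold s; apply is_lim_seq_unique in Ht1; rewrite Ht1; auto).
      rewrite E. split; [exact Ht1|exact Ht2]. }
    destruct (tannery (fun i N => w j (update v j i) * wbox N js w (Gb N) (update v j i))
      (fun i N => wabs w j (update v j i) * wbox N js (wabs w) (Ga N) (update v j i))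
      (fun i => w j (update v j i) * s i) B) as [l [Hl1 Hl2]].
    + intros i. apply (is_lim_seq_scal_l _ (w j (update v j i)) (s i)). apply Hs.
    + intros i N. rewrite Rabs_mult. apply Rmult_le_compat_l; [apply Rabs_pos|].
      apply wbox_le; auto. intros; unfold wabs; lra.
    + intros i N. apply Rmult_le_compat_l; [apply Rabs_pos|].
      eapply Rle_trans; [apply Rle_abs|]. apply wbox_le; [lia| |].
      * intros; unfold wabs; rewrite Rabs_Rabsolu; lra.
      * intros u. rewrite Rabs_right; [auto|apply Rle_ge; auto].
    + exact HB.
    + exists l. split; [exact Hl2|]. intros Hg. simpl in Hg. simpl.
      exists (fun i => (c0 * RtoC (s (lo j v + i)%nat))%C). split.
      * intros i. apply Hs. apply Hg. lia.
      * assert (E0 : forall i, (i < lo j v)%nat -> w j (update v j i) * s i = 0).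
        { intros i Hi. replace (s i) with 0; [ring|].
          apply (is_lim_seq_unique2 (fun N => wbox N js w (Gb N) (update v j i))).
          - apply is_lim_seq_ext with (fun _ => 0); [intros; symmetry; auto|].
            apply is_lim_seq_const.
          - apply Hs. }
        apply (rser_shift _ _ _ E0) in Hl1. apply (rser_complex c0) in Hl1.
        eapply is_series_ext; [|exact Hl1].
        intros i. cbv beta. rewrite RtoC_mult.
        match goal with |- ?a = ?b => change (@eq C a b) end. ring.
Qed.

Lemma wbox_lin (N : nat) (js : list nat) (w : nat -> (nat -> nat) -> R)
    (a b : R) (G G' : (nat -> nat) -> R) (v : nat -> nat) :
  wbox N js w (fun v => a * G v + b * G' v) v = a * wbox N js w G v + b * wbox N js w G' v.
Proof.
  revert v; induction js as [|j js IH]; intros v; simpl; auto.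
  rewrite <- 2!rsum_scal, <- rsum_plus. apply rsum_ext; intros. rewrite IH; ring.
Qed.

Lemma rsum_rser (M : nat) (f : nat -> nat -> R) (l : nat -> R) :
  (forall i, rser (f i) (l i)) -> rser (fun s => rsum M (fun i => f i s)) (rsum M l).
Proof.
  intros H. induction M as [|M IH]; simpl.
  - apply is_lim_seq_ext with (fun _ => 0); [|apply is_lim_seq_const].
    intros; symmetry; apply rsum_0; auto.
  - apply rser_plus; auto.
Qed.

Lemma wbox_rser (N : nat) (js : list nat) (w : nat -> (nat -> nat) -> R)
    (be : nat -> R) (G : nat -> (nat -> nat) -> R) (L : (nat -> nat) -> R) (v : nat -> nat) :
  (forall v, rser (fun s => be s * G s v) (L v)) ->
  rser (fun s => be s * wbox N js w (G s) v) (wbox N js w L v).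
Proof.
  intros H. revert v; induction js as [|j js IH]; intros v; simpl; auto.
  eapply rser_ext; [|apply (rsum_rser N (fun i s => w j (update v j i) *
    (be s * wbox N js w (G s) (update v j i)))); intros i; apply rser_scal, IH].
  intros s. cbv beta. rewrite <- rsum_scal. apply rsum_ext; intros; ring.
Qed.

(* AM-GM for products of weights; the accumulated factors a, a1, a2 make the induction
   go through although some weights may vanish. *)
Lemma wbox_amgm (N : nat) (js : list nat) (w w1 w2 : nat -> (nat -> nat) -> R)
    (G : (nat -> nat) -> R) (v : nat -> nat) (a a1 a2 : R) :
  (forall j v, 0 <= w1 j v) -> (forall j v, 0 <= w2 j v) ->
  (forall j v, w j v ^ 2 <= w1 j v * w2 j v) -> (forall v, 0 <= G v) ->
  0 <= a1 -> 0 <= a2 -> a ^ 2 <= a1 * a2 ->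
  a * wbox N js (wabs w) G v <= (a1 * wbox N js w1 G v + a2 * wbox N js w2 G v) / 2.
Proof.
  intros H1 H2 H12 HG. revert a a1 a2 v;
    induction js as [|j js IH]; intros a a1 a2 v Ha1 Ha2 Ha; simpl.
  - assert (a <= (a1 + a2) / 2).
    { apply Rnot_lt_le. intros Hlt. pose proof (pow2_ge_0 (a1 - a2)).
      assert (((a1 + a2) / 2) ^ 2 < a ^ 2) by nra. nra. }
    specialize (HG v). replace ((a1 * G v + a2 * G v) / 2) with ((a1 + a2) / 2 * G v) by field.
    apply Rmult_le_compat_r; auto.
  - rewrite <- 3!rsum_scal. unfold Rdiv. rewrite <- rsum_plus, Rmult_comm, <- rsum_scal.
    apply rsum_le; intros i Hi. set (u := update v j i).
    specialize (IH (a * Rabs (w j u)) (a1 * w1 j u) (a2 * w2 j u) u).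
    unfold wabs at 1.
    apply Rle_trans with ((a1 * w1 j u * wbox N js w1 G u + a2 * w2 j u * wbox N js w2 G u) / 2).
    + rewrite <- Rmult_assoc. apply IH; try (apply Rmult_le_pos; auto).
      rewrite Rpow_mult_distr, pow2_abs.
      replace (a1 * w1 j u * (a2 * w2 j u)) with ((a1 * a2) * (w1 j u * w2 j u)) by ring.
      apply Rmult_le_compat; auto; apply pow2_ge_0.
    + right. field.
Qed.

(** Of every outer sum of nonnegative terms only the term at the value prescribed by [v] is kept. *)
Lemma wbox_outer (N : nat) (pre suf : list nat) (w : nat -> (nat -> nat) -> R)
    (G : (nat -> nat) -> R) (v : nat -> nat) :
  (forall j v, 0 <= w j v) -> (forall v, 0 <= G v) ->
  (forall j, In j pre -> (v j < N)%nat) ->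
  fold_right (fun j c => w j v * c) 1 pre * wbox N suf w G v <= wbox N (pre ++ suf)%list w G v.
Proof.
  intros Hw HG. induction pre as [|j pre IH]; intros Hv; simpl; [lra|].
  apply Rle_trans with (w j v * wbox N (pre ++ suf)%list w G v).
  - rewrite Rmult_assoc. apply Rmult_le_compat_l; auto. apply IH. intros; apply Hv; simpl; auto.
  - assert (H := rsum_term_le N (v j)
      (fun i => w j (update v j i) * wbox N (pre ++ suf)%list w G (update v j i))).
    cbv beta in H. rewrite update_same in H. apply H.
    + apply Hv; simpl; auto.
    + intros i. apply Rmult_le_pos; auto. apply wbox_nonneg; auto.
Qed.

(* Bounds on complete box sums pass to inner ones once the outer weights are positive. *)
Lemma wbox_suffix_bound (pre suf : list nat) (w : nat -> (nat -> nat) -> R)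
    (G : nat -> (nat -> nat) -> R) (v : nat -> nat) (B : R) :
  (forall j v, 0 <= w j v) -> (forall j, In j pre -> 0 < w j v) ->
  (forall N v, 0 <= G N v) -> (forall N v, G N v <= G (S N) v) ->
  (forall N, wbox N (pre ++ suf)%list w (G N) v <= B) ->
  exists B', forall N, wbox N suf w (G N) v <= B'.
Proof.
  intros Hw Hpos HG Hm HB.
  set (c := fold_right (fun j c => w j v * c) 1 pre).
  assert (Hc : 0 < c).
  { unfold c. clear HB c. induction pre as [|j pre IH]; simpl; [lra|].
    apply Rmult_lt_0_compat; [apply Hpos; simpl; auto|].
    apply IH. intros; apply Hpos; simpl; auto. }
  assert (HN0 : exists N0, forall j, In j pre -> (v j < N0)%nat).
  { clear - pre. induction pre as [|j pre [N0 IH]]; [exists 0%nat; intros j []|].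
    exists (N0 + S (v j))%nat. intros k [->|Hk]; [lia|]. specialize (IH k Hk). lia. }
  destruct HN0 as [N0 HN0].
  assert (Hm' : forall N k v, G N v <= G (N + k)%nat v).
  { intros N k u. induction k as [|k IH]; [rewrite Nat.add_0_r; lra|].
    rewrite Nat.add_succ_r. eapply Rle_trans; [apply IH|apply Hm]. }
  exists (B / c). intros N.
  apply Rle_trans with (wbox (N + N0) suf w (G (N + N0)%nat) v).
  - eapply Rle_trans; [apply Rle_abs|]. apply wbox_le; [lia| |].
    + intros; rewrite Rabs_right; [lra|apply Rle_ge; auto].
    + intros; rewrite Rabs_right; [apply Hm'|apply Rle_ge; auto].
  - apply (Rmult_le_reg_l c); auto. replace (c * (B / c)) with B by (field; lra).
    eapply Rle_trans; [|apply (HB (N + N0)%nat)].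
    apply wbox_outer; auto. intros j Hj. specialize (HN0 j Hj). lia.
Qed.

(** * Bounds on tree sums *)

Definition act_data (th th' : R) : node_data :=
  {| nd_c := cos th ^ 2; nd_e := sin th ^ 2; nd_c' := cos th' ^ 2; nd_e' := sin th' ^ 2;
     nd_t := cos th * cos th'; nd_tau := sin th * sin th' |}.

(* A point outside the real domain at which every weight is strictly positive. *)
Definition virt_data (eps : R) : node_data :=
  {| nd_c := 1 + eps; nd_e := - eps; nd_c' := 1 + eps; nd_e' := - eps;
     nd_t := 1 + eps; nd_tau := eps |}.

Lemma sin_cos_sq (t : R) : cos t ^ 2 + sin t ^ 2 = 1.
Proof. rewrite <- (sin2_cos2 t). unfold Rsqr. ring. Qed.

Lemma act_valid (th th' : R) : node_valid (act_data th th').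
Proof. repeat split; simpl nd_c; simpl nd_e; simpl nd_c'; simpl nd_e';
  try apply sin_cos_sq; simpl; ring. Qed.

Lemma virt_valid (eps : R) : node_valid (virt_data eps).
Proof. repeat split; simpl; ring. Qed.

Lemma jnorm_pos (al be n : nat) : 0 < jnorm al be n.
Proof.
  unfold jnorm. repeat apply Rmult_lt_0_compat; try apply rfact_pos.
  apply lt_0_INR. lia.
Qed.

Lemma node_weight_diag_nonneg (th : R) (al be L1 L2 n : nat) :
  0 <= node_weight (act_data th th) al be L1 L2 n.
Proof.
  unfold node_weight. simpl nd_t. simpl nd_tau. simpl nd_c. simpl nd_e. simpl nd_c'. simpl nd_e'.
  set (J := jhom _ _ _ _ _).
  pose proof (jnorm_pos al be n).
  assert (0 <= (cos th * cos th) ^ L1) by (apply pow_le; nra).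
  assert (0 <= (sin th * sin th) ^ L2) by (apply pow_le; nra).
  rewrite Rmult_assoc. apply Rmult_le_pos; [|nra].
  apply Rmult_le_pos; [apply Rmult_le_pos|]; auto; lra.
Qed.

Lemma node_weight_act_sq (th th' : R) (al be L1 L2 n : nat) :
  node_weight (act_data th th') al be L1 L2 n ^ 2
  = node_weight (act_data th th) al be L1 L2 n * node_weight (act_data th' th') al be L1 L2 n.
Proof.
  unfold node_weight. simpl nd_t. simpl nd_tau. simpl nd_c. simpl nd_e. simpl nd_c'. simpl nd_e'.
  rewrite !Rpow_mult_distr. ring.
Qed.

(** The coefficients of [hharm] alternate in sign and so do the powers of [e = - eps]; hence all
    terms of [jhom] are positive. *)
Lemma node_weight_virt_pos (eps : R) (al be L1 L2 n : nat) : 0 < eps ->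
  0 < node_weight (virt_data eps) al be L1 L2 n.
Proof.
  intros He. unfold node_weight. simpl nd_t. simpl nd_tau. simpl nd_c. simpl nd_e.
  simpl nd_c'. simpl nd_e'.
  assert (HJ : 0 < jhom al be n (1 + eps) (- eps)).
  { unfold jhom, hev, hharm.
    assert (Ht : forall b, (b <= n)%nat ->
      0 < hker al be 1 (-1) n b * ((1 + eps) ^ (n - b) * (- eps) ^ b)).
    { intros b Hb. rewrite hker_le by auto.
      replace (- eps) with (-1 * eps) by ring. rewrite Rpow_mult_distr, pow1.
      match goal with |- 0 < ?x => replace x with
        (((-1) ^ b * (-1) ^ b) * ((1 + eps) ^ (n - b) * eps ^ b)
         / (rfact (n - b) * rfact (al + (n - b)) * (rfact b * rfact (be + b))))
        by (unfold Rdiv; ring) end.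
      rewrite pow_m1_sq. apply Rdiv_lt_0_compat.
      - repeat apply Rmult_lt_0_compat; try apply pow_lt; lra.
      - repeat apply Rmult_lt_0_compat; apply rfact_pos. }
    rewrite rsum_first. apply Rplus_lt_le_0_compat; [apply Ht; lia|].
    apply rsum_nonneg; intros i Hi. left. apply Ht. lia. }
  assert (H1 : 0 < (1 + eps) ^ L1) by (apply pow_lt; lra).
  assert (H2 : 0 < eps ^ L2) by (apply pow_lt; lra).
  pose proof (jnorm_pos al be n).
  do 4 (apply Rmult_lt_0_compat; auto).
Qed.

(** The product along the path from [i] up to the root, by halving; the fuel makes the recursion
    structural, and [i] itself is enough of it. *)
Fixpoint cfd_aux (D : nat -> node_data) (fuel i : nat) : R :=
  match fuel with
  | O => 1
  | S f => if Nat.leb i 1 then 1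
           else cfd_aux D f (Nat.div2 i)
                * (if Nat.even i then nd_t (D (Nat.div2 i)) else nd_tau (D (Nat.div2 i)))
  end.

Definition cfd (D : nat -> node_data) (i : nat) : R := cfd_aux D i i.

Lemma cfd_aux_fuel (D : nat -> node_data) (f i : nat) : (i <= f)%nat ->
  cfd_aux D f i = cfd D i.
Proof.
  unfold cfd. revert f; induction i as [i IH] using lt_wf_ind; intros f Hf.
  destruct f as [|f]; [replace i with O by lia; auto|].
  destruct i as [|i]; [reflexivity|].
  simpl. destruct i as [|i]; [reflexivity|].
  change (Nat.leb (S (S i)) 1) with false. cbv iota.
  assert (Nat.div2 i <= i)%nat by (apply Nat.div2_decr; lia).
  rewrite (IH (S (Nat.div2 i))) by lia.
  rewrite (IH (S (Nat.div2 i)) ltac:(lia) (S i)) by lia. reflexivity.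
Qed.

Lemma cfd_edges (q : nat) (D : nat -> node_data) : edge_weights q D (cfd D).
Proof.
  split; [reflexivity|]. intros k [Hk _].
  assert (E : forall i, (2 <= i)%nat -> cfd D i = cfd D (Nat.div2 i)
     * (if Nat.even i then nd_t (D (Nat.div2 i)) else nd_tau (D (Nat.div2 i)))).
  { intros i Hi. unfold cfd at 1. destruct i as [|[|i]]; try lia.
    change (cfd_aux D (S (S i)) (S (S i))) with (cfd_aux D (S i) (S (Nat.div2 i))
      * (if Nat.even i then nd_t (D (S (Nat.div2 i))) else nd_tau (D (S (Nat.div2 i))))).
    assert (Nat.div2 i <= i)%nat by (apply Nat.div2_decr; lia).
    rewrite cfd_aux_fuel by lia. reflexivity. }
  split; rewrite E by lia.
  - rewrite Nat.div2_double, Nat.even_mul. reflexivity.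
  - replace (2 * k + 1)%nat with (S (2 * k)) by lia.
    rewrite Nat.div2_succ_double, Nat.even_succ, Nat.odd_mul. reflexivity.
Qed.

Lemma cfd_nonneg (D : nat -> node_data) (i : nat) :
  (forall k, 0 <= nd_t (D k)) -> (forall k, 0 <= nd_tau (D k)) -> 0 <= cfd D i.
Proof.
  intros H1 H2. unfold cfd. generalize i at 1. intros f; revert i.
  induction f as [|f IH]; intros i; simpl; [lra|].
  destruct (Nat.leb i 1); [lra|]. apply Rmult_le_pos; auto. destruct (Nat.even i); auto.
Qed.

Lemma frontier_step (f : nat -> R) (k : nat) :
  rsum (S (S k)) (fun i => f (S (S k) + i)%nat)
  = rsum (S k) (fun i => f (S k + i)%nat) - f (S k) + f (2 * S k)%nat + f (2 * S k + 1)%nat.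
Proof.
  rewrite 2!rsum_S, (rsum_first k (fun i => f (S k + i)%nat)).
  rewrite (rsum_ext k (fun i => f (S (S k) + i)%nat) (fun i => f (S k + S i)%nat))
    by (intros; f_equal; lia).
  replace (S (S k) + k)%nat with (2 * S k)%nat by lia.
  replace (S (S k) + S k)%nat with (2 * S k + 1)%nat by lia.
  rewrite Nat.add_0_r. ring.
Qed.

(** Expanding the nodes [1, ..., h] in this order turns the root into the cut [h + 1, ..., 2 h + 1].
    The total quantum number and the norm in Hopf coordinates are both instances. *)
Lemma frontier_sum (f g : nat -> R) (h : nat) :
  (forall k, (1 <= k < S h)%nat -> f k = g k + f (2 * k)%nat + f (2 * k + 1)%nat) ->
  f 1%nat = rsum h (fun k => g (S k)) + rsum (S h) (fun i => f (S h + i)%nat).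
Proof.
  induction h as [|h IH]; intros H; [simpl; ring|].
  rewrite IH by (intros; apply H; lia).
  rewrite frontier_step, (rsum_S h (fun k => g (S k))), (H (S h)) by lia. ring.
Qed.

(** Replacing a node by its children multiplies the total of a cut by at most [Y], since all entries
    are nonnegative; [2^(q-1) - 1] replacements lead to the leaves. *)
Lemma cfd_leaf_sum (q : nat) (D : nat -> node_data) (Y : R) :
  (2 <= q)%nat -> 1 <= Y -> (forall k, 0 <= nd_t (D k)) -> (forall k, 0 <= nd_tau (D k)) ->
  (forall k, nd_t (D k) + nd_tau (D k) <= Y) ->
  rsum (2 ^ (q - 1)) (fun i => cfd D (2 ^ (q - 1) + i)%nat) <= Y ^ (2 ^ (q - 1) - 1).
Proof.
  intros Hq HY H1 H2 H3. pose proof (pow2_pos (q - 1)).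
  destruct (cfd_edges q D) as [E1 E2].
  assert (G : forall k, (k < 2 ^ (q - 1))%nat ->
    rsum (S k) (fun i => cfd D (S k + i)%nat) <= Y ^ k).
  { induction k as [|k IH]; intros Hk.
    - simpl. rewrite E1. lra.
    - rewrite frontier_step. destruct (E2 (S k) ltac:(lia)) as [-> ->].
      specialize (IH ltac:(lia)).
      assert (Hc : 0 <= cfd D (S k)) by (apply cfd_nonneg; auto).
      assert (Hs : cfd D (S k) <= rsum (S k) (fun i => cfd D (S k + i)%nat)).
      { assert (T := rsum_term_le (S k) 0 (fun i => cfd D (S k + i)%nat) ltac:(lia)).
        cbv beta in T. rewrite Nat.add_0_r in T. apply T. intros; apply cfd_nonneg; auto. }
      specialize (H3 (S k)). simpl pow.
      apply Rle_trans with (Y * rsum (S k) (fun i => cfd D (S k + i)%nat)); [|nra].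
      set (S0 := rsum (S k) _) in *. nra. }
  specialize (G (2 ^ (q - 1) - 1)%nat ltac:(lia)).
  replace (S (2 ^ (q - 1) - 1)) with (2 ^ (q - 1))%nat in G by lia. exact G.
Qed.

Lemma leaf_sum_split (f : nat -> R) (h : nat) : (1 <= h)%nat ->
  rsum h (fun i => f (h + i)%nat)
  = rsum (h - 1) (fun i => f (2 * h - (2 + i))%nat) + f (2 * h - 1)%nat.
Proof.
  intros Hh. destruct h as [|h]; [lia|]. rewrite rsum_S.
  replace (S h - 1)%nat with h by lia.
  f_equal; [|f_equal; lia]. rewrite rsum_rev. apply rsum_ext; intros i Hi. f_equal. lia.
Qed.

(** At angle [0] the sum in [cos_pow_kap] has nonnegative terms, and one of them is at least
    [kap 0 s m]. *)
Lemma kap_le (s m : nat) : kap 0 s m <= expq 2 s.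
Proof.
  assert (H := cos_pow_kap s (S (s + m)) 0 ltac:(lia)).
  rewrite cos_0, Rmult_1_r in H. unfold expq. rewrite <- H.
  apply Rle_trans with (epsilon m * cos (INR m * 0) * kap 0 s m).
  - rewrite Rmult_0_r, cos_0. pose proof (epsilon_ge_1 m). pose proof (kap_nonneg 0 s m). nra.
  - apply (rsum_term_le (S (s + m)) m (fun m => epsilon m * cos (INR m * 0) * kap 0 s m)).
    + lia.
    + intros i. rewrite Rmult_0_r, cos_0. pose proof (epsilon_ge_1 i).
      pose proof (kap_nonneg 0 s i). nra.
Qed.

Lemma rfact_le (n k : nat) : rfact n <= rfact (n + k).
Proof. apply le_INR, fact_le. lia. Qed.

Lemma kap_lam_le (lam s L : nat) : kap lam s L <= kap 0 s L.
Proof.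
  destruct (parity_cases s L) as [[j ->]|H].
  - rewrite 2!kap_eq, Nat.add_0_r. apply Rinv_le_contravar.
    + apply Rmult_lt_0_compat; apply rfact_pos.
    + apply Rmult_le_compat_l; [left; apply rfact_pos|apply rfact_le].
  - rewrite 2!kap_0; auto; lra.
Qed.

Lemma expq_nonneg (x : R) (s : nat) : 0 <= x -> 0 <= expq x s.
Proof.
  intros H. unfold expq. apply Rmult_le_pos; [apply pow_le; auto|].
  left; apply Rinv_0_lt_compat, rfact_pos.
Qed.

Definition msum (q : nat) (cf psi : nat -> R) (m1 s : nat) : R :=
  conv (expq (2 * rsum (2 ^ (q - 1) - 1) (fun i =>
                      cf (2 ^ q - (2 + i))%nat * cos (psi (2 + i)%nat))))
      (fun b => cf (2 ^ q - 1)%nat ^ b * kap 0 b m1) s.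

Lemma msum_bound (q : nat) (cf : nat -> R) (m1 s : nat) (U : R) :
  (2 <= q)%nat -> (forall i, 0 <= cf i) ->
  rsum (2 ^ (q - 1)) (fun i => cf (2 ^ (q - 1) + i)%nat) <= U ->
  0 <= msum q cf (fun _ => 0) m1 s <= expq (2 * U) s.
Proof.
  intros Hq Hcf HU. pose proof (pow2_pos (q - 1)).
  assert (Hd : (2 ^ q = 2 * 2 ^ (q - 1))%nat)
    by (rewrite <- Nat.pow_succ_r'; f_equal; lia).
  rewrite leaf_sum_split, <- Hd in HU by auto.
  unfold msum.
  rewrite (rsum_ext _ _ (fun i => cf (2 ^ q - (2 + i))%nat)) by (intros; rewrite cos_0; ring).
  set (v := rsum _ _) in *. set (k := cf (2 ^ q - 1)%nat) in *.
  assert (Hv : 0 <= v) by (apply rsum_nonneg; auto).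
  assert (Hk : 0 <= k) by apply Hcf.
  split.
  - apply conv_nonneg; intros a; [apply expq_nonneg; lra|].
    apply Rmult_le_pos; [apply pow_le; auto|apply kap_nonneg].
  - apply Rle_trans with (conv (expq (2 * v)) (expq (2 * k)) s).
    + apply rsum_le; intros a Ha. apply Rmult_le_compat_l; [apply expq_nonneg; lra|].
      unfold expq at 1. rewrite Rmult_comm, Rpow_mult_distr.
      assert (T := kap_le (s - a) m1). unfold expq in T.
      unfold Rdiv. rewrite (Rmult_comm (2 ^ _)), Rmult_assoc, (Rmult_comm (kap _ _ _)).
      apply Rmult_le_compat_l; [apply pow_le; auto|exact T].
    + rewrite conv_expq. unfold expq. apply Rmult_le_compat_r.
      * left; apply Rinv_0_lt_compat, rfact_pos.
      * apply pow_incr. lra.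
Qed.

Definition epsw (i : nat) (m : nat -> nat) : R := epsilon (m i) * cos (INR (m i) * 0).

Lemma epsw_pos (i : nat) (m : nat -> nat) : 0 < epsw i m.
Proof. unfold epsw. rewrite Rmult_0_r, cos_0. pose proof (epsilon_ge_1 (m i)). lra. Qed.

(* u^s is s! / 2^s times the coefficient of t^s in exp (2 u t). *)
Definition fweight (b : nat -> R) (s : nat) : R := b s * (rfact s / 2 ^ s).

Lemma fweight_expq (b : nat -> R) (U : R) (s : nat) :
  fweight b s * expq (2 * U) s = b s * U ^ s.
Proof.
  unfold fweight, expq. rewrite Rpow_mult_distr. field.
  split; [apply rfact_neq_0|apply pow_nonzero; lra].
Qed.

Lemma Rabs_fweight (b : nat -> R) (s : nat) :
  Rabs (fweight b s) = fweight (fun s => Rabs (b s)) s.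
Proof.
  unfold fweight. rewrite Rabs_mult, (Rabs_right (rfact s / 2 ^ s)); auto.
  apply Rle_ge, Rmult_le_pos; [left; apply rfact_pos|].
  left; apply Rinv_0_lt_compat, pow_lt; lra.
Qed.

Lemma fweight_nonneg (b : nat -> R) (s : nat) : 0 <= fweight (fun s => Rabs (b s)) s.
Proof. rewrite <- Rabs_fweight. apply Rabs_pos. Qed.

(** The radial coefficient formed with [|b|] in place of [b]; its nonnegative terms allow every
    interchange of sums in the comparison. *)
Definition majc (b : nat -> R) (lam L : nat) : R :=
  Series (fun s => fweight (fun s => Rabs (b s)) s * kap lam s L).

Lemma majc_rser (b : nat -> R) (lam L : nat) (B : R) :
  (forall N, rsum N (fun s => Rabs (b s)) <= B) ->
  rser (fun s => fweight (fun s => Rabs (b s)) s * kap lam s L) (majc b lam L).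
Proof.
  intros HB. apply rser_is_series. apply Series_correct.
  destruct (rser_nonneg_ex (fun s => fweight (fun s => Rabs (b s)) s * kap lam s L) B) as [l Hl].
  - intros s. apply Rmult_le_pos; [apply fweight_nonneg|apply kap_nonneg].
  - intros N. eapply Rle_trans; [|apply (HB N)]. apply rsum_le; intros s _.
    apply Rle_trans with (fweight (fun s => Rabs (b s)) s * expq (2 * 1) s).
    + apply Rmult_le_compat_l; [apply fweight_nonneg|].
      rewrite Rmult_1_r. eapply Rle_trans; [apply kap_lam_le|apply kap_le].
    + rewrite fweight_expq, pow1. lra.
  - exists l. apply rser_is_series; auto.
Qed.

Lemma majc_nonneg (b : nat -> R) (lam L : nat) (B : R) :
  (forall N, rsum N (fun s => Rabs (b s)) <= B) -> 0 <= majc b lam L.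
Proof.
  intros HB. apply (rser_partial_le _ _ 0 (fun s => Rmult_le_pos _ _
    (fweight_nonneg b s) (kap_nonneg lam s L)) (majc_rser b lam L B HB)).
Qed.

Definition tree_box (N q : nat) (wm : nat -> (nat -> nat) -> R) (D : nat -> node_data)
    (G : nat -> R) (m n : nat -> nat) : R :=
  wbox N (seq 2 (2 ^ (q - 1) - 1)) wm
    (fun m => wbox N (rev (seq 1 (2 ^ (q - 1) - 1))) (tree_weight q D m)
       (fun n => G (lnum q m n 1)) n) m.

Lemma tree_box_rser (N q : nat) (wm : nat -> (nat -> nat) -> R) (D : nat -> node_data)
    (be : nat -> R) (G : nat -> nat -> R) (l : nat -> R) (m n : nat -> nat) :
  (forall L, rser (fun s => be s * G s L) (l L)) ->
  rser (fun s => be s * tree_box N q wm D (G s) m n) (tree_box N q wm D l m n).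
Proof.
  intros H. unfold tree_box.
  apply (wbox_rser N (seq 2 (2 ^ (q - 1) - 1)) wm be (fun s m =>
    wbox N (rev (seq 1 (2 ^ (q - 1) - 1))) (tree_weight q D m)
       (fun n => G s (lnum q m n 1)) n)).
  intros m'. apply (wbox_rser N _ (tree_weight q D m') be (fun s n => G s (lnum q m' n 1))).
  auto.
Qed.

(** All terms are nonnegative, so the box may be enlarged beyond [s], where [tree_sum] evaluates it
    exactly. *)
Lemma tree_box_kap_bound (N q : nat) (D : nat -> node_data) (s : nat) (U : R)
    (m n : nat -> nat) :
  (2 <= q)%nat -> (forall k, node_valid (D k)) ->
  (forall m k n, 0 <= tree_weight q D m k n) ->
  (forall k, 0 <= nd_t (D k)) -> (forall k, 0 <= nd_tau (D k)) ->
  rsum (2 ^ (q - 1)) (fun i => cfd D (2 ^ (q - 1) + i)%nat) <= U ->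
  0 <= tree_box N q epsw D (fun L => kap (lamk q 1) s L) m n <= expq (2 * U) s.
Proof.
  intros Hq HD Hw Ht Htau HU.
  assert (H0 : forall N m, 0 <= wbox N (rev (seq 1 (2 ^ (q - 1) - 1))) (tree_weight q D m)
       (fun n => kap (lamk q 1) s (lnum q m n 1)) n)
    by (intros; apply wbox_nonneg; auto; intros; apply kap_nonneg).
  assert (He : forall j v, 0 <= epsw j v) by (intros; left; apply epsw_pos).
  split; [apply wbox_nonneg; auto|].
  apply Rle_trans with (tree_box (N + S s) q epsw D (fun L => kap (lamk q 1) s L) m n).
  - eapply Rle_trans; [apply Rle_abs|]. apply wbox_le; [lia| |].
    + intros; rewrite Rabs_right; [lra|apply Rle_ge; auto].
    + intros v. apply wbox_le; [lia| |]; intros; rewrite Rabs_right; try lra; apply Rle_ge; auto.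
      apply kap_nonneg.
  - assert (T := tree_sum q D (cfd D) (fun _ => 0) m n (N + S s) s Hq HD (cfd_edges q D)
                   ltac:(lia)).
    change (tree_box (N + S s) q epsw D (fun L => kap (lamk q 1) s L) m n
            = msum q (cfd D) (fun _ => 0) (m 1%nat) s) in T.
    rewrite T. apply msum_bound; auto. intros; apply cfd_nonneg; auto.
Qed.

Lemma tree_box_bound (q : nat) (D : nat -> node_data) (b : nat -> R) (U B B1 : R) :
  (2 <= q)%nat -> (forall k, node_valid (D k)) ->
  (forall m k n, 0 <= tree_weight q D m k n) ->
  (forall k, 0 <= nd_t (D k)) -> (forall k, 0 <= nd_tau (D k)) ->
  rsum (2 ^ (q - 1)) (fun i => cfd D (2 ^ (q - 1) + i)%nat) <= U ->
  (forall N, rsum N (fun s => Rabs (b s)) <= B1) ->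
  (forall N, rsum N (fun s => Rabs (b s) * U ^ s) <= B) ->
  forall N m n, tree_box N q epsw D (majc b (lamk q 1)) m n <= B.
Proof.
  intros Hq HD Hw Ht Htau HU HB1 HB N m n.
  assert (H := tree_box_rser N q epsw D (fweight (fun s => Rabs (b s)))
    (fun s L => kap (lamk q 1) s L) (majc b (lamk q 1)) m n
    (fun L => majc_rser b (lamk q 1) L B1 HB1)).
  apply is_lim_seq_bound with (2 := H). intros M.
  eapply Rle_trans; [|apply (HB M)]. apply rsum_le; intros s _.
  rewrite <- (fweight_expq (fun s => Rabs (b s))).
  apply Rmult_le_compat_l; [apply fweight_nonneg|].
  apply tree_box_kap_bound; auto.
Qed.

Definition diagD (th : nat -> R) (k : nat) : node_data := act_data (th k) (th k).

Definition actD (th th' : nat -> R) (k : nat) : node_data := act_data (th k) (th' k).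

(** Nodes up to [kk] keep their angles, later ones move to the virtual point. In [rev (seq 1 h)] the
    large labels are outermost, so exactly the outer weights become positive. *)
Definition mixD (th : nat -> R) (kk : nat) (eps : R) (k : nat) : node_data :=
  if Nat.leb k kk then act_data (th k) (th k) else virt_data eps.

Definition bounded_coef (z : R) (b : nat -> R) : Prop :=
  forall r, 0 <= r < z -> exists B, forall N, rsum N (fun s => Rabs (b s) * r ^ s) <= B.

Lemma bounded_coef_1 (z : R) (b : nat -> R) : 1 < z -> bounded_coef z b ->
  exists B, forall N, rsum N (fun s => Rabs (b s)) <= B.
Proof.
  intros Hz H. destruct (H 1 ltac:(lra)) as [B HB]. exists B. intros N.
  rewrite (rsum_ext _ _ (fun s => Rabs (b s) * 1 ^ s)); auto.
  intros; rewrite pow1; ring.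
Qed.

Lemma root_exists (U : R) (h : nat) : 1 < U -> (1 <= h)%nat -> exists Y, 1 < Y /\ Y ^ h = U.
Proof.
  intros HU Hh. assert (0 < INR h) by (apply lt_0_INR; lia).
  exists (Rpower U (/ INR h)). split.
  - rewrite <- (Rpower_O U) at 1 by lra. apply Rpower_lt; auto.
    apply Rinv_0_lt_compat; auto.
  - rewrite <- Rpower_pow by apply exp_pos. rewrite Rpower_mult, Rinv_l by lra.
    apply Rpower_1; lra.
Qed.

Lemma mixed_box (q : nat) (th : nat -> R) (kk : nat) (z : R) (b : nat -> R) :
  (2 <= q)%nat -> 1 < z -> bounded_coef z b ->
  exists eps B, 0 < eps /\
    forall N m n, tree_box N q epsw (mixD th kk eps) (majc b (lamk q 1)) m n <= B.
Proof.
  intros Hq Hz Hb. pose proof (pow2_pos (q - 1)).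
  (* The midpoint of [1] and [z] is a radius at which the power series still converges absolutely. A
     virtual node has [t + tau = 1 + 2 eps = Y], and the leaf total is at most a power of [Y] below
     that midpoint. *)
  destruct (root_exists ((1 + z) / 2) (2 ^ (q - 1)) ltac:(lra) ltac:(lia)) as [Y [HY HYh]].
  destruct (bounded_coef_1 z b Hz Hb) as [B1 HB1].
  destruct (Hb ((1 + z) / 2) ltac:(lra)) as [B HB].
  exists ((Y - 1) / 2), B. split; [lra|].
  assert (Hc : forall k, 0 <= nd_t (mixD th kk ((Y - 1) / 2) k)
     /\ 0 <= nd_tau (mixD th kk ((Y - 1) / 2) k)
     /\ nd_t (mixD th kk ((Y - 1) / 2) k) + nd_tau (mixD th kk ((Y - 1) / 2) k) <= Y).
  { intros k. unfold mixD. destruct (Nat.leb k kk); simpl; [|lra].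
    pose proof (sin_cos_sq (th k)). repeat split; nra. }
  apply (tree_box_bound q (mixD th kk ((Y - 1) / 2)) b ((1 + z) / 2) B B1); auto.
  - intros k. unfold mixD. destruct (Nat.leb k kk); auto using act_valid, virt_valid.
  - intros m k n. unfold tree_weight, mixD. destruct (Nat.leb k kk).
    + apply node_weight_diag_nonneg.
    + left; apply node_weight_virt_pos. lra.
  - intros k; apply Hc.
  - intros k; apply Hc.
  - eapply Rle_trans; [apply (cfd_leaf_sum q _ Y)|]; auto; try lra; try (intros k; apply Hc).
    rewrite <- HYh. apply Rle_pow; [lra|lia].
Qed.

Lemma wbox_ext_in (N : nat) (js : list nat) (w w' : nat -> (nat -> nat) -> R)
    (G : (nat -> nat) -> R) (v : nat -> nat) :
  (forall j v, In j js -> w j v = w' j v) -> wbox N js w G v = wbox N js w' G v.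
Proof.
  intros Hw. revert v; induction js as [|j js IH]; intros v; simpl; auto.
  apply rsum_ext; intros. rewrite Hw, IH; auto; [|simpl; auto].
  intros; apply Hw; simpl; auto.
Qed.

Lemma nodes_split (h k : nat) : (k <= h)%nat ->
  rev (seq 1 h) = (rev (seq (S k) (h - k)) ++ rev (seq 1 k))%list.
Proof.
  intros H. rewrite <- rev_app_distr. change (S k) with (1 + k)%nat.
  rewrite <- seq_app. do 2 f_equal. lia.
Qed.

Lemma leaves_split (h j : nat) : (1 <= j <= h)%nat ->
  seq 2 (h - 1) = (seq 2 (j - 1) ++ seq (S j) (h - j))%list.
Proof.
  intros H. replace (S j) with (2 + (j - 1))%nat by lia. rewrite <- seq_app. f_equal. lia.
Qed.

Lemma wbox_mono (N N' : nat) (js : list nat) (w : nat -> (nat -> nat) -> R)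
    (G G' : (nat -> nat) -> R) (v : nat -> nat) :
  (N <= N')%nat -> (forall j v, 0 <= w j v) -> (forall v, 0 <= G v <= G' v) ->
  wbox N js w G v <= wbox N' js w G' v.
Proof.
  intros HN Hw HG. eapply Rle_trans; [apply Rle_abs|]. apply wbox_le; auto.
  - intros; rewrite Rabs_right; [lra|apply Rle_ge; auto].
  - intros u. specialize (HG u). rewrite Rabs_right; lra.
Qed.

Lemma mixD_nonneg (q : nat) (th : nat -> R) (kk : nat) (eps : R) (m n : nat -> nat) (k : nat) :
  0 < eps -> 0 <= tree_weight q (mixD th kk eps) m k n.
Proof.
  intros He. unfold tree_weight, mixD. destruct (Nat.leb k kk).
  - apply node_weight_diag_nonneg.
  - left; apply node_weight_virt_pos; auto.
Qed.

(** [wbox_suffix_bound] is used twice on the mixed box: it strips the leaf sums, whose weights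
    [epsw] are positive, and then the nodes beyond [k], whose weights are virtual. Only genuine
    diagonal weights remain. *)
Lemma nodes_bound (q : nat) (th : nat -> R) (k : nat) (z : R) (b : nat -> R) (m n : nat -> nat) :
  (2 <= q)%nat -> 1 < z -> bounded_coef z b -> (k < 2 ^ (q - 1))%nat ->
  exists B, forall N, wbox N (rev (seq 1 k)) (tree_weight q (diagD th) m)
    (fun n => majc b (lamk q 1) (lnum q m n 1)) n <= B.
Proof.
  intros Hq Hz Hb Hk. pose proof (pow2_pos (q - 1)).
  destruct (mixed_box q th k z b Hq Hz Hb) as [eps [B [He HB]]].
  destruct (bounded_coef_1 z b Hz Hb) as [B1 HB1].
  assert (Hmaj : forall L, 0 <= majc b (lamk q 1) L)
    by (intros; apply (majc_nonneg b _ _ B1 HB1)).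
  assert (Hw : forall m k' n, 0 <= tree_weight q (mixD th k eps) m k' n)
    by (intros; apply mixD_nonneg; auto).
  set (G := fun N m => wbox N (rev (seq 1 (2 ^ (q - 1) - 1))) (tree_weight q (mixD th k eps) m)
       (fun n => majc b (lamk q 1) (lnum q m n 1)) n).
  destruct (wbox_suffix_bound (seq 2 (2 ^ (q - 1) - 1)) nil epsw G m B) as [B2 HB2].
  - intros; left; apply epsw_pos.
  - intros; apply epsw_pos.
  - intros; apply wbox_nonneg; auto.
  - intros; apply wbox_mono; auto. intros; split; auto; lra.
  - intros N. rewrite app_nil_r. apply (HB N m n).
  - simpl in HB2. unfold G in HB2.
    destruct (wbox_suffix_bound (rev (seq (S k) (2 ^ (q - 1) - 1 - k))) (rev (seq 1 k))
      (tree_weight q (mixD th k eps) m) (fun _ n => majc b (lamk q 1) (lnum q m n 1)) n B2)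
      as [B3 HB3]; auto.
    + intros j Hj. apply in_rev, in_seq in Hj. unfold tree_weight, mixD.
      replace (Nat.leb j k) with false by (symmetry; apply Nat.leb_gt; lia).
      apply node_weight_virt_pos; auto.
    + intros; lra.
    + intros N. rewrite <- nodes_split by lia. apply HB2.
    + exists B3. intros N. rewrite (wbox_ext_in N _ _ (tree_weight q (mixD th k eps) m)); auto.
      intros j u Hj. apply in_rev, in_seq in Hj. unfold tree_weight, mixD, diagD.
      replace (Nat.leb j k) with true by (symmetry; apply Nat.leb_le; lia). auto.
Qed.

Lemma leaves_bound (q : nat) (th : nat -> R) (j : nat) (z : R) (b : nat -> R)
    (m n : nat -> nat) :
  (2 <= q)%nat -> 1 < z -> bounded_coef z b -> (1 <= j <= 2 ^ (q - 1))%nat ->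
  exists B, forall N, wbox N (seq (S j) (2 ^ (q - 1) - j)) epsw (fun m =>
    wbox N (rev (seq 1 (2 ^ (q - 1) - 1))) (tree_weight q (diagD th) m)
    (fun n => majc b (lamk q 1) (lnum q m n 1)) n) m <= B.
Proof.
  intros Hq Hz Hb Hj.
  destruct (mixed_box q th (2 ^ (q - 1)) z b Hq Hz Hb) as [eps [B [He HB]]].
  destruct (bounded_coef_1 z b Hz Hb) as [B1 HB1].
  assert (Hmaj : forall L, 0 <= majc b (lamk q 1) L)
    by (intros; apply (majc_nonneg b _ _ B1 HB1)).
  assert (Hw : forall m k' n, 0 <= tree_weight q (diagD th) m k' n)
    by (intros; apply node_weight_diag_nonneg).
  apply (wbox_suffix_bound (seq 2 (j - 1)) (seq (S j) (2 ^ (q - 1) - j)) epsw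
    (fun N m => wbox N (rev (seq 1 (2 ^ (q - 1) - 1))) (tree_weight q (diagD th) m)
    (fun n => majc b (lamk q 1) (lnum q m n 1)) n) m B).
  - intros; left; apply epsw_pos.
  - intros; apply epsw_pos.
  - intros; apply wbox_nonneg; auto.
  - intros; apply wbox_mono; auto. intros; split; auto; lra.
  - intros N. rewrite <- leaves_split by auto.
    eapply Rle_trans; [right|apply (HB N m n)]. unfold tree_box.
    apply wbox_ext; auto. intros m'. apply wbox_ext_in.
    intros k u Hk. apply in_rev, in_seq in Hk. unfold tree_weight, mixD, diagD.
    replace (Nat.leb k (2 ^ (q - 1))) with true by (symmetry; apply Nat.leb_le; lia). auto.
Qed.

Lemma tree_weight_amgm (q : nat) (th th' : nat -> R) (N k : nat) (m n : nat -> nat)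
    (G : nat -> R) : (forall L, 0 <= G L) ->
  wbox N (rev (seq 1 k)) (wabs (tree_weight q (actD th th') m)) (fun n => G (lnum q m n 1)) n
  <= (wbox N (rev (seq 1 k)) (tree_weight q (diagD th) m) (fun n => G (lnum q m n 1)) n
      + wbox N (rev (seq 1 k)) (tree_weight q (diagD th') m) (fun n => G (lnum q m n 1)) n) / 2.
Proof.
  intros HG.
  assert (H := wbox_amgm N (rev (seq 1 k)) (tree_weight q (actD th th') m)
    (tree_weight q (diagD th) m) (tree_weight q (diagD th') m)
    (fun n => G (lnum q m n 1)) n 1 1 1).
  rewrite !Rmult_1_l in H. apply H; auto; try lra.
  - intros; apply node_weight_diag_nonneg.
  - intros; apply node_weight_diag_nonneg.
  - intros j v. right. apply node_weight_act_sq.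
Qed.

Definition azim (psi : nat -> R) (i : nat) (m : nat -> nat) : R :=
  epsilon (m i) * cos (INR (m i) * psi i).

Lemma azim_le (psi : nat -> R) (i : nat) (m : nat -> nat) : Rabs (azim psi i m) <= epsw i m.
Proof.
  unfold azim, epsw. rewrite Rmult_0_r, cos_0, Rabs_mult.
  pose proof (epsilon_ge_1 (m i)). rewrite Rabs_right by lra.
  apply Rmult_le_compat_l; [lra|]. apply Rabs_cos_le.
Qed.

Lemma leaves_amgm (q : nat) (th th' psi : nat -> R) (N : nat) (js : list nat)
    (m n : nat -> nat) (G : nat -> R) : (forall L, 0 <= G L) ->
  wbox N js (wabs (azim psi)) (fun m =>
    wbox N (rev (seq 1 (2 ^ (q - 1) - 1))) (wabs (tree_weight q (actD th th') m))
      (fun n => G (lnum q m n 1)) n) m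
  <= / 2 * wbox N js epsw (fun m =>
      wbox N (rev (seq 1 (2 ^ (q - 1) - 1))) (tree_weight q (diagD th) m)
        (fun n => G (lnum q m n 1)) n) m
    + / 2 * wbox N js epsw (fun m =>
      wbox N (rev (seq 1 (2 ^ (q - 1) - 1))) (tree_weight q (diagD th') m)
        (fun n => G (lnum q m n 1)) n) m.
Proof.
  intros HG. rewrite <- wbox_lin. eapply Rle_trans; [apply Rle_abs|]. apply wbox_le; auto.
  - intros j v. unfold wabs. rewrite Rabs_Rabsolu. apply azim_le.
  - intros v. rewrite Rabs_right.
    + eapply Rle_trans; [apply tree_weight_amgm; auto|]. right. field.
    + apply Rle_ge, wbox_nonneg; auto. intros; apply Rabs_pos.
Qed.

(** Two nested uses of [multiseries_box]: node boxes with fixed [m] are the summands of the leaf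
    boxes. The bounds come from [nodes_bound] and [leaves_bound] through the inequality of
    arithmetic and geometric means between the two diagonals. *)
Lemma tree_multiseries (q : nat) (th th' psi : nat -> R) (z : R) (b : nat -> R)
    (rad : nat -> R) (c0 : C) (lo : (nat -> nat) -> nat -> (nat -> nat) -> nat)
    (F : (nat -> nat) -> (nat -> nat) -> C -> Prop) (m n : nat -> nat) :
  (2 <= q)%nat -> 1 < z -> bounded_coef z b ->
  (forall L, Rabs (rad L) <= majc b (lamk q 1) L) ->
  (forall m k n, (2 <= k)%nat -> lo m k n = O) ->
  (forall m n i, (i < lo m 1 n)%nat -> rad (lnum q m (update n 1 i) 1) = 0) ->
  (forall m n i, (lo m 1 n <= i)%nat ->
     F m (update n 1 i) (c0 * RtoC (rad (lnum q m (update n 1 i) 1)))%C) ->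
  exists S : R,
    is_multiseries (seq 2 (2 ^ (q - 1) - 1)) (fun _ _ => O) (azim psi)
      (fun m => is_multiseries (rev (seq 1 (2 ^ (q - 1) - 1))) (lo m)
         (fun k n => tree_weight q (actD th th') m k n) (F m) n) m (c0 * RtoC S)%C
    /\ is_lim_seq (fun N => tree_box N q (azim psi) (actD th th') rad m n) S.
Proof.
  intros Hq Hz Hb Hrad Hlo Hlo0 HF. pose proof (pow2_pos (q - 1)).
  assert (H2h : (2 <= 2 ^ (q - 1))%nat).
  { replace (q - 1)%nat with (S (q - 2)) by lia. rewrite Nat.pow_succ_r'.
    pose proof (pow2_pos (q - 2)). lia. }
  set (h := (2 ^ (q - 1))%nat) in *.
  destruct (bounded_coef_1 z b Hz Hb) as [B1 HB1].
  assert (Hmaj : forall L, 0 <= majc b (lamk q 1) L)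
    by (intros; apply (majc_nonneg b _ _ B1 HB1)).
  set (G1 := fun m (_ : nat) n => rad (lnum q m n 1)).
  set (G2 := fun m (_ : nat) n => majc b (lamk q 1) (lnum q m n 1)).
  set (Rb1 := fun m n => F m n (c0 * RtoC (rad (lnum q m n 1)))%C).
  assert (Hin : forall k m n, (k < h)%nat ->
     hsum (rev (seq 1 k)) (lo m) (tree_weight q (actD th th') m) (G1 m) (G2 m) (fun _ => True) n).
  { induction k as [|k IH]; intros m' n' Hk; [exact I|].
    rewrite seq_S, rev_app_distr. simpl app.
    change ((1 + k)%nat :: rev (seq 1 k))%list with (S k :: rev (seq 1 k))%list.
    split; [|split].
    - destruct (nodes_bound q th (S k) z b m' n' Hq Hz Hb Hk) as [X HX].
      destruct (nodes_bound q th' (S k) z b m' n' Hq Hz Hb Hk) as [X' HX'].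
      exists ((X + X') / 2). intros N.
      assert (T := tree_weight_amgm q th th' N (S k) m' n' _ Hmaj).
      specialize (HX N). specialize (HX' N).
      rewrite seq_S, rev_app_distr in T, HX, HX'. simpl (rev (_ :: nil)) in *.
      unfold G2. simpl app in *. change (1 + k)%nat with (S k) in *. lra.
    - intros N i Hi. destruct k as [|k].
      + simpl. unfold G1. apply Hlo0. exact Hi.
      + rewrite Hlo in Hi by lia. lia.
    - intros i. apply IH. lia. }
  assert (Hgood : forall k m n, (1 <= k)%nat -> good (rev (seq 1 k)) (lo m) (Rb1 m) n).
  { induction k as [|k IH]; intros m' n' Hk; [lia|].
    rewrite seq_S, rev_app_distr. simpl app. intros i Hi.
    destruct k as [|k]; [|apply IH; lia]. simpl. unfold Rb1. apply HF. exact Hi. }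
  set (Gb := fun N m => wbox N (rev (seq 1 (h - 1))) (tree_weight q (actD th th') m)
                          (fun n => rad (lnum q m n 1)) n).
  set (Ga := fun N m => wbox N (rev (seq 1 (h - 1))) (wabs (tree_weight q (actD th th') m))
                          (fun n => majc b (lamk q 1) (lnum q m n 1)) n).
  destruct (multiseries_box (seq 2 (h - 1)) (fun _ _ => O) (azim psi)
    (fun m => is_multiseries (rev (seq 1 (h - 1))) (lo m)
         (fun k n => tree_weight q (actD th th') m k n) (F m) n) c0 Gb Ga
    (fun _ => True) (fun _ => True) m) as [S [HS1 HS2]].
  - intros m' _.
    destruct (multiseries_box (rev (seq 1 (h - 1))) (lo m') (tree_weight q (actD th th') m')
      (F m') c0 (G1 m') (G2 m') (fun _ => True) (Rb1 m') n) as [s [Hs1 Hs2]].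
    + intros n' _. exists (rad (lnum q m' n' 1)). split; [apply is_lim_seq_const|auto].
    + intros; apply Hrad.
    + intros; unfold G2; lra.
    + apply Hin. lia.
    + exists s. split; [exact Hs1|]. intros _. apply Hs2. apply Hgood. lia.
  - intros N v. apply wbox_le; auto. intros; unfold wabs; lra.
  - intros N v. apply wbox_mono; auto; [intros; apply Rabs_pos|]. intros; split; auto; lra.
  - assert (Hout : forall r j m, (j + r = h)%nat -> (1 <= j)%nat ->
       hsum (seq (Datatypes.S j) r) (fun _ _ => O) (azim psi) Gb Ga (fun _ => True) m).
    { induction r as [|r IH]; intros j m' Hjr Hj; [exact I|].
      simpl seq. split; [|split].
      - destruct (leaves_bound q th j z b m' n Hq Hz Hb ltac:(fold h; lia)) as [X HX].
        destruct (leaves_bound q th' j z b m' n Hq Hz Hb ltac:(fold h; lia)) as [X' HX'].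
        fold h in HX, HX'. replace (h - j)%nat with (Datatypes.S r) in HX, HX' by lia.
        exists (/ 2 * X + / 2 * X'). intros N.
        eapply Rle_trans; [apply (leaves_amgm q th th' psi N _ m' n _ Hmaj)|].
        specialize (HX N). specialize (HX' N). fold h. simpl seq in *.
        apply Rplus_le_compat; apply Rmult_le_compat_l; auto; lra.
      - intros N i Hi. lia.
      - intros i. apply IH; lia. }
    apply (Hout (h - 1)%nat 1%nat); lia.
  - exists S. split; [|exact HS1]. apply HS2.
    clear. generalize (seq 2 (h - 1)). intros l. revert m.
    induction l as [|j l IH]; intros m; simpl; auto.
Qed.

(** * The value of the complete tree sum *)

Lemma cfd_act_sq (th th' : nat -> R) (i : nat) :
  cfd (actD th th') i ^ 2 = cfd (diagD th) i * cfd (diagD th') i.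
Proof.
  unfold cfd. generalize i at 1 3 5. intros f; revert i.
  induction f as [|f IH]; intros i; simpl cfd_aux; [ring|].
  destruct (Nat.leb i 1); [ring|]. rewrite Rpow_mult_distr, IH.
  destruct (Nat.even i); simpl; ring.
Qed.

Lemma cfd_diag_nonneg (th : nat -> R) (i : nat) : 0 <= cfd (diagD th) i.
Proof. apply cfd_nonneg; intros k; simpl; nra. Qed.

Lemma cfd_diag_sum (q : nat) (th : nat -> R) : (2 <= q)%nat ->
  rsum (2 ^ (q - 1)) (fun i => cfd (diagD th) (2 ^ (q - 1) + i)%nat) <= 1.
Proof.
  intros Hq. rewrite <- (pow1 (2 ^ (q - 1) - 1)) at 1.
  apply cfd_leaf_sum; auto; try lra; intros k; simpl; try nra.
  pose proof (sin_cos_sq (th k)). nra.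
Qed.

Lemma cfd_act_sum (q : nat) (th th' : nat -> R) : (2 <= q)%nat ->
  rsum (2 ^ (q - 1)) (fun i => Rabs (cfd (actD th th') (2 ^ (q - 1) + i)%nat)) <= 1.
Proof.
  intros Hq.
  apply Rle_trans with (/ 2 * rsum (2 ^ (q - 1)) (fun i => cfd (diagD th) (2 ^ (q - 1) + i)%nat)
    + / 2 * rsum (2 ^ (q - 1)) (fun i => cfd (diagD th') (2 ^ (q - 1) + i)%nat)).
  - rewrite <- 2!rsum_scal, <- rsum_plus. apply rsum_le; intros i _.
    set (j := (2 ^ (q - 1) + i)%nat).
    pose proof (cfd_act_sq th th' j). pose proof (cfd_diag_nonneg th j).
    pose proof (cfd_diag_nonneg th' j).
    set (a := cfd (diagD th) j) in *. set (a' := cfd (diagD th') j) in *.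
    rewrite <- pow2_abs in H. pose proof (Rabs_pos (cfd (actD th th') j)).
    apply Rnot_lt_le. intros Hlt. pose proof (pow2_ge_0 (a - a')). nra.
  - pose proof (cfd_diag_sum q th Hq). pose proof (cfd_diag_sum q th' Hq). lra.
Qed.

Lemma cfd_act_bound (q : nat) (th th' psi : nat -> R) : (2 <= q)%nat ->
  Rabs (rsum (2 ^ (q - 1) - 1) (fun i =>
        cfd (actD th th') (2 ^ q - (2 + i))%nat * cos (psi (2 + i)%nat)))
  + Rabs (cfd (actD th th') (2 ^ q - 1)%nat) <= 1.
Proof.
  intros Hq. pose proof (pow2_pos (q - 1)).
  assert (Hd : (2 ^ q = 2 * 2 ^ (q - 1))%nat)
    by (rewrite <- Nat.pow_succ_r'; f_equal; lia).
  eapply Rle_trans; [|apply (cfd_act_sum q th th' Hq)].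
  rewrite (leaf_sum_split (fun i => Rabs (cfd (actD th th') i))), <- Hd by auto.
  apply Rplus_le_compat_r. eapply Rle_trans; [apply rsum_Rabs|].
  apply rsum_le; intros i _. rewrite Rabs_mult.
  rewrite <- (Rmult_1_r (Rabs (cfd _ _))) at 2.
  apply Rmult_le_compat_l; [apply Rabs_pos|apply Rabs_cos_le].
Qed.

Lemma rser_abs_le (f g : nat -> R) (l S : R) :
  (forall i, Rabs (f i) <= g i) -> rser f l -> rser g S -> Rabs l <= S.
Proof.
  intros H Hf Hg. assert (T := rser_tail_le f g l S 0 H Hf Hg). simpl in T.
  rewrite 2!Rminus_0_r in T. exact T.
Qed.

Lemma fcoef_msum (n s : nat) (v k : R) :
  fcoef n (fun t => (v + k * cos t) ^ s)
    (rfact s / 2 ^ s * conv (expq (2 * v)) (fun b => k ^ b * kap 0 b n) s).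
Proof.
  assert (H2 : forall j, 2 ^ j <> 0) by (intros; apply pow_nonzero; lra).
  apply fcoef_ext with (fun t => rsum (S s) (fun a =>
    rfact s * expq v a * (k ^ (s - a) / rfact (s - a)) * cos t ^ (s - a))).
  - intros t. transitivity (rfact s * expq (v + k * cos t) s).
    + rewrite <- conv_expq. unfold conv. rewrite <- rsum_scal. apply rsum_ext; intros a Ha.
      unfold expq. rewrite (Rpow_mult_distr k). unfold Rdiv; ring.
    + unfold expq. field. apply rfact_neq_0.
  - replace (rfact s / 2 ^ s * conv (expq (2 * v)) (fun b => k ^ b * kap 0 b n) s)
      with (rsum (S s) (fun a => rfact s * expq v a * (k ^ (s - a) / rfact (s - a))
        * (rfact (s - a) / 2 ^ (s - a) * kap 0 (s - a) n))).
    + apply (fcoef_rsum n (S s) (fun a t => rfact s * expq v a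
        * (k ^ (s - a) / rfact (s - a)) * cos t ^ (s - a))).
      intros a Ha. apply (fcoef_scal n (fun t => cos t ^ (s - a))), fcoef_cos_pow.
    + unfold conv. rewrite <- rsum_scal. apply rsum_ext; intros a Ha.
      replace (2 ^ s) with (2 ^ a * 2 ^ (s - a)) by (rewrite <- pow_add; f_equal; lia).
      unfold expq. rewrite (Rpow_mult_distr 2). field. repeat split; auto; apply rfact_neq_0.
Qed.

(** A box of size [N] is exact for the powers [s < N] by [tree_sum]. The higher powers contribute at
    most the tail of the sum of [|b s|], because the box for [s] is dominated by that of the
    diagonals, where the cosine is at most [1]. *)
Lemma tree_box_value (q : nat) (th th' psi : nat -> R) (z : R) (b : nat -> R) (f : R -> R)
    (rad : nat -> R) (m n : nat -> nat) :
  (2 <= q)%nat -> 1 < z -> psum z b f ->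
  (forall L, rser (fun s => fweight b s * kap (lamk q 1) s L) (rad L)) ->
  exists V : R,
    is_lim_seq (fun N => tree_box N q (azim psi) (actD th th') rad m n) V /\
    fcoef (m 1%nat) (fun t => f (rsum (2 ^ (q - 1) - 1) (fun i =>
        cfd (actD th th') (2 ^ q - (2 + i))%nat * cos (psi (2 + i)%nat))
      + cfd (actD th th') (2 ^ q - 1)%nat * cos t)) V.
Proof.
  intros Hq Hz Hb Hrad. pose proof (pow2_pos (q - 1)).
  assert (Hd : (2 ^ q = 2 * 2 ^ (q - 1))%nat)
    by (rewrite <- Nat.pow_succ_r'; f_equal; lia).
  set (D := actD th th'). set (cf := cfd D).
  set (v := rsum _ (fun i => cf _ * cos _)). set (k := cf (2 ^ q - 1)%nat).
  assert (Hvk : Rabs v + Rabs k <= 1) by (apply cfd_act_bound; auto).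
  destruct (fcoef_psum (m 1%nat) z 1 b f (fun t => v + k * cos t)
    (fun s => rfact s / 2 ^ s * conv (expq (2 * v)) (fun b => k ^ b * kap 0 b (m 1%nat)) s))
    as [V [HV1 HV2]]; auto; [lra| | |].
  { intros t. eapply Rle_trans; [apply Rabs_triang|]. rewrite Rabs_mult.
    pose proof (Rabs_cos_le t). pose proof (Rabs_pos k). pose proof (Rabs_pos (cos t)). nra. }
  { intros s. apply fcoef_msum. }
  exists V. split; [|exact HV2].
  destruct (bounded_coef_1 z b Hz (proj2 Hb)) as [B HB].
  destruct (rser_nonneg_ex (fun s => Rabs (b s)) B (fun s => Rabs_pos _) HB) as [SS HSS].
  set (wN := fun N s => tree_box N q (azim psi) D (fun L => kap (lamk q 1) s L) m n).
  assert (HwN : forall N s, Rabs (fweight b s * wN N s) <= Rabs (b s)).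
  { intros N s. rewrite Rabs_mult, Rabs_fweight.
    replace (Rabs (b s)) with (fweight (fun s => Rabs (b s)) s * expq (2 * 1) s)
      by (rewrite fweight_expq, pow1; ring).
    apply Rmult_le_compat_l; [apply fweight_nonneg|].
    apply Rle_trans with (wbox N (seq 2 (2 ^ (q - 1) - 1)) (wabs (azim psi)) (fun m =>
      wbox N (rev (seq 1 (2 ^ (q - 1) - 1))) (wabs (tree_weight q (actD th th') m))
        (fun n => kap (lamk q 1) s (lnum q m n 1)) n) m).
    { apply wbox_le; auto; [intros; apply Rle_refl|].
      intros m'. apply wbox_le; auto; [intros; apply Rle_refl|].
      intros n'. rewrite Rabs_right; [lra|apply Rle_ge, kap_nonneg]. }
    eapply Rle_trans; [apply leaves_amgm; intros; apply kap_nonneg|].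
    assert (T : forall th, tree_box N q epsw (diagD th) (fun L => kap (lamk q 1) s L) m n
                           <= expq (2 * 1) s).
    { intros th0. apply tree_box_kap_bound; auto.
      - intros; apply act_valid.
      - intros; apply node_weight_diag_nonneg.
      - intros; simpl; nra.
      - intros; simpl; nra.
      - apply cfd_diag_sum; auto. }
    assert (T1 := T th). assert (T2 := T th'). unfold tree_box in T1, T2. lra. }
  assert (HN : forall N, rser (fun s => fweight b s * wN N s) (tree_box N q (azim psi) D rad m n)).
  { intros N. apply (tree_box_rser N q (azim psi) D (fweight b)
      (fun s L => kap (lamk q 1) s L)). exact Hrad. }
  assert (HM : forall N, rsum N (fun s => fweight b s * wN N s)
     = rsum N (fun s => b s * (rfact s / 2 ^ s *
         conv (expq (2 * v)) (fun b => k ^ b * kap 0 b (m 1%nat)) s))).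
  { intros N. apply rsum_ext; intros s Hs. unfold wN, tree_box.
    assert (T := tree_sum q D cf psi m n N s Hq (fun k => act_valid _ _) (cfd_edges q D) Hs).
    fold v k in T. unfold azim. rewrite T. unfold fweight. ring. }
  apply is_lim_seq_ext with (fun N => (tree_box N q (azim psi) D rad m n
    - rsum N (fun s => fweight b s * wN N s)) + rsum N (fun s => b s * (rfact s / 2 ^ s *
         conv (expq (2 * v)) (fun b => k ^ b * kap 0 b (m 1%nat)) s))).
  { intros N. rewrite HM. ring. }
  replace V with (0 + V) by ring. apply is_lim_seq_plus'; [|exact HV1].
  apply is_lim_seq_abs_0.
  apply is_lim_seq_le_le with (u := fun _ => 0) (w := fun N => SS - rsum N (fun s => Rabs (b s))).
  - intros N. split; [apply Rabs_pos|]. apply rser_tail_le; auto.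
  - apply is_lim_seq_const.
  - replace 0 with (SS - SS) by ring. apply is_lim_seq_minus'; [apply is_lim_seq_const|exact HSS].
Qed.

(** * The finite multiple sum *)

Lemma Csum_0_rsum (hi : nat) (c0 : C) (f : nat -> C) (g : nat -> R) :
  (forall i, (i <= hi)%nat -> f i = (c0 * RtoC (g i))%C) ->
  Csum 0 hi f = (c0 * RtoC (rsum (S hi) g))%C.
Proof.
  intros H. unfold Csum. induction hi as [|hi IH].
  - rewrite sum_n_n, H by lia. simpl rsum. rewrite Rplus_0_l. auto.
  - rewrite sum_n_Sm by lia. rewrite IH by (intros; apply H; lia). rewrite H by lia.
    rewrite (rsum_S (S hi)), RtoC_plus. change plus with Cplus. ring.
Qed.

Lemma Csum_lt_rsum (n : nat) (c0 : C) (f : nat -> C) (g : nat -> R) :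
  (forall i, (i < n)%nat -> f i = (c0 * RtoC (g i))%C) ->
  Csum_lt n f = (c0 * RtoC (rsum n g))%C.
Proof.
  intros H. destruct n as [|n].
  - simpl. ring.
  - apply Csum_0_rsum. intros; apply H; lia.
Qed.

Lemma nat_sum_rsum (lo hi : nat) (f : nat -> nat) :
  INR (nat_sum lo hi f) = rsum (hi + 1 - lo) (fun i => INR (f (lo + i)%nat)).
Proof.
  unfold nat_sum. induction (hi + 1 - lo)%nat as [|k IH]; [reflexivity|].
  rewrite seq_S, map_app, list_sum_app, plus_INR, IH. simpl list_sum.
  rewrite Nat.add_0_r. reflexivity.
Qed.

Lemma nat_sum_first (lo hi : nat) (f : nat -> nat) : (lo <= hi)%nat ->
  nat_sum lo hi f = (f lo + nat_sum (lo + 1) hi f)%nat.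
Proof.
  intros H. unfold nat_sum. replace (hi + 1 - lo)%nat with (S (hi + 1 - (lo + 1))) by lia.
  rewrite !Nat.add_1_r. reflexivity.
Qed.

Lemma nat_sum_last (lo hi : nat) (f : nat -> nat) : (lo <= S hi)%nat ->
  nat_sum lo (S hi) f = (nat_sum lo hi f + f (S hi))%nat.
Proof.
  intros H. unfold nat_sum. replace (S hi + 1 - lo)%nat with (S (hi + 1 - lo)) by lia.
  rewrite seq_S, map_app, list_sum_app. simpl. rewrite Nat.add_0_r.
  f_equal. f_equal. lia.
Qed.

Lemma nat_sum_update (lo hi j i : nat) (f : nat -> nat) : (j < lo \/ hi < j)%nat ->
  nat_sum lo hi (update f j i) = nat_sum lo hi f.
Proof.
  intros H. unfold nat_sum. f_equal. apply map_ext_in. intros k Hk. apply in_seq in Hk.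
  apply update_neq. lia.
Qed.

Lemma lnum_total (q : nat) (m n : nat -> nat) : (2 <= q)%nat ->
  lnum q m n 1 = (2 * nat_sum 1 (2 ^ (q - 1) - 1) n + nat_sum 1 (2 ^ (q - 1)) m)%nat.
Proof.
  intros Hq. pose proof (pow2_pos (q - 1)).
  assert (Hd : (2 ^ q = 2 * 2 ^ (q - 1))%nat)
    by (rewrite <- Nat.pow_succ_r'; f_equal; lia).
  apply INR_eq. rewrite plus_INR, mult_INR, 2!nat_sum_rsum.
  rewrite (frontier_sum (fun k => INR (lnum q m n k)) (fun k => INR (2 * n k)) (2 ^ (q - 1) - 1)).
  - f_equal.
    + rewrite <- rsum_scal. replace (2 ^ (q - 1) - 1 + 1 - 1)%nat with (2 ^ (q - 1) - 1)%nat by lia.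
      apply rsum_ext; intros i Hi. rewrite mult_INR. reflexivity.
    + replace (S (2 ^ (q - 1) - 1)) with (2 ^ (q - 1))%nat by lia.
      replace (2 ^ (q - 1) + 1 - 1)%nat with (2 ^ (q - 1))%nat by lia.
      rewrite rsum_rev. apply rsum_ext; intros i Hi. rewrite lnum_leaf by lia. do 2 f_equal. lia.
  - intros k Hk. rewrite lnum_node, 2!plus_INR by (auto; lia). ring.
Qed.

Lemma wbox_zero (N : nat) (js : list nat) (w : nat -> (nat -> nat) -> R)
    (G : (nat -> nat) -> R) (P : (nat -> nat) -> Prop) (v : nat -> nat) :
  (forall v, P v -> G v = 0) -> (forall j v i, In j js -> P v -> P (update v j i)) -> P v ->
  wbox N js w G v = 0.
Proof.
  intros HG. revert v; induction js as [|j js IH]; intros v HP Hv; simpl; auto.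
  apply rsum_0; intros i Hi. rewrite IH; [ring| |].
  - intros j' v' i' Hj. apply HP. simpl; auto.
  - apply HP; simpl; auto.
Qed.

(** Each range stops exactly where the total degree would exceed [p]. Beyond it [G] vanishes, so the
    box with cutoff above [p] only adds zeros; the last hypothesis keeps the natural-number
    subtractions exact. *)
Lemma nodes_multisum (h p M N k : nat) (w : nat -> (nat -> nat) -> R)
    (F : (nat -> nat) -> C) (G : (nat -> nat) -> R) (c0 : C) (n : nat -> nat) :
  (k < h)%nat -> (p < N)%nat ->
  (forall n, (M + 2 * nat_sum 1 (h - 1) n <= p)%nat -> F n = (c0 * RtoC (G n))%C) ->
  (forall n, (p < M + 2 * nat_sum 1 (h - 1) n)%nat -> G n = 0) ->
  (M + 2 * nat_sum (k + 1) (h - 1) n <= p)%nat ->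
  multisum (rev (seq 1 k)) (fun k n => (p - M - 2 * nat_sum (k + 1) (h - 1) n) / 2)%nat w F n
  = (c0 * RtoC (wbox N (rev (seq 1 k)) w G n))%C.
Proof.
  intros Hk HN HF HG. revert n; induction k as [|k IH]; intros n Hn.
  - apply HF. exact Hn.
  - rewrite seq_S, rev_app_distr. simpl app. cbn [multisum wbox].
    set (hi := ((p - M - 2 * nat_sum (S k + 1) (h - 1) n) / 2)%nat).
    assert (Hhi : (2 * hi <= p - M - 2 * nat_sum (S k + 1) (h - 1) n)%nat)
      by (apply Nat.Div0.mul_div_le).
    assert (Hhi' : (p - M - 2 * nat_sum (S k + 1) (h - 1) n < 2 * S hi)%nat)
      by (apply Nat.mul_succ_div_gt; lia).
    assert (Hs : forall i, nat_sum (k + 1) (h - 1) (update n (S k) i)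
                 = (i + nat_sum (S k + 1) (h - 1) n)%nat).
    { intros i. rewrite nat_sum_first by lia. replace (k + 1)%nat with (S k) by lia.
      rewrite update_eq, nat_sum_update by lia. auto. }
    rewrite (Csum_0_rsum _ c0 _ (fun i => w (S k) (update n (S k) i)
               * wbox N (rev (seq 1 k)) w G (update n (S k) i))).
    + do 2 f_equal. symmetry. apply rsum_extend; [lia|]. intros i Hi.
      rewrite (wbox_zero _ _ _ _ (fun n' => p < M + 2 * nat_sum (k + 1) (h - 1) n')%nat);
        [ring| | |].
      * intros n' Hn'. apply HG.
        assert (nat_sum (k + 1) (h - 1) n' <= nat_sum 1 (h - 1) n')%nat; [|lia].
        clear - Hk. unfold nat_sum.
        replace (h - 1 + 1 - 1)%nat with (k + (h - 1 + 1 - (k + 1)))%nat by lia.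
        rewrite seq_app, map_app, list_sum_app. rewrite (Nat.add_comm k 1). lia.
      * intros j n' i' Hj Hn'. apply in_rev, in_seq in Hj. rewrite nat_sum_update by lia. auto.
      * rewrite Hs. lia.
    + intros i Hi. change (1 + k)%nat with (S k). rewrite IH by (rewrite ?Hs; lia).
      rewrite RtoC_mult. ring.
Qed.

Lemma leaves_multisum (h p N r j : nat) (w : nat -> (nat -> nat) -> R)
    (F : (nat -> nat) -> C) (G : (nat -> nat) -> R) (c0 : C) (m : nat -> nat) :
  (j + r = h)%nat -> (1 <= j)%nat -> (p < N)%nat ->
  (forall m, (nat_sum 1 h m <= p)%nat -> F m = (c0 * RtoC (G m))%C) ->
  (forall m, (p < nat_sum 1 h m)%nat -> G m = 0) ->
  (nat_sum 1 j m <= p)%nat ->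
  multisum (seq (S j) r) (fun j m => p - nat_sum 1 (j - 1) m)%nat w F m
  = (c0 * RtoC (wbox N (seq (S j) r) w G m))%C.
Proof.
  intros Hjr Hj HN HF HG. revert j m Hjr Hj; induction r as [|r IH]; intros j m Hjr Hj Hm.
  - apply HF. replace h with j by lia. exact Hm.
  - cbn [seq multisum wbox]. replace (S j - 1)%nat with j by lia.
    assert (Hs : forall i, nat_sum 1 (S j) (update m (S j) i) = (nat_sum 1 j m + i)%nat).
    { intros i. rewrite nat_sum_last, nat_sum_update, update_eq by lia. auto. }
    rewrite (Csum_0_rsum _ c0 _ (fun i => w (S j) (update m (S j) i)
               * wbox N (seq (S (S j)) r) w G (update m (S j) i))).
    + do 2 f_equal. symmetry. apply rsum_extend; [lia|]. intros i Hi.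
      rewrite (wbox_zero _ _ _ _ (fun m' => p < nat_sum 1 (S j) m')%nat); [ring| | |].
      * intros m' Hm'. apply HG.
        assert (nat_sum 1 (S j) m' <= nat_sum 1 h m')%nat; [|lia].
        clear - Hjr. unfold nat_sum.
        replace (h + 1 - 1)%nat with ((S j + 1 - 1) + r)%nat by lia.
        rewrite seq_app, map_app, list_sum_app. lia.
      * intros t m' i' Ht Hm'. apply in_seq in Ht. rewrite nat_sum_update by lia. auto.
      * rewrite Hs. lia.
    + intros i Hi. rewrite IH by (rewrite ?Hs; lia). rewrite RtoC_mult. ring.
Qed.

(** Both factors [Upsilon] carry the same square root, whose square is [jnorm] divided by the
    factorials that [JacobiP_jhom] brings in twice. *)
Lemma Psi_tree_weight (q : nat) (th th' : nat -> R) (m n : nat -> nat) (k : nat) :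
  Psi q th th' m n k = tree_weight q (actD th th') m k n.
Proof.
  unfold Psi, Upsilon, tree_weight, node_weight. cbv zeta.
  set (a := alpha q m n k). set (b := beta q m n k).
  unfold actD, act_data. cbn [nd_t nd_tau nd_c nd_e nd_c' nd_e'].
  assert (E : forall t, cos (2 * t) = cos t ^ 2 - sin t ^ 2)
    by (intros; rewrite cos_2a; ring).
  rewrite 2!E, 2!JacobiP_jhom by apply sin_cos_sq.
  set (s := sqrt _).
  assert (Es : s * s = jnorm a b (n k)
    / ((rfact (n k + a) * rfact (n k + b)) * (rfact (n k + a) * rfact (n k + b)))).
  { unfold s. rewrite sqrt_sqrt.
    - unfold jnorm, rfact. field. split; apply INR_fact_neq_0.
    - apply Rmult_le_pos.
      + repeat apply Rmult_le_pos; apply pos_INR.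
      + left. apply Rinv_0_lt_compat, Rmult_lt_0_compat; apply INR_fact_lt_0. }
  rewrite 2!Rpow_mult_distr.
  set (J := jhom a b (n k) (cos (th k) ^ 2) (sin (th k) ^ 2)).
  set (J' := jhom a b (n k) (cos (th' k) ^ 2) (sin (th' k) ^ 2)).
  transitivity (s * s * ((rfact (n k + a) * rfact (n k + b)) * (rfact (n k + a) * rfact (n k + b)))
    * (cos (th k) ^ lnum q m n (2 * k) * cos (th' k) ^ lnum q m n (2 * k))
    * (sin (th k) ^ lnum q m n (2 * k + 1) * sin (th' k) ^ lnum q m n (2 * k + 1)) * J * J');
    [ring|].
  rewrite Es. field. split; apply rfact_neq_0.
Qed.

Lemma first_multisum_value (q p m N : nat) (th th' phi phi' : nat -> R) (rmax z : R)
    (rad : nat -> R) (c0 : C) :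
  (2 <= q)%nat -> (m <= p)%nat -> (p < N)%nat ->
  (forall L, (L <= p)%nat ->
     low_degree_term (2 ^ q) p L rmax z = (c0 * RtoC ((-1) ^ L * rad L))%C) ->
  (forall L, (p < L)%nat -> rad L = 0) ->
  first_multisum q p m th th' phi phi' rmax z
  = (c0 * RtoC (tree_box N q (azim (fun j => phi j - phi' j)%R) (actD th th') rad
                  (update (fun _ => O) 1 m) (fun _ => O)))%C.
Proof.
  intros Hq Hm HN Hlow Hrad. pose proof (pow2_pos (q - 1)).
  unfold first_multisum, tree_box. cbv zeta. rewrite pow2_half by lia.
  set (h := (2 ^ (q - 1))%nat) in *.
  apply (leaves_multisum h p N (h - 1) 1); try lia.
  - intros m' Hm'. set (M := nat_sum 1 h m') in *.
    rewrite (nodes_multisum h p M N (h - 1) _ _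
      (fun n => (-1) ^ (2 * nat_sum 1 (h - 1) n + M) * rad (2 * nat_sum 1 (h - 1) n + M)%nat) c0).
    + assert (E : forall c0 a b : C, (a * (c0 * b) = c0 * (a * b))%C) by (intros; ring).
      rewrite E, <- RtoC_mult. do 2 f_equal.
      (* A zero second summand brings the goal into the shape of [wbox_lin], which moves [(-1)^M]
         under the sums. There it cancels [(-1)^L], as [L = 2 N + M] has the parity of [M]. *)
      rewrite <- (Rplus_0_r ((-1) ^ M * _)), <- (Rmult_0_l (wbox N (rev (seq 1 (h - 1)))
        (fun k n => Psi q th th' m' n k) (fun _ => 0) (fun _ => O))).
      rewrite <- wbox_lin. apply wbox_ext.
      * intros j v. apply Psi_tree_weight.
      * intros v. rewrite lnum_total by auto. fold h M.
        replace (2 * nat_sum 1 (h - 1) v + M)%nat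
          with (nat_sum 1 (h - 1) v * 2 + M)%nat by lia.
        rewrite pow_add, (Nat.mul_comm _ 2), pow_mult.
        replace ((-1) ^ 2) with 1 by ring. rewrite pow1.
        transitivity (((-1) ^ M * (-1) ^ M) * rad (2 * nat_sum 1 (h - 1) v + M)%nat); [ring|].
        rewrite pow_m1_sq. ring.
    + lia.
    + exact HN.
    + intros n Hn. apply Hlow. lia.
    + intros n Hn. rewrite Hrad by lia. ring.
    + replace (nat_sum (h - 1 + 1) (h - 1) (fun _ => O)) with O; [lia|].
      unfold nat_sum. replace (h - 1 + 1 - (h - 1 + 1))%nat with O by lia. reflexivity.
  - intros m' Hm'. apply (wbox_zero _ _ _ _ (fun _ => True)); auto.
    intros n _. rewrite lnum_total by auto. fold h. apply Hrad. lia.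
  - unfold nat_sum, update. simpl. lia.
Qed.

(** * Radial coefficients as Legendre functions *)

Lemma Csum_lt_ext (n : nat) (f g : nat -> C) :
  (forall i, (i < n)%nat -> f i = g i) -> Csum_lt n f = Csum_lt n g.
Proof.
  intros H. destruct n as [|n]; [reflexivity|]. apply sum_n_m_ext_loc.
  intros k Hk. apply H. lia.
Qed.

Definition legendre_factor (x : R) : R := sqrt (PI / 2) / sqrt (shx x).

(** Whipple's transformation exchanges the roles of degree and order: order [i + 1/2] becomes degree
    [i] of [legp]. The two sums are the parts [i >= n] and [i < n] of the sum in [low_bracket]. *)
Lemma legendre_bracket (n K : nat) (e x : R) : 0 < x < 1 -> (n <= K)%nat ->
  (RtoC ((e + 2 * harmonic (2 * K) - harmonic (K + n) - harmonic (K - n))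
         / (rfact (K - n) * rfact (K + n)))
   * LegendreQ (INR n - 1 / 2) (INR K + 1 / 2) (zx x)
   + RtoC (1 / rfact (K + n))
     * Csum_lt (K - n) (fun k =>
         RtoC ((2 * (INR n + INR k) + 1)
               / (rfact k * (INR K - INR n - INR k) * (INR K + INR n + INR k + 1))
               * (1 + rfact k * rfact (K + n) / (rfact (k + 2 * n) * rfact (K - n))))
         * LegendreQ (INR n - 1 / 2) (INR (n + k) + 1 / 2) (zx x))
   + RtoC (1 / rfact (K - n))
     * Csum_lt n (fun k =>
         RtoC ((2 * INR k + 1)
               / (rfact (n + k) * (INR K - INR k) * (INR K + INR k + 1)))
         * LegendreQ (INR n - 1 / 2) (INR k + 1 / 2) (zx x))
   = Ci * RtoC (legendre_factor x * ((-1) ^ K * x ^ n * low_bracket n K e (wx x))))%C.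
Proof.
  intros Hx Hn.
  rewrite (Csum_lt_rsum (K - n) Ci _ (fun k =>
    (rfact (K + n) * legendre_factor x * (-1) ^ K * x ^ n) * (dcoef K (n + k)
      * (fquot (n + k) n / rfact (K + n) + / rfact (K - n)) * legp n (n + k) (wx x)))).
  2:{ intros k Hk. rewrite LegendreQ_closed by auto. fold (legendre_factor x).
      assert (E : forall a b c : C, (a * (b * c) = b * (a * c))%C) by (intros; ring).
      rewrite E, <- RtoC_mult. do 2 f_equal. rewrite fquot_le by lia.
      replace (n + k - n)%nat with k by lia. replace (k + 2 * n)%nat with (n + k + n)%nat by lia.
      replace (n + (n + k))%nat with (n + k + n)%nat by lia.
      unfold dcoef. rewrite plus_INR.
      transitivity (legendre_factor x * (((-1) ^ K * (-1) ^ K) * (-1) ^ (n + k)) * x ^ n *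
        ((2 * (INR n + INR k) + 1) / ((INR K - INR n - INR k) * (INR K + INR n + INR k + 1)))
        * (rfact (n + k + n) / rfact k + rfact (K + n) / rfact (K - n)) * legp n (n + k) (wx x)).
      - rewrite pow_m1_sq.
        assert (INR n + INR k + 1 <= INR K)
          by (rewrite <- plus_INR, <- S_INR; apply le_INR; lia).
        pose proof (pos_INR n). pose proof (pos_INR k).
        field. repeat split; try apply rfact_neq_0; lra.
      - rewrite (pow_add (-1) K).
        assert (INR n + INR k + 1 <= INR K)
          by (rewrite <- plus_INR, <- S_INR; apply le_INR; lia).
        pose proof (pos_INR n). pose proof (pos_INR k).
        field. repeat split; try apply rfact_neq_0; lra. }
  rewrite (Csum_lt_rsum n Ci _ (fun k =>
    (rfact (K - n) * legendre_factor x * (-1) ^ K * x ^ n) * (dcoef K k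
      * (fquot k n / rfact (K + n) + / rfact (K - n)) * legp n k (wx x)))).
  2:{ intros k Hk. rewrite LegendreQ_closed by auto. fold (legendre_factor x).
      assert (E : forall a b c : C, (a * (b * c) = b * (a * c))%C) by (intros; ring).
      rewrite E, <- RtoC_mult. do 2 f_equal. rewrite fquot_gt by lia.
      unfold dcoef. rewrite (pow_add (-1) K).
      transitivity (legendre_factor x * (((-1) ^ K * (-1) ^ K) * (-1) ^ k) * x ^ n *
        ((2 * INR k + 1) / ((INR K - INR k) * (INR K + INR k + 1)))
        * legp n k (wx x)).
      - rewrite pow_m1_sq.
        assert (INR k + 1 <= INR K) by (rewrite <- S_INR; apply le_INR; lia).
        pose proof (pos_INR k).
        field. repeat split; try apply rfact_neq_0; lra.
      - assert (INR k + 1 <= INR K) by (rewrite <- S_INR; apply le_INR; lia).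
        pose proof (pos_INR k).
        field. repeat split; try apply rfact_neq_0; lra. }
  rewrite LegendreQ_closed by auto. fold (legendre_factor x).
  rewrite 2!rsum_scal.
  assert (E : forall a b c a' b' c' : R, (RtoC a * (Ci * RtoC b) + RtoC a' * (Ci * RtoC b')
    + RtoC c * (Ci * RtoC c') = Ci * RtoC (a * b + a' * b' + c * c'))%C).
  { intros. rewrite 2!RtoC_plus, 3!RtoC_mult. ring. }
  rewrite E. do 2 f_equal. unfold low_bracket.
  assert (ES : forall f, rsum K f = rsum n f + rsum (K - n) (fun i => f (n + i)%nat)).
  { intros f. rewrite <- rsum_add. f_equal. lia. }
  rewrite ES. rewrite (Nat.add_comm n K). field. rfact_nz.
Qed.

Lemma half_nat (lam : nat) : (2 * (lam + 1) / 2 = lam + 1)%nat.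
Proof. rewrite Nat.mul_comm, Nat.div_mul; lia. Qed.

(** Writing [d = 2 (lam + 1)] turns the factorials and parameters of the statement into those of
    [legendre_bracket] at [n = L + lam], [K = p + lam]. *)
Lemma low_degree_value (lam p L : nat) (rmax x : R) : 0 < x < 1 -> (L <= p)%nat ->
  low_degree_term (2 * (lam + 1)) p L rmax (zx x)
  = (Ci * RtoC (legendre_factor x * ((-1) ^ (p + lam) * x ^ (L + lam)
       * low_bracket (L + lam) (p + lam)
           (2 * ln rmax - harmonic (p + lam) + harmonic p) (wx x))))%C.
Proof.
  intros Hx HL. rewrite <- legendre_bracket by (auto; lia).
  unfold low_degree_term. cbv zeta. rewrite half_nat.
  fold (rfact (p - L)) (rfact (p + L + 2 * (lam + 1) - 2)).
  assert (Hd : INR (2 * (lam + 1)) = 2 * INR lam + 2)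
    by (rewrite mult_INR, plus_INR; simpl; ring).
  rewrite Hd.
  replace (p + lam - (L + lam))%nat with (p - L)%nat by lia.
  replace (p + L + 2 * (lam + 1) - 2)%nat with (p + lam + (L + lam))%nat by lia.
  replace (2 * p + 2 * (lam + 1) - 2)%nat with (2 * (p + lam))%nat by lia.
  replace (p + (lam + 1) - 1)%nat with (p + lam)%nat by lia.
  replace (L + (lam + 1) - 1)%nat with (L + lam)%nat by lia.
  replace (INR L + (2 * INR lam + 2 - 3) / 2) with (INR (L + lam) - 1 / 2)
    by (rewrite plus_INR; field).
  replace (INR p + (2 * INR lam + 2 - 1) / 2) with (INR (p + lam) + 1 / 2)
    by (rewrite plus_INR; field).
  apply (f_equal2 Cplus); [apply (f_equal2 Cplus)|].
  - do 3 f_equal. ring.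
  - f_equal. apply Csum_lt_ext. intros k Hk.
    fold (rfact k) (rfact (k + 2 * L + 2 * (lam + 1) - 2)).
    replace (k + 2 * L + 2 * (lam + 1) - 2)%nat with (k + 2 * (L + lam))%nat by lia.
    replace (p + k + L + 2 * (lam + 1) - 1)%nat with (p + lam + (L + lam) + k + 1)%nat by lia.
    replace (2 * L + 2 * k + 2 * (lam + 1) - 1)%nat with (2 * (L + lam + k) + 1)%nat by lia.
    replace (INR k + INR L + (2 * INR lam + 2 - 1) / 2) with (INR (L + lam + k) + 1 / 2)
      by (rewrite !plus_INR; field).
    assert (A1 : INR (2 * (L + lam + k) + 1) = 2 * (INR (L + lam) + INR k) + 1)
      by (rewrite plus_INR, mult_INR, (plus_INR (L + lam)); simpl; ring).
    assert (A2 : INR (p - k - L) = INR (p + lam) - INR (L + lam) - INR k)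
      by (rewrite 2!minus_INR, !plus_INR by lia; ring).
    assert (A3 : INR (p + lam + (L + lam) + k + 1)
                 = INR (p + lam) + INR (L + lam) + INR k + 1)
      by (rewrite (plus_INR _ 1), (plus_INR _ k), (plus_INR (p + lam)); reflexivity).
    rewrite A1, A2, A3. reflexivity.
  - f_equal. apply Csum_lt_ext. intros k Hk.
    replace (L + k + (lam + 1) - 1)%nat with (L + lam + k)%nat by lia. fold (rfact (L + lam + k)).
    replace (p + (lam + 1) - k - 1)%nat with (p + lam - k)%nat by lia.
    replace (p + k + (lam + 1))%nat with (p + lam + k + 1)%nat by lia.
    assert (A1 : INR (2 * k + 1) = 2 * INR k + 1)
      by (rewrite plus_INR, mult_INR; simpl; ring).
    assert (A2 : INR (p + lam + k + 1) = INR (p + lam) + INR k + 1)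
      by (rewrite (plus_INR _ 1), (plus_INR _ k); reflexivity).
    rewrite A1, A2, (minus_INR (p + lam) k) by lia. reflexivity.
Qed.

Lemma high_degree_value (lam p L : nat) (x : R) : 0 < x < 1 -> (p < L)%nat ->
  high_degree_term (2 * (lam + 1)) p L (zx x)
  = (Ci * RtoC (legendre_factor x * ((-1) ^ (p + lam) * x ^ (L + lam)
       * (rfact (L - p - 1) * legp (L + lam) (p + lam) (wx x)))))%C.
Proof.
  intros Hx HL. unfold high_degree_term.
  fold (rfact (L - p - 1)) (rfact (L + p + 2 * (lam + 1) - 2)).
  assert (Hd : INR (2 * (lam + 1)) = 2 * INR lam + 2)
    by (rewrite mult_INR, plus_INR; simpl; ring).
  rewrite Hd.
  replace (INR L + (2 * INR lam + 2 - 3) / 2) with (INR (L + lam) - 1 / 2)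
    by (rewrite plus_INR; field).
  replace (INR p + (2 * INR lam + 2 - 1) / 2) with (INR (p + lam) + 1 / 2)
    by (rewrite plus_INR; field).
  rewrite LegendreQ_closed by auto. fold (legendre_factor x).
  assert (E : forall a b c : C, (a * (b * c) = b * (a * c))%C) by (intros; ring).
  rewrite E, <- RtoC_mult. do 2 f_equal.
  replace (L + lam + (p + lam))%nat with (L + p + 2 * (lam + 1) - 2)%nat by lia.
  field. apply rfact_neq_0.
Qed.

Lemma fcoef_lp_low (n K : nat) (x c : R) : 0 < x < 1 -> (n <= K)%nat ->
  fcoef n (fun t => (zx x - cos t) ^ K * (ln (zx x - cos t) + c))
    (rfact K * shx x ^ K * (- x) ^ n * low_bracket n K (c - ln (2 * x)) (wx x)).
Proof.
  intros Hx Hn. assert (H := fcoef_lp n K x c Hx).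
  assert (Hx2 : x ^ 2 <> 1) by nra.
  rewrite dleg_low, leg_low in H by auto.
  match goal with |- fcoef _ _ ?v => match type of H with fcoef _ _ ?v' =>
    replace v with v'; [exact H|] end end.
  unfold low_bracket. fold (wx x). rewrite shx_pow by auto.
  assert ((2 * x) ^ K <> 0) by (apply pow_nonzero; lra).
  field. repeat split; auto; apply rfact_neq_0.
Qed.

(** * Geometry of generalized Hopf coordinates *)

Lemma hopf_tree (q : nat) (x : Tn (2 ^ q) R) (r : R) (theta phi rho : nat -> R) :
  (2 <= q)%nat -> hopf_coordinates q x r theta phi rho ->
  rho 1%nat = r /\ forall k, (1 <= k < 2 ^ (q - 1))%nat ->
    rho (2 * k)%nat = rho k * cos (theta k) /\ rho (2 * k + 1)%nat = rho k * sin (theta k).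
Proof.
  intros Hq H. destruct H as [_ _ _ H1 H2 H3 _ _]. rewrite pow2_half in H2, H3 by lia.
  split; auto. intros k Hk. split; [apply H2|apply H3]; lia.
Qed.

Lemma hopf_norm (q : nat) (x : Tn (2 ^ q) R) (r : R) (theta phi rho : nat -> R) :
  (2 <= q)%nat -> hopf_coordinates q x r theta phi rho ->
  rsum (2 ^ (q - 1)) (fun i => rho (2 ^ (q - 1) + i)%nat ^ 2) = r ^ 2.
Proof.
  intros Hq H. destruct (hopf_tree _ _ _ _ _ _ Hq H) as [H1 H2].
  pose proof (pow2_pos (q - 1)).
  assert (E := frontier_sum (fun k => rho k ^ 2) (fun _ => 0) (2 ^ (q - 1) - 1)).
  cbv beta in E. rewrite H1 in E. rewrite E.
  - rewrite (rsum_0 _ (fun _ => 0)) by auto.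
    replace (S (2 ^ (q - 1) - 1)) with (2 ^ (q - 1))%nat by lia. ring.
  - intros k Hk. destruct (H2 k ltac:(lia)) as [-> ->].
    assert (Hsc := sin_cos_sq (theta k)).
    replace (0 + (rho k * cos (theta k)) ^ 2 + (rho k * sin (theta k)) ^ 2)
      with (rho k ^ 2 * (cos (theta k) ^ 2 + sin (theta k) ^ 2)) by ring.
    rewrite Hsc. ring.
Qed.

Lemma hopf_weights (q : nat) (x x' : Tn (2 ^ q) R) (r r' : R)
    (theta theta' phi phi' rho rho' : nat -> R) (i : nat) :
  (2 <= q)%nat -> hopf_coordinates q x r theta phi rho ->
  hopf_coordinates q x' r' theta' phi' rho' -> (1 <= i < 2 ^ q)%nat ->
  rho i * rho' i = r * r' * cfd (actD theta theta') i.
Proof.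
  intros Hq H H'. destruct (hopf_tree _ _ _ _ _ _ Hq H) as [H1 H2].
  destruct (hopf_tree _ _ _ _ _ _ Hq H') as [H1' H2'].
  destruct (cfd_edges q (actD theta theta')) as [E1 E2].
  assert (Hd : (2 ^ q = 2 * 2 ^ (q - 1))%nat)
    by (rewrite <- Nat.pow_succ_r'; f_equal; lia).
  induction i as [i IH] using lt_wf_ind; intros Hi.
  destruct (Nat.eq_dec i 1) as [->|Hi1]; [rewrite H1, H1', E1; ring|].
  destruct (Nat.Even_or_Odd i) as [[k ->]|[k ->]].
  - destruct (H2 k ltac:(lia)) as [-> _]. destruct (H2' k ltac:(lia)) as [-> _].
    destruct (E2 k ltac:(lia)) as [-> _].
    transitivity (rho k * rho' k * (cos (theta k) * cos (theta' k))); [ring|].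
    rewrite IH by lia. simpl. ring.
  - destruct (H2 k ltac:(lia)) as [_ ->]. destruct (H2' k ltac:(lia)) as [_ ->].
    destruct (E2 k ltac:(lia)) as [_ ->].
    transitivity (rho k * rho' k * (sin (theta k) * sin (theta' k))); [ring|].
    rewrite IH by lia. simpl. ring.
Qed.

Lemma sum_n_m_pairs (f : nat -> R) (h : nat) :
  sum_n_m f 1 (2 * h) = rsum h (fun i => f (2 * i + 1)%nat + f (2 * i + 2)%nat).
Proof.
  induction h as [|h IH]; [rewrite sum_n_m_zero; [reflexivity|lia]|].
  replace (2 * S h)%nat with (S (S (2 * h))) by lia.
  rewrite 2!sum_n_Sm, IH, rsum_S by lia.
  replace (S (2 * h)) with (2 * h + 1)%nat by lia.
  replace (S (2 * h + 1)) with (2 * h + 2)%nat by lia.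
  match goal with |- plus (plus ?a ?b) ?c = ?e => change (a + b + c = e) end. ring.
Qed.

(** The squared distance without its term in [cos (phi_1 - phi_1')], computed in polar form in each
    coordinate plane and divided by [2 r r']. *)
Lemma hopf_chi (q : nat) (x x' : Tn (2 ^ q) R) (r r' : R)
    (theta theta' phi phi' rho rho' : nat -> R) :
  (2 <= q)%nat -> hopf_coordinates q x r theta phi rho ->
  hopf_coordinates q x' r' theta' phi' rho' -> 0 < r -> 0 < r' ->
  0 < rho (2 ^ q - 1)%nat -> 0 < rho' (2 ^ q - 1)%nat ->
  cfd (actD theta theta') (2 ^ q - 1)
    * chi x x' (rho (2 ^ q - 1)%nat) (rho' (2 ^ q - 1)%nat)
  = zeta r r' - rsum (2 ^ (q - 1) - 1) (fun i =>
      cfd (actD theta theta') (2 ^ q - (2 + i))%nat * cos (phi (2 + i)%nat - phi' (2 + i)%nat)).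
Proof.
  intros Hq H H' Hr Hr' HR HR'. pose proof (pow2_pos (q - 1)).
  assert (Hd : (2 ^ q = 2 * 2 ^ (q - 1))%nat)
    by (rewrite <- Nat.pow_succ_r'; f_equal; lia).
  set (cf := cfd (actD theta theta')).
  assert (Hw : forall i, (1 <= i < 2 ^ q)%nat -> rho i * rho' i = r * r' * cf i)
    by (intros; apply (hopf_weights q x x' r r' theta theta' phi phi' rho rho'); auto).
  assert (N := hopf_norm q x r theta phi rho Hq H).
  assert (N' := hopf_norm q x' r' theta' phi' rho' Hq H').
  set (h := (2 ^ (q - 1))%nat) in *.
  assert (ES : sum_n_m (fun j => (coord x j - coord x' j) ^ 2) 1 (2 ^ q - 2)
    = rsum (h - 1) (fun i => rho (h + i)%nat ^ 2) + rsum (h - 1) (fun i => rho' (h + i)%nat ^ 2)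
      - 2 * (r * r') * rsum (h - 1) (fun i =>
          cf (2 ^ q - (2 + i))%nat * cos (phi (2 + i)%nat - phi' (2 + i)%nat))).
  { replace (2 ^ q - 2)%nat with (2 * (h - 1))%nat by lia. rewrite sum_n_m_pairs.
    rewrite (rsum_rev (h - 1) (fun i => cf (2 ^ q - (2 + i))%nat * _)).
    rewrite <- rsum_scal, <- rsum_plus, <- rsum_minus. apply rsum_ext; intros i Hi.
    destruct H as [_ _ _ _ _ _ X1 X2], H' as [_ _ _ _ _ _ X1' X2'].
    rewrite pow2_half in X1, X2, X1', X2' by lia. fold h in X1, X2, X1', X2'.
    specialize (X1 (h + i)%nat ltac:(lia)). specialize (X2 (h + i)%nat ltac:(lia)).
    specialize (X1' (h + i)%nat ltac:(lia)). specialize (X2' (h + i)%nat ltac:(lia)).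
    replace (2 * (h + i) + 1 - 2 ^ q)%nat with (2 * i + 1)%nat in X1, X1' by lia.
    replace (2 * (h + i) + 2 - 2 ^ q)%nat with (2 * i + 2)%nat in X2, X2' by lia.
    rewrite X1, X2, X1', X2'.
    replace (2 + (h - 1 - 1 - i))%nat with (2 ^ q - (h + i))%nat by lia.
    replace (2 ^ q - (2 ^ q - (h + i)))%nat with (h + i)%nat by lia.
    set (a := phi (2 ^ q - (h + i))%nat). set (a' := phi' (2 ^ q - (h + i))%nat).
    rewrite cos_minus.
    transitivity (rho (h + i)%nat ^ 2 * (cos a ^ 2 + sin a ^ 2)
      + rho' (h + i)%nat ^ 2 * (cos a' ^ 2 + sin a' ^ 2)
      - 2 * (rho (h + i)%nat * rho' (h + i)%nat) * (cos a * cos a' + sin a * sin a')); [ring|].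
    rewrite 2!sin_cos_sq, Hw by lia. ring. }
  assert (HN : forall f : nat -> R, rsum h (fun i => f (h + i)%nat)
               = rsum (h - 1) (fun i => f (h + i)%nat) + f (2 ^ q - 1)%nat).
  { intros f. replace h with (S (h - 1)) at 1 by lia. rewrite rsum_S. f_equal. f_equal. lia. }
  rewrite (HN (fun i => rho i ^ 2)) in N. rewrite (HN (fun i => rho' i ^ 2)) in N'.
  unfold chi, zeta. rewrite ES.
  assert (HW := Hw (2 ^ q - 1)%nat ltac:(lia)).
  set (v := rsum (h - 1) (fun i => cf _ * _)) in *.
  set (R0 := rho (2 ^ q - 1)%nat) in *. set (R0' := rho' (2 ^ q - 1)%nat) in *.
  assert (Hcf : cf (2 ^ q - 1)%nat = R0 * R0' / (r * r')) by (rewrite HW; field; lra).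
  rewrite Hcf, <- N, <- N'. field. lra.
Qed.

Lemma zx_of_chi (X : R) : 1 < X ->
  let x := X - sqrt (X ^ 2 - 1) in
  0 < x < 1 /\ zx x = X /\ shx x = sqrt (X ^ 2 - 1) /\ / x = X + sqrt (X ^ 2 - 1).
Proof.
  intros HX x. assert (Hs : sqrt (X ^ 2 - 1) * sqrt (X ^ 2 - 1) = X ^ 2 - 1)
    by (apply sqrt_sqrt; nra).
  assert (Hp : 0 < sqrt (X ^ 2 - 1)) by (apply sqrt_lt_R0; nra).
  unfold x. set (s := sqrt (X ^ 2 - 1)) in *.
  assert (Hx : 0 < X - s) by nra.
  assert (Hx1 : X - s < 1) by nra.
  split; [auto|]. unfold zx, shx. repeat split.
  - apply (Rmult_eq_reg_r (2 * (X - s))); [|lra]. field_simplify; [|lra]. nra.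
  - apply (Rmult_eq_reg_r (2 * (X - s))); [|lra]. field_simplify; [|lra]. nra.
  - apply (Rmult_eq_reg_r (X - s)); [|lra]. rewrite Rinv_l by lra. nra.
Qed.

(** Everything is symmetric in [r] and [r'], so they may be named [a < c]. The last identity is
    [2 a c / (2 a / c) = c^2]. *)
Lemma radius_ratio (r r' : R) : 0 < r -> 0 < r' -> r <> r' ->
  let x := Rmin r r' / Rmax r r' in
  0 < x < 1 /\ zx x = zeta r r' /\
  shx x = (Rmax r r' ^ 2 - Rmin r r' ^ 2) / (2 * r * r') /\
  ln (2 * (r * r')) - ln (2 * x) = 2 * ln (Rmax r r').
Proof.
  intros Hr Hr' Hne x.
  assert (H : exists a c, 0 < a /\ a < c /\ Rmin r r' = a /\ Rmax r r' = c /\ r * r' = a * c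
                     /\ r ^ 2 + r' ^ 2 = a ^ 2 + c ^ 2).
  { destruct (Rtotal_order r r') as [H|[H|H]]; [|contradiction|].
    - exists r, r'. rewrite Rmin_left, Rmax_right by lra. repeat split; lra.
    - exists r', r. rewrite Rmin_right, Rmax_left by lra. repeat split; lra. }
  destruct H as [a [c [Ha [Hc [E1 [E2 [E3 E4]]]]]]].
  unfold x. rewrite E1, E2. unfold zx, shx, zeta. rewrite (Rmult_assoc 2 r r'), E3, E4.
  repeat split.
  - apply Rdiv_lt_0_compat; lra.
  - apply (Rmult_lt_reg_r c); [lra|]. unfold Rdiv. rewrite Rmult_assoc, Rinv_l; lra.
  - field. lra.
  - field. lra.
  - assert (0 < a / c) by (apply Rdiv_lt_0_compat; lra).
    assert (0 < / c) by (apply Rinv_0_lt_compat; lra).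
    unfold Rdiv. rewrite (ln_mult 2 (a * c)), (ln_mult a c), (ln_mult 2 (a * / c)),
      (ln_mult a (/ c)), ln_Rinv by (try nra; lra).
    ring.
Qed.

Definition radial (x ell : R) (p lam L : nat) : R :=
  if Nat.leb L p then
    (-2) ^ lam * rfact p * shx x ^ (p + lam) * (- x) ^ (L + lam)
     * low_bracket (L + lam) (p + lam)
         (ell - ln (2 * x) - harmonic (p + lam) + harmonic p) (wx x)
  else
    (-2) ^ lam * rfact p * shx x ^ (p + lam) * (- x) ^ (L + lam)
     * ((-1) ^ (L - p - 1) * rfact (L - p - 1) * legp (L + lam) (p + lam) (wx x)).

Lemma radial_rser (x ell : R) (p lam L : nat) : 0 < x < 1 ->
  rser (fun s => fweight (lpc (zx x) ell p) s * kap lam s L) (radial x ell p lam L).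
Proof.
  intros Hx. unfold radial, fweight.
  apply rser_ext with (fun s => lpc (zx x) ell p s * (rfact s / 2 ^ s * kap lam s L));
    [intros; ring|].
  destruct (Nat.leb_spec L p); [apply radial_coef_low|apply radial_coef_high]; auto.
Qed.

(** The factor between the Legendre terms of the statement and [radial]. It is the same for all [L];
    only the sign differs, [(-1)^L] for [L <= p] and [(-1)^(p+1)] above, which explains the signs in
    front of the two multi-sums. *)
Definition radial_scale (x : R) (p lam : nat) : R :=
  legendre_factor x * (-1) ^ (p + lam) / (2 ^ lam * rfact p * shx x ^ (p + lam)).

Lemma pow_neg (x : R) (n : nat) : (- x) ^ n = (-1) ^ n * x ^ n.
Proof. replace (- x) with (-1 * x) by ring. apply Rpow_mult_distr. Qed.

Lemma radial_low_term (x ell rmax : R) (p lam L : nat) : 0 < x < 1 -> (L <= p)%nat ->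
  ell - ln (2 * x) = 2 * ln rmax ->
  low_degree_term (2 * (lam + 1)) p L rmax (zx x)
  = (Ci * RtoC (radial_scale x p lam) * RtoC ((-1) ^ L * radial x ell p lam L))%C.
Proof.
  intros Hx HL Hell. rewrite low_degree_value by auto.
  rewrite <- Cmult_assoc, <- RtoC_mult. do 2 f_equal.
  unfold radial, radial_scale. apply Nat.leb_le in HL as HL'. rewrite HL', Hell.
  assert (Hs := shx_pos x Hx).
  assert (shx x ^ (p + lam) <> 0) by (apply pow_nonzero; lra).
  assert (2 ^ lam <> 0) by (apply pow_nonzero; lra).
  rewrite pow_neg. replace (-2) with (-(2)) by ring. rewrite (pow_neg 2).
  rewrite (pow_add (-1) L lam).
  match goal with |- _ = ?r => replace r with
    (((-1) ^ L * (-1) ^ L) * ((-1) ^ lam * (-1) ^ lam) * (legendre_factor x *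
     ((-1) ^ (p + lam) * x ^ (L + lam) *
      low_bracket (L + lam) (p + lam) (2 * ln rmax - harmonic (p + lam) + harmonic p) (wx x))))
    by (field; repeat split; auto; apply rfact_neq_0) end.
  rewrite 2!pow_m1_sq. ring.
Qed.

Lemma radial_high_term (x ell : R) (p lam L : nat) : 0 < x < 1 -> (p < L)%nat ->
  high_degree_term (2 * (lam + 1)) p L (zx x)
  = (Ci * RtoC (radial_scale x p lam) * RtoC ((-1) ^ (p + 1)) * RtoC (radial x ell p lam L))%C.
Proof.
  intros Hx HL. rewrite high_degree_value by auto.
  rewrite <- 2!Cmult_assoc, <- 2!RtoC_mult. do 2 f_equal.
  unfold radial, radial_scale. apply Nat.leb_gt in HL as HL'. rewrite HL'.
  assert (Hs := shx_pos x Hx).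
  assert (shx x ^ (p + lam) <> 0) by (apply pow_nonzero; lra).
  assert (2 ^ lam <> 0) by (apply pow_nonzero; lra).
  rewrite pow_neg. replace (-2) with (-(2)) by ring. rewrite (pow_neg 2).
  rewrite (pow_add (-1) L lam).
  replace ((-1) ^ L) with ((-1) ^ (L - p - 1) * (-1) ^ (p + 1))
    by (rewrite <- pow_add; f_equal; lia).
  match goal with |- _ = ?r => replace r with
    (((-1) ^ (L - p - 1) * (-1) ^ (L - p - 1)) * ((-1) ^ (p + 1) * (-1) ^ (p + 1))
     * ((-1) ^ lam * (-1) ^ lam) * (legendre_factor x *
     ((-1) ^ (p + lam) * x ^ (L + lam) *
      (rfact (L - p - 1) * legp (L + lam) (p + lam) (wx x)))))
    by (field; repeat split; auto; apply rfact_neq_0) end.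
  rewrite 3!pow_m1_sq. ring.
Qed.

Lemma Rpower_half_integer (a : R) (n : nat) : 0 < a -> Rpower a (INR n + / 2) = a ^ n * sqrt a.
Proof. intros Ha. rewrite Rpower_plus, Rpower_pow, Rpower_half by auto. auto. Qed.

Lemma tree_box_plus (N q : nat) (wm : nat -> (nat -> nat) -> R) (D : nat -> node_data)
    (G G1 G2 : nat -> R) (m n : nat -> nat) : (forall L, G L = G1 L + G2 L) ->
  tree_box N q wm D G m n = tree_box N q wm D G1 m n + tree_box N q wm D G2 m n.
Proof.
  intros H. unfold tree_box.
  rewrite <- (Rmult_1_l (wbox N _ wm (fun m => wbox N _ _ (fun n => G1 _) n) m)).
  rewrite <- (Rmult_1_l (wbox N _ wm (fun m => wbox N _ _ (fun n => G2 _) n) m)).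
  rewrite <- wbox_lin. apply wbox_ext; auto. intros m'. cbv beta.
  rewrite <- wbox_lin. apply wbox_ext; auto. intros n'. rewrite H. ring.
Qed.

Lemma radial_scale_neq_0 (x : R) (p lam : nat) : 0 < x < 1 -> radial_scale x p lam <> 0.
Proof.
  intros Hx. assert (Hs := shx_pos x Hx). unfold radial_scale, legendre_factor.
  assert (0 < sqrt (PI / 2)) by (apply sqrt_lt_R0; pose proof PI_RGT_0; lra).
  assert (0 < sqrt (shx x)) by (apply sqrt_lt_R0; auto).
  assert (shx x ^ (p + lam) <> 0) by (apply pow_nonzero; lra).
  assert (2 ^ lam <> 0) by (apply pow_nonzero; lra).
  assert ((-1) ^ (p + lam) <> 0) by (apply pow_nonzero; lra).
  pose proof (rfact_neq_0 p).
  unfold Rdiv. repeat (apply Rmult_integral_contrapositive_currified); auto; try lra;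
    apply Rinv_neq_0_compat; try lra.
  repeat (apply Rmult_integral_contrapositive_currified); auto.
Qed.

Lemma Ci_scale_inj (s a b : R) : s <> 0 ->
  (Ci * RtoC s * RtoC a = Ci * RtoC s * RtoC b)%C -> a = b.
Proof.
  intros Hs H. apply (f_equal snd) in H. simpl in H.
  apply (Rmult_eq_reg_l s); auto. lra.
Qed.

Lemma fourier_value (m p : nat) (z v k X ell : R) : 1 < X -> 0 < k -> k * X = z - v ->
  (m <= p)%nat ->
  let x := X - sqrt (X ^ 2 - 1) in
  fcoef m (fun t => (z - (v + k * cos t)) ^ p * (ln (z - (v + k * cos t)) + ell))
    (k ^ p * (rfact p * shx x ^ p * (- x) ^ m
       * low_bracket m p (ln k + ell - ln (2 * x)) (wx x))).
Proof.
  intros HX Hk E Hm x. destruct (zx_of_chi X HX) as [Hx [Hz _]]. fold x in Hx, Hz.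
  eapply fcoef_ext; [|apply fcoef_scal, (fcoef_lp_low m p x (ln k + ell)); auto].
  intros t. cbv beta. rewrite Hz.
  replace (z - (v + k * cos t)) with (k * (X - cos t)) by lra.
  assert (Hc := COS_bound t). rewrite ln_mult, Rpow_mult_distr by lra. ring.
Qed.

Lemma circle_legendre (m p : nat) (e X : R) : 1 < X -> (m <= p)%nat ->
  let x := X - sqrt (X ^ 2 - 1) in
  (RtoC (1 / (INR (fact (p + m)) * INR (fact (p - m)))
         * (e + 2 * harmonic (2 * p) - harmonic (p + m) - harmonic (p - m)))
   * LegendreQ (INR m - 1 / 2) (INR p + 1 / 2) X
   + RtoC (1 / INR (fact (p + m)))
     * Csum_lt (p - m) (fun k =>
         RtoC (INR (2 * m + 2 * k + 1)
               / (INR (fact k) * INR (p - m - k) * INR (p + m + k + 1))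
               * (1 + INR (fact k) * INR (fact (p + m))
                      / (INR (fact (2 * m + k)) * INR (fact (p - m)))))
         * LegendreQ (INR m - 1 / 2) (INR m + INR k + 1 / 2) X)
   + RtoC (1 / INR (fact (p - m)))
     * Csum_lt m (fun k =>
         RtoC (INR (2 * k + 1)
               / (INR (fact (m + k)) * INR (p - k) * INR (p + k + 1)))
         * LegendreQ (INR m - 1 / 2) (INR k + 1 / 2) X)
   = Ci * RtoC (legendre_factor x * ((-1) ^ p * x ^ m * low_bracket m p e (wx x))))%C.
Proof.
  intros HX Hm x. destruct (zx_of_chi X HX) as [Hx [Hz _]]. fold x in Hx, Hz.
  rewrite <- legendre_bracket, Hz by auto.
  fold (rfact (p + m)) (rfact (p - m)).
  apply (f_equal2 Cplus); [apply (f_equal2 Cplus)|].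
  - do 2 f_equal. unfold Rdiv. rewrite (Rmult_comm (rfact (p - m))). ring.
  - f_equal. apply Csum_lt_ext. intros k Hk. fold (rfact k) (rfact (2 * m + k)).
    rewrite (Nat.add_comm (2 * m) k).
    rewrite (plus_INR m k).
    assert (A1 : INR (2 * m + 2 * k + 1) = 2 * (INR m + INR k) + 1)
      by (rewrite 2!plus_INR, 2!mult_INR; simpl; ring).
    assert (A2 : INR (p - m - k) = INR p - INR m - INR k) by (rewrite 2!minus_INR by lia; ring).
    assert (A3 : INR (p + m + k + 1) = INR p + INR m + INR k + 1)
      by (rewrite 3!plus_INR; reflexivity).
    rewrite A1, A2, A3. reflexivity.
  - f_equal. apply Csum_lt_ext. intros k Hk. fold (rfact (m + k)).
    assert (A1 : INR (2 * k + 1) = 2 * INR k + 1)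
      by (rewrite plus_INR, mult_INR; simpl; ring).
    assert (A2 : INR (p + k + 1) = INR p + INR k + 1)
      by (rewrite 2!plus_INR; reflexivity).
    rewrite A1, A2, (minus_INR p k) by lia. reflexivity.
Qed.

Theorem theorem7p9 :
  forall (q p m : nat) (x x' : Tn (2 ^ q) R) (r r' : R)
    (theta theta' phi phi' rho rho' : nat -> R),
  (2 <= q)%nat -> (m <= p)%nat ->
  hopf_coordinates q x r theta phi rho ->
  hopf_coordinates q x' r' theta' phi' rho' ->
  let d := (2 ^ q)%nat in
  let R0 := rho (d - 1)%nat in
  let R0' := rho' (d - 1)%nat in
  0 < r -> 0 < r' -> 0 < R0 -> 0 < R0' -> r <> r' ->
  let X := chi x x' R0 R0' in
  let Z := zeta r r' in
  let rmax := Rmax r r' in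
  let rmin := Rmin r r' in
  exists S2 : C,
  is_second_multisum q p m theta theta' phi phi' Z S2 /\
  (RtoC (1 / (INR (fact (p + m)) * INR (fact (p - m)))
         * (ln (R0 * R0') + ln (X + sqrt (X ^ 2 - 1)) + 2 * harmonic (2 * p)
            - harmonic (p + m) - harmonic (p - m)))
   * LegendreQ (INR m - 1 / 2) (INR p + 1 / 2) X
   + RtoC (1 / INR (fact (p + m)))
     * Csum_lt (p - m) (fun k =>
         RtoC (INR (2 * m + 2 * k + 1)
               / (INR (fact k) * INR (p - m - k) * INR (p + m + k + 1))
               * (1 + INR (fact k) * INR (fact (p + m))
                      / (INR (fact (2 * m + k)) * INR (fact (p - m)))))
         * LegendreQ (INR m - 1 / 2) (INR m + INR k + 1 / 2) X)
   + RtoC (1 / INR (fact (p - m)))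
     * Csum_lt m (fun k =>
         RtoC (INR (2 * k + 1)
               / (INR (fact (m + k)) * INR (p - k) * INR (p + k + 1)))
         * LegendreQ (INR m - 1 / 2) (INR k + 1 / 2) X)
   = RtoC ((-1) ^ (m + d / 2 - 1) * 2 ^ (d / 2 - 1)
           * (r * r' / (R0 * R0')) ^ p
           * Rpower (X ^ 2 - 1) (- (INR p / 2) - 1 / 4)
           * Rpower ((rmax ^ 2 - rmin ^ 2) / (2 * r * r')) (INR p + (INR d - 1) / 2))
     * (first_multisum q p m theta theta' phi phi' rmax Z
        + RtoC ((-1) ^ (p + 1)) * S2))%C.
Proof.
  intros q p m x x' r r' theta theta' phi phi' rho rho' Hq Hm H H' d R0 R0'
    Hr Hr' HR HR' Hne X Z rmax rmin.
  pose proof (pow2_pos (q - 1)) as Hh.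
  assert (Hd : (2 ^ q = 2 * 2 ^ (q - 1))%nat)
    by (rewrite <- Nat.pow_succ_r'; f_equal; lia).
  assert (H2h : (2 <= 2 ^ (q - 1))%nat).
  { replace (q - 1)%nat with (S (q - 2)) by lia. rewrite Nat.pow_succ_r'.
    pose proof (pow2_pos (q - 2)). lia. }
  set (h := (2 ^ (q - 1))%nat) in *. set (lam := (h - 1)%nat).
  assert (Hdl : (d = 2 * (lam + 1))%nat) by (unfold d, lam; lia).
  assert (Hlam : lamk q 1 = lam) by (unfold lamk, lam, h; rewrite Nat.sub_0_r; reflexivity).
  destruct (radius_ratio r r' Hr Hr' Hne) as [Hx [HZ [Hsh Hell]]].
  (* [ell] is the logarithm of the factor in [|x - x'|^2 = 2 r r' (Z - y)]. *)
  set (xr := Rmin r r' / Rmax r r') in *. set (ell := ln (2 * (r * r'))) in *.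
  fold Z in HZ. fold rmax rmin in Hsh. fold rmax in Hell.
  assert (HZ1 : 1 < Z) by (rewrite <- HZ; apply zx_gt_1; auto).
  set (psi := fun j => phi j - phi' j).
  set (D := actD theta theta').
  set (m0 := update (fun _ => O) 1 m). set (n0 := fun _ : nat => O).
  set (b := lpc Z ell p).
  assert (Hb : psum Z b (fun u => (Z - u) ^ p * (ln (Z - u) + ell)))
    by (apply psum_lpc; lra).
  set (rad := radial xr ell p lam).
  assert (Hrad : forall L, rser (fun s => fweight b s * kap (lamk q 1) s L) (rad L)).
  { intros L. rewrite Hlam. unfold b. rewrite <- HZ. apply radial_rser; auto. }
  (* The complete tree sum splits by total degree: [radlo] gives the finite multi-sum, [radhi] the
     infinite one. *)
  set (radlo := fun L => if Nat.leb L p then rad L else 0).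
  set (radhi := fun L => if Nat.leb L p then 0 else rad L).
  destruct (bounded_coef_1 Z b HZ1 (proj2 Hb)) as [B HB].
  assert (Hhi : forall L, Rabs (radhi L) <= majc b (lamk q 1) L).
  { intros L. unfold radhi. destruct (Nat.leb L p).
    - rewrite Rabs_R0. apply (majc_nonneg b _ _ B HB).
    - eapply rser_abs_le; [|apply Hrad|apply (majc_rser b (lamk q 1) L B HB)].
      intros s. cbv beta. rewrite Rabs_mult, Rabs_fweight, (Rabs_right (kap _ _ _)); [lra|].
      apply Rle_ge, kap_nonneg. }
  set (c0 := (Ci * RtoC (radial_scale xr p lam))%C).
  destruct (tree_multiseries q theta theta' psi Z b radhi (c0 * RtoC ((-1) ^ (p + 1)))%C
    (fun ms k ns => if Nat.eqb k 1 then
              Z.to_nat (Z.max 0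
                ((Z.of_nat p - Z.of_nat (nat_sum 1 h ms)
                  - 2 * Z.of_nat (nat_sum 2 (h - 1) ns)) / 2 + 1))
            else 0%nat)
    (fun ms ns s' => s' = high_degree_term d p (2 * nat_sum 1 (h - 1) ns + nat_sum 1 h ms) Z)
    m0 n0 Hq HZ1 (proj2 Hb) Hhi) as [T [HS1 HS2]].
  { intros ms k ns Hk. destruct (Nat.eqb_spec k 1); [lia|auto]. }
  (* An index below the lower limit of the innermost series has total degree at most [p], so [radhi]
     vanishes there; the next block is the converse. *)
  { intros ms ns i Hi. rewrite Nat.eqb_refl in Hi. unfold radhi.
    rewrite lnum_total by auto. fold h. rewrite nat_sum_first, update_eq, nat_sum_update by lia.
    change (1 + 1)%nat with 2%nat.
    destruct (Nat.leb_spec (2 * (i + nat_sum 2 (h - 1) ns) + nat_sum 1 h ms) p); auto.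
    exfalso. Z.div_mod_to_equations. lia. }
  { intros ms ns i Hi. rewrite Nat.eqb_refl in Hi.
    rewrite <- HZ, Hdl. unfold radhi. rewrite lnum_total by auto. fold h.
    assert (Hp : (p < 2 * nat_sum 1 (h - 1) (update ns 1 i) + nat_sum 1 h ms)%nat).
    { rewrite nat_sum_first, update_eq, nat_sum_update by lia. change (1 + 1)%nat with 2%nat.
      Z.div_mod_to_equations. lia. }
    rewrite (radial_high_term xr ell) by auto. apply Nat.leb_gt in Hp. rewrite Hp. reflexivity. }
  destruct (tree_box_value q theta theta' psi Z b _ rad m0 n0 Hq HZ1 Hb Hrad) as [V [HV1 HV2]].
  exists (c0 * RtoC ((-1) ^ (p + 1)) * RtoC T)%C. split.
  { unfold is_second_multisum. cbv zeta. rewrite pow2_half by lia. fold h.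
    assert (EP : forall ms, (fun k ns => Psi q theta theta' ms ns k)
                 = (fun k ns => tree_weight q (actD theta theta') ms k ns)).
    { intros ms. do 2 (apply functional_extensionality; intro). apply Psi_tree_weight. }
    match type of HS1 with is_multiseries _ _ _ ?F _ _ =>
      match goal with |- is_multiseries _ _ _ ?F' _ _ => replace F' with F end end.
    - exact HS1.
    - apply functional_extensionality; intro ms. rewrite EP. reflexivity. }
  assert (Hfirst : forall N, (p < N)%nat ->
    first_multisum q p m theta theta' phi phi' rmax Z
    = (c0 * RtoC (tree_box N q (azim psi) D radlo m0 n0))%C).
  { intros N HN. apply first_multisum_value; auto.
    - intros L HL. change (2 ^ q)%nat with d. rewrite Hdl, <- HZ.
      rewrite (radial_low_term xr ell rmax p lam L) by auto. unfold radlo, c0.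
      apply Nat.leb_le in HL. rewrite HL. auto.
    - intros L HL. unfold radlo. apply Nat.leb_gt in HL. rewrite HL. auto. }
  assert (HVT : V = tree_box (p + 1) q (azim psi) D radlo m0 n0 + T).
  { apply (is_lim_seq_unique2 (fun N => tree_box (N + (p + 1)) q (azim psi) D rad m0 n0)).
    - apply (is_lim_seq_incr_n (fun N => tree_box N q (azim psi) D rad m0 n0)). exact HV1.
    - apply is_lim_seq_ext with (fun N => tree_box (p + 1) q (azim psi) D radlo m0 n0
        + tree_box (N + (p + 1)) q (azim psi) D radhi m0 n0).
      + intros N. rewrite (tree_box_plus _ _ _ _ rad radlo radhi).
        (* The low part does not depend on the cutoff once this exceeds [p]: times the nonzero
           factor [c0], every such box equals the same finite multi-sum. *)
        * f_equal. apply (Ci_scale_inj (radial_scale xr p lam));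
            [apply radial_scale_neq_0; auto|].
          fold c0. rewrite <- 2!Hfirst by lia. reflexivity.
        * intros L. unfold radlo, radhi. destruct (Nat.leb L p); ring.
      + apply (is_lim_seq_plus' (fun _ => _)); [apply is_lim_seq_const|].
        apply (is_lim_seq_incr_n (fun N => tree_box N q (azim psi) D radhi m0 n0)). exact HS2. }
  set (kap0 := cfd D (2 ^ q - 1)) in *.
  set (v := rsum (2 ^ (q - 1) - 1) _) in HV2.
  assert (HW : R0 * R0' = r * r' * kap0)
    by (apply (hopf_weights q x x' r r' theta theta' phi phi' rho rho'); auto; lia).
  assert (Hk0 : 0 < kap0).
  { apply (Rmult_lt_reg_l (r * r')); [nra|]. rewrite <- HW. nra. }
  assert (HX : kap0 * X = Z - v).
  { apply (hopf_chi q x x' r r' theta theta' phi phi' rho rho'); auto. }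
  (* From [|v| + kap0 <= 1 < Z] follows [kap0 X = Z - v > kap0]; so the two circles with parameters
     [X] and [Z] can be treated alike. *)
  assert (HX1 : 1 < X).
  { assert (B1 := cfd_act_bound q theta theta' psi Hq). fold D in B1.
    fold h in B1. change (rsum (h - 1) _) with v in B1. fold kap0 in B1.
    rewrite (Rabs_right kap0) in B1 by lra. pose proof (Rle_abs v).
    apply (Rmult_lt_reg_l kap0); auto. lra. }
  (* The two computations meet here: [V], the limit of the tree sums, and the closed form on the
     circle are the same Fourier coefficient. *)
  assert (HV : V = _) by (eapply fcoef_unique;
    [exact HV2|exact (fourier_value m p Z v kap0 X ell HX1 Hk0 HX Hm)]).
  rewrite circle_legendre by auto.
  destruct (zx_of_chi X HX1) as [Hx1 [Hzx [Hshx Hinv]]].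
  set (x1 := X - sqrt (X ^ 2 - 1)) in *.
  rewrite (Hfirst (p + 1)%nat) by lia.
  assert (HE : ln (R0 * R0') + ln (X + sqrt (X ^ 2 - 1)) = ln kap0 + ell - ln (2 * x1)).
  { assert (0 < r * r') by nra. unfold ell.
    rewrite <- Hinv, ln_Rinv, HW, (ln_mult (r * r')),
      (ln_mult 2 (r * r')), (ln_mult 2 x1) by (try nra; lra). ring. }
  rewrite HE. set (lb := low_bracket m p _ _) in *.
  set (A := tree_box (p + 1) q (azim psi) D radlo m0 n0) in *.
  (* Here [e] is [(-1)^(p+1)]: the sign in front of the second multi-sum cancels the one carried by
     its terms. *)
  assert (EC : forall a s e t w : R, e * e = 1 ->
    (RtoC w * (Ci * RtoC s * RtoC a + RtoC e * (Ci * RtoC s * RtoC e * RtoC t))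
     = Ci * RtoC (w * (s * (a + t))))%C).
  { intros a s e t w He.
    replace (w * (s * (a + t))) with (w * (s * (a + e * e * t))) by (rewrite He; ring).
    rewrite !RtoC_mult, RtoC_plus, !RtoC_mult. ring. }
  unfold c0. rewrite EC by apply pow_m1_sq. do 2 f_equal. rewrite <- HVT, HV.
  assert (Ed : (d / 2 = lam + 1)%nat) by (rewrite Hdl; apply half_nat). rewrite Ed.
  replace (m + (lam + 1) - 1)%nat with (m + lam)%nat by lia.
  replace (lam + 1 - 1)%nat with lam by lia.
  assert (HdR : INR d = 2 * INR lam + 2)
    by (rewrite Hdl, mult_INR, plus_INR; simpl; ring).
  assert (Hs := shx_pos xr Hx). assert (Hs1 := shx_pos x1 Hx1).
  assert (P2 : Rpower ((rmax ^ 2 - rmin ^ 2) / (2 * r * r')) (INR p + (INR d - 1) / 2)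
               = shx xr ^ (p + lam) * sqrt (shx xr)).
  { rewrite <- Hsh, <- Rpower_half_integer by auto. f_equal. rewrite HdR, plus_INR. field. }
  assert (P1 : Rpower (X ^ 2 - 1) (- (INR p / 2) - 1 / 4) = / (shx x1 ^ p * sqrt (shx x1))).
  { rewrite <- Hzx, zx_shx, <- Rpower_half_integer, <- Rpower_Ropp by auto.
    replace (shx x1 ^ 2) with (Rpower (shx x1) 2)
      by (rewrite <- Rpower_pow by auto; f_equal; simpl; ring).
    rewrite Rpower_mult. f_equal. field. }
  assert (HK : r * r' / (R0 * R0') = / kap0) by (rewrite HW; field; nra).
  rewrite P1, P2, HK, pow_inv. unfold radial_scale, legendre_factor.
  assert (N1 : shx xr ^ (p + lam) <> 0) by (apply pow_nonzero; lra).
  assert (N2 : shx x1 ^ p <> 0) by (apply pow_nonzero; lra).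
  assert (N3 : kap0 ^ p <> 0) by (apply pow_nonzero; lra).
  assert (N4 : 2 ^ lam <> 0) by (apply pow_nonzero; lra).
  assert (N5 : sqrt (shx xr) <> 0) by (apply Rgt_not_eq, sqrt_lt_R0; auto).
  assert (N6 : sqrt (shx x1) <> 0) by (apply Rgt_not_eq, sqrt_lt_R0; auto).
  rewrite pow_neg, 2!(pow_add (-1)).
  transitivity (sqrt (PI / 2) / sqrt (shx x1) * (((-1) ^ m * (-1) ^ m)
    * ((-1) ^ lam * (-1) ^ lam) * ((-1) ^ p * x1 ^ m * lb))).
  { rewrite 2!pow_m1_sq. ring. }
  field. repeat split; auto. apply rfact_neq_0.
Qed.
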